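(* Let $(\gamma,\nu,\alpha,\beta)$ satisfy $\gamma>1$, $0<\delta=(\gamma-1)\nu<1$, $\alpha>0$, $2\alpha+3\beta\ge0$, $4\gamma+3\delta\le7$. Let the initial data $(\rho_0,u_0,S_0)$ satisfy, for some $q\in(3,\infty)$, $$\rho_0>0,\quad \rho_0^{\gamma-1}\in D^1_*\cap D^3,\quad \nabla\rho_0^{\delta-1}\in L^q\cap D^{1,3}\cap D^2,\quad \nabla\rho_0^{\frac{\delta-1}{2}}\in L^6,\quad u_0\in H^3,\quad S_0-\bar S\in D^1_*\cap D^3,$$ and $$\nabla u_0=\rho_0^{\frac{1-\delta}{2}}g_1,\quad Lu_0=\rho_0^{1-\delta}g_2,\quad \nabla(\rho_0^{\delta-1}Lu_0)=\rho_0^{\frac{1-\delta}{2}}g_3,\quad \nabla^2e^{\frac{S_0}{c_v}}=\rho_0^{\frac{1-\delta}{2}}g_4$$ for some $g_1,g_2,g_3,g_4\in L^2$. Assume in addition that $0<m(0)<\infty$ and $|\mathbb{P}(0)|>0$. Then there is no global regular solution $(\rho,u,S)$ to the Cauchy problem (CP) with the regularities (R) that satisfies $$\limsup_{t\to\infty}|u(t,\cdot)|_{L^\infty(\mathbb{R}^3)}=0.$$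
   Context: Function spaces on $\mathbb{R}^3$: $L^p$, $H^s$ are standard; $D^{k,r}=\{f\in L^1_{loc}: |\nabla^k f|_{L^r}<\infty\}$, $D^k=D^{k,2}$, $D^1_*=\{f\in L^6:\nabla f\in L^2\}$. Constants: $A>0$, $R>0$, $c_v=R/(\gamma-1)$, $\delta=(\gamma-1)\nu$, and a constant $\bar S\in\mathbb{R}$. Pressure $P=Ae^{S/c_v}\rho^\gamma$. Define $$Q(u)=\alpha(\nabla u+(\nabla u)^\top)+\beta\,\mathrm{div}u\,\mathbb{I}_3,\quad H(u)=\mathrm{div}(uQ(u))-u\cdot\mathrm{div}Q(u),\quad Lu=-\alpha\Delta u-(\alpha+\beta)\nabla\mathrm{div}u.$$ The Cauchy problem (CP): $$\begin{cases}\rho_t+\mathrm{div}(\rho u)=0,\\ (\rho u)_t+\mathrm{div}(\rho u\otimes u)+\nabla P=A^\nu R^{-\nu}\mathrm{div}(\rho^\delta e^{\frac{S}{c_v}\nu}Q(u)),\\ P(S_t+u\cdot\nabla S)=A^\nu R^{1-\nu}\rho^\delta e^{\frac{S}{c_v}\nu}H(u),\end{cases}$$ with $(\rho,u,S)|_{t=0}=(\rho_0,u_0,S_0)$ on $\mathbb{R}^3$ and $(\rho,u,S)(t,x)\to(0,0,\bar S)$ as $|x|\to\infty$ for $t\ge0$. Regular solution: for finite $T>0$, $(\rho,u,S)$ is a regular solution to (CP) in $[0,T]\times\mathbb{R}^3$ if it satisfies (CP) in the sense of distributions and (i) $\rho>0$, $\rho^{\gamma-1}\in C([0,T];D^1_*\cap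 D^3)$, $\nabla\rho^{\delta-1}\in C([0,T];L^\infty\cap D^2)$; (ii) $u\in C([0,T];H^3)\cap L^2([0,T];H^4)$, $\rho^{\frac{\delta-1}{2}}\nabla u\in C([0,T];L^2)$, $\rho^{\delta-1}\nabla u\in L^\infty([0,T];D^1_* )$, $\rho^{\delta-1}\nabla^2u\in L^\infty([0,T];H^1)\cap L^2([0,T];D^2)$; (iii) $S\in L^\infty([0,T]\times\mathbb{R}^3)$, $e^{\frac{S}{c_v}}-e^{\frac{\bar S}{c_v}}\in C([0,T];D^1_*\cap D^3)$. Regularities (R) on $[0,T]$: $(\rho^{\gamma-1})_t\in C([0,T];H^2)$, $u_t\in C([0,T];H^1)\cap L^2([0,T];D^2)$, $t^{\frac12}u\in L^\infty([0,T];D^4)$, $t^{\frac12}u_t\in L^\infty([0,T];D^2)\cap L^2([0,T];D^3)$, $u_{tt}\in L^2([0,T];L^2)$, $t^{\frac12}u_{tt}\in L^\infty([0,T];L^2)\cap L^2([0,T];D^1_* )$, $\nabla\rho^{\delta-1}\in C([0,T];L^q\cap D^{1,3}\cap D^2)$, $S-\bar S\in C([0,T];D^1_*\cap D^3)$, $S_t\in L^\infty([0,T];L^\infty\cap L^3\cap D^1_*\cap D^2)$, $S_{tt}\in L^2([0,T];D^1_* )$. A global regular solution with the regularities (R) is a triple defined on $[0,\infty)\times\mathbb{R}^3$ which, for every finite $T>0$, is a regular solution in $[0,T]\times\mathbb{R}^3$ and satisfies (R) on $[0,T]$. Quantities: $m(t)=\int_{\mathbb{R}^3}\rho(t,\cdot)\,dx$,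 $\mathbb{P}(t)=\int_{\mathbb{R}^3}\rho(t,\cdot)u(t,\cdot)\,dx$. *)

(* Defs.v *)
From HB Require Import structures.
From mathcomp Require Import all_boot all_order all_algebra.
From mathcomp Require Import all_classical all_reals all_analysis measurable_realfun.
Import Order.TTheory GRing.Theory Num.Theory.
Import numFieldNormedType.Exports.

Set Implicit Arguments.
Unset Strict Implicit.
Unset Printing Implicit Defensive.

Local Open Scope classical_set_scope.
Local Open Scope ring_scope.

(* Conventions.
   - R^3 is R * R * R, whose library norm is the sup norm, with the threefold
     product of the Lebesgue measure.  Vectors of R^3 that occur as values of
     functions are rows 'rV[R]_3.
   - Elements of function spaces are handled through representatives: every
     notion below that refers to a function space is invariant under changes on
     null sets.
   - A function space is given by its norm, as a map to \bar R equal to +oo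
     outside the space.  Entries of vectors, matrices and higher gradients are
     summed, which gives norms equivalent to the Euclidean ones.
   - A function of (t, x) is a curve t |-> f t of functions of x; its values at
     t < 0 are irrelevant.  Integrals over (0, T) x R^3 are iterated, and are only
     taken of curves in L^1([0, T]; L^1_loc), see L1loct.
   - Positivity of the density and the limits at infinity are pointwise; initial
     values are attained almost everywhere. *)

Section Space.
Variable R : realType.

Notation leb := (@lebesgue_measure R).
Notation E := (R * R * R)%type.

Definition mu3 : {measure set (measurableTypeR R * measurableTypeR R * measurableTypeR R)
    -> \bar R} := ((leb \x leb) \x leb)%E.

Definition unitv (i : 'I_3) : E :=
  (((i == 0 :> nat)%:R, (i == 1 :> nat)%:R), (i == 2 :> nat)%:R).

(* All iterated directional derivatives are Frechet differentiable, which for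
   finite-dimensional V is equivalent to C^oo. *)
Definition smooth (V : normedModType R) (phi : V -> R) :=
  forall (vs : seq V) (x : V),
    differentiable (foldr (fun v g => 'D_v g) phi vs) x.

Definition test_function (V : normedModType R) (U : set V) (phi : V -> R) :=
  [/\ smooth phi,
      compact (closure [set x | phi x != 0]) &
      closure [set x | phi x != 0] `<=` U].

Definition partials (s : seq 'I_3) (phi : E -> R) : E -> R :=
  foldr (fun i g => 'D_(unitv i) g) phi s.

(* L^1_loc *)
Definition loc_integrable (f : E -> R) :=
  measurable_fun setT f /\
  forall K : set E, compact K -> mu3.-integrable K (EFin \o f).

(* g is the weak derivative of f with respect to the multi-index s. *)
Definition is_weak_deriv (s : seq 'I_3) (f g : E -> R) :=
  [/\ loc_integrable f, loc_integrable g &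
      forall phi, test_function setT phi ->
        \int[mu3]_x (f x * partials s phi x) =
        (-1) ^+ size s * \int[mu3]_x (g x * phi x)].

(* A choice of the weak derivative, which is unique up to null sets; it is 0 when
   there is none, so it is only used on functions already known to have one. *)
Definition wD (s : seq 'I_3) (f : E -> R) : E -> R :=
  xget (cst 0) [set g | is_weak_deriv s f g].

Definition grad (f : E -> R) (x : E) : 'rV[R]_3 := \row_j wD [:: j] f x.

Definition divv (v : E -> 'rV[R]_3) (x : E) : R :=
  \sum_j wD [:: j] (fun y => v y 0 j) x.

Definition gradv (v : E -> 'rV[R]_3) (x : E) : 'M[R]_3 :=
  \matrix_(i, j) wD [:: j] (fun y => v y 0 i) x.

Definition divm (M : E -> 'M[R]_3) (x : E) : 'rV[R]_3 :=
  \row_i \sum_j wD [:: j] (fun y => M y i j) x.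

Definition laplacian (v : E -> 'rV[R]_3) (x : E) : 'rV[R]_3 :=
  \row_i \sum_j wD [:: j; j] (fun y => v y 0 i) x.

Definition dot (v w : 'rV[R]_3) : R := \sum_i v 0 i * w 0 i.

Definition enorm (v : 'rV[R]_3) : R := Num.sqrt (dot v v).

Definition in_space (N : (E -> R) -> \bar R) (f : E -> R) := (N f < +oo)%E.

Definition Lp (p : \bar R) (f : E -> R) : \bar R :=
  if `[< measurable_fun setT f >] then Lnorm mu3 p (EFin \o f) else +oo%E.

(* |nabla^k f|_{L^r}.  Each infimum is over the representatives of one weak
   derivative, all of which have the same norm; it is +oo if there is none. *)
Definition Dn (k : nat) (r : \bar R) (f : E -> R) : \bar R :=
  (\sum_(s : k.-tuple 'I_3)
     ereal_inf [set Lp r g | g in [set g | is_weak_deriv s f g]])%E.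

Definition Hn (k : nat) (f : E -> R) : \bar R :=
  (\sum_(j < k.+1) Dn j 2%:E f)%E.

(* On D^1_* the L^6 norm is controlled by |nabla f|_{L^2} (Sobolev inequality),
   so this norm is equivalent to |nabla f|_{L^2}. *)
Definition D1star (f : E -> R) : \bar R := (Lp 6%:E f + Dn 1 2%:E f)%E.

(* The norm of nabla f in the space with norm N *)
Definition gradN (N : (E -> R) -> \bar R) (f : E -> R) : \bar R :=
  (\sum_(i < 3) ereal_inf [set N g | g in [set g | is_weak_deriv [:: i] f g]])%E.

(* Spaces of curves on [0, T] with values in the space with norm N *)

Definition Ct (T : R) (N : (E -> R) -> \bar R) (f : R -> E -> R) :=
  forall t0, t0 \in `[0, T] ->
    in_space N (f t0) /\
    N (f t \- f t0) @[t --> within `[0, T]%classic (nbhs t0)] --> 0%E.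

(* Measurability of the curve tested against C_c^oo: Bochner measurability for the
   separable spaces (Pettis), weak-star measurability for L^oo. *)
Definition curve_measurable (T : R) (f : R -> E -> R) :=
  forall psi, test_function setT psi ->
    measurable_fun `[0, T]%classic (fun t => \int[mu3]_x (f t x * psi x)).

Definition L2t (T : R) (N : (E -> R) -> \bar R) (f : R -> E -> R) :=
  [/\ curve_measurable T f,
      measurable_fun `[0, T]%classic (fun t => N (f t)) &
      (\int[leb]_(t in `[0%R, T]) (N (f t) ^+ 2) < +oo)%E].

Definition Linft (T : R) (N : (E -> R) -> \bar R) (f : R -> E -> R) :=
  curve_measurable T f /\
  exists C : R, {ae leb, forall t, t \in `[0, T] -> (N (f t) <= C%:E)%E}.

(* f belongs to L^1([0, T]; L^1(K)) for every compact K. *)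
Definition L1loct (T : R) (f : R -> E -> R) :=
  [/\ curve_measurable T f,
      {ae leb, forall t, t \in `[0, T] -> loc_integrable (f t)} &
      forall K : set E, compact K ->
        leb.-integrable `[0, T]%classic
          (fun t => \int[mu3]_(x in K) (`|f t x|)%:E)%E].

Definition pairing (T : R) (f : R -> E -> R) (phi : R * E -> R) : R :=
  \int[leb]_(t in `[0, T]%classic) \int[mu3]_x (f t x * phi (t, x)).

Definition dt (phi : R * E -> R) : R * E -> R := 'D_((1, 0) : R * E) phi.

Definition dx (j : 'I_3) (phi : R * E -> R) : R * E -> R :=
  'D_((0, unitv j) : R * E) phi.

(* f_t + sum_j d_j F_j = g in the sense of distributions on (0, T) x R^3 *)
Definition balance (T : R) (f : R -> E -> R) (F : 'I_3 -> R -> E -> R)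
    (g : R -> E -> R) :=
  [/\ L1loct T f, forall j, L1loct T (F j), L1loct T g &
      forall phi, test_function [set z : R * E | 0 < z.1 < T] phi ->
        - pairing T f (dt phi) - \sum_j pairing T (F j) (dx j phi) =
        pairing T g phi].

(* g is the weak time derivative of f on (0, T) x R^3. *)
Definition weak_dt (T : R) (f g : R -> E -> R) :=
  balance T f (fun _ _ _ => 0) g.

Definition tends_at_infty (f : E -> R) (l : R) :=
  forall eps, 0 < eps ->
    \forall M \near +oo, forall x : E, M < `|x| -> `|f x - l| < eps.

End Space.

Section System.
Variable R : realType.

Notation E := (R * R * R)%type.
Notation mu := (@mu3 R).

(* cA and cR are the constants A and R of the equation of state. *)
Record params := Params {
  gamma : R; nu : R; alpha : R; beta : R; cA : R; cR : R; Sbar : R }.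

Implicit Type p : params.

Definition delta p : R := (gamma p - 1) * nu p.
Definition cv p : R := cR p / (gamma p - 1).

Definition pressure p (rho S : E -> R) (x : E) : R :=
  cA p * expR (S x / cv p) * rho x `^ gamma p.

Definition Qu p (u : E -> 'rV[R]_3) (x : E) : 'M[R]_3 :=
  alpha p *: (gradv u x + (gradv u x)^T) + (beta p * divv u x)%:M.

Definition Hu p (u : E -> 'rV[R]_3) (x : E) : R :=
  divv (fun y => u y *m Qu p u y) x - dot (u x) (divm (Qu p u) x).

Definition Lu p (u : E -> 'rV[R]_3) (x : E) : 'rV[R]_3 :=
  - (alpha p *: laplacian u x) - (alpha p + beta p) *: grad (divv u) x.

(* rho^delta e^{S nu / c_v} *)
Definition visc p (rho S : E -> R) (x : E) : R :=
  rho x `^ delta p * expR (S x / cv p * nu p).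

Definition mass_eq p (T : R) (rho : R -> E -> R) (u : R -> E -> 'rV[R]_3) :=
  balance T rho (fun j t x => rho t x * u t x 0 j) (fun _ _ => 0).

Definition momentum_eq p (T : R) (rho : R -> E -> R) (u : R -> E -> 'rV[R]_3)
    (S : R -> E -> R) :=
  forall i : 'I_3,
    balance T (fun t x => rho t x * u t x 0 i)
      (fun j t x => rho t x * u t x 0 i * u t x 0 j
        + (i == j)%:R * pressure p (rho t) (S t) x
        - cA p `^ nu p * cR p `^ (- nu p)
          * (visc p (rho t) (S t) x * Qu p (u t) x i j))
      (fun _ _ => 0).

(* P S_t is a product of functions: S is required to have a locally integrable
   weak time derivative. *)
Definition entropy_eq p (T : R) (rho : R -> E -> R) (u : R -> E -> 'rV[R]_3)
    (S : R -> E -> R) :=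
  exists2 St, weak_dt T S St &
    balance T (fun _ _ => 0) (fun _ _ _ => 0)
      (fun t x => pressure p (rho t) (S t) x * (St t x + dot (u t x) (grad (S t) x))
        - cA p `^ nu p * cR p `^ (1 - nu p)
          * (visc p (rho t) (S t) x * Hu p (u t) x)).

Record regular_solution p (T : R) (rho0 : E -> R) (u0 : E -> 'rV[R]_3)
    (S0 : E -> R) (rho : R -> E -> R) (u : R -> E -> 'rV[R]_3) (S : R -> E -> R)
    : Prop := RegularSolution {
  rs_mass : mass_eq p T rho u;
  rs_momentum : momentum_eq p T rho u S;
  rs_entropy : entropy_eq p T rho u S;
  rs_init : {ae mu, forall x,
    [/\ rho 0 x = rho0 x, u 0 x = u0 x & S 0 x = S0 x]};
  rs_far : forall t, t \in `[0, T] ->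
    [/\ tends_at_infty (rho t) 0,
        forall i, tends_at_infty (fun x => u t x 0 i) 0 &
        tends_at_infty (S t) (Sbar p)];

  rs_rho_gt0 : forall t x, t \in `[0, T] -> 0 < rho t x;
  rs_rho_gamma : let f t x := rho t x `^ (gamma p - 1) in
    Ct T (@D1star R) f /\ Ct T (Dn 3 2%:E) f;
  rs_rho_delta : let f t x := rho t x `^ (delta p - 1) in
    Ct T (gradN (Lp +oo%E)) f /\ Ct T (gradN (Dn 2 2%:E)) f;

  rs_u : forall i, let f t x := u t x 0 i in
    Ct T (Hn 3) f /\ L2t T (Hn 4) f;
  rs_gradu : forall i j, Ct T (Lp 2%:E) (fun t x =>
    rho t x `^ ((delta p - 1) / 2) * wD [:: j] (fun y => u t y 0 i) x);
  rs_gradu_weighted : forall i j, Linft T (@D1star R) (fun t x =>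
    rho t x `^ (delta p - 1) * wD [:: j] (fun y => u t y 0 i) x);
  rs_grad2u_weighted : forall i j k, let f t x :=
    rho t x `^ (delta p - 1) * wD [:: j; k] (fun y => u t y 0 i) x in
    Linft T (Hn 1) f /\ L2t T (Dn 2 2%:E) f;

  rs_S_bounded : Linft T (Lp +oo%E) S;
  rs_expS : let f t x := expR (S t x / cv p) - expR (Sbar p / cv p) in
    Ct T (@D1star R) f /\ Ct T (Dn 3 2%:E) f
}.

Definition u_t_regularities (T : R) (u : R -> E -> 'rV[R]_3) :=
  forall i, let ui t x := u t x 0 i in
  exists ut utt : R -> E -> R,
    weak_dt T ui ut /\ weak_dt T ut utt /\
    Ct T (Hn 1) ut /\ L2t T (Dn 2 2%:E) ut /\
    Linft T (Dn 2 2%:E) (fun t x => Num.sqrt t * ut t x) /\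
    L2t T (Dn 3 2%:E) (fun t x => Num.sqrt t * ut t x) /\
    L2t T (Lp 2%:E) utt /\
    Linft T (Lp 2%:E) (fun t x => Num.sqrt t * utt t x) /\
    L2t T (@D1star R) (fun t x => Num.sqrt t * utt t x).

Definition S_t_regularities (T : R) (S : R -> E -> R) :=
  exists St Stt : R -> E -> R,
    weak_dt T S St /\ weak_dt T St Stt /\
    Linft T (Lp +oo%E) St /\ Linft T (Lp 3%:E) St /\
    Linft T (@D1star R) St /\ Linft T (Dn 2 2%:E) St /\
    L2t T (@D1star R) Stt.

Record regularities p (q T : R) (rho : R -> E -> R) (u : R -> E -> 'rV[R]_3)
    (S : R -> E -> R) : Prop := Regularities {
  rg_rho_gamma_t :
    exists2 g, weak_dt T (fun t x => rho t x `^ (gamma p - 1)) g & Ct T (Hn 2) g;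
  rg_u_t : u_t_regularities T u;
  rg_u : forall i, Linft T (Dn 4 2%:E) (fun t x => Num.sqrt t * u t x 0 i);
  rg_rho_delta : let f t x := rho t x `^ (delta p - 1) in
    [/\ Ct T (gradN (Lp q%:E)) f, Ct T (gradN (Dn 1 3%:E)) f &
        Ct T (gradN (Dn 2 2%:E)) f];
  rg_S : let f t x := S t x - Sbar p in
    Ct T (@D1star R) f /\ Ct T (Dn 3 2%:E) f;
  rg_S_t : S_t_regularities T S
}.

Definition global_regular_solution p (q : R) rho0 u0 S0 rho u S :=
  forall T : R, 0 < T ->
    regular_solution p T rho0 u0 S0 rho u S /\ regularities p q T rho u S.

Record admissible_data p (q : R) (rho0 : E -> R) (u0 : E -> 'rV[R]_3)
    (S0 : E -> R) : Prop := AdmissibleData {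
  ad_rho_gt0 : forall x, 0 < rho0 x;
  ad_rho_gamma : let f x := rho0 x `^ (gamma p - 1) in
    in_space (@D1star R) f /\ in_space (Dn 3 2%:E) f;
  ad_rho_delta : let f x := rho0 x `^ (delta p - 1) in
    [/\ in_space (gradN (Lp q%:E)) f, in_space (gradN (Dn 1 3%:E)) f &
        in_space (gradN (Dn 2 2%:E)) f];
  ad_rho_half :
    in_space (gradN (Lp 6%:E)) (fun x => rho0 x `^ ((delta p - 1) / 2));
  ad_u : forall i, in_space (Hn 3) (fun x => u0 x 0 i);
  ad_S : let f x := S0 x - Sbar p in
    in_space (@D1star R) f /\ in_space (Dn 3 2%:E) f
}.

Definition initial_compatibility p (rho0 : E -> R) (u0 : E -> 'rV[R]_3)
    (S0 : E -> R) (g1 : E -> 'M[R]_3) (g2 : E -> 'rV[R]_3) (g3 g4 : E -> 'M[R]_3) :=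
  let w x := rho0 x `^ ((1 - delta p) / 2) in
  [/\ forall i j, is_weak_deriv [:: j] (fun x => u0 x 0 i) (fun x => w x * g1 x i j),
      {ae mu, forall x, Lu p u0 x = rho0 x `^ (1 - delta p) *: g2 x},
      forall i j, is_weak_deriv [:: j]
        (fun x => rho0 x `^ (delta p - 1) * Lu p u0 x 0 i)
        (fun x => w x * g3 x i j) &
      forall i j, is_weak_deriv [:: i; j]
        (fun x => expR (S0 x / cv p)) (fun x => w x * g4 x i j)].

Definition L2_row (g : E -> 'rV[R]_3) :=
  forall i, in_space (Lp 2%:E) (fun x => g x 0 i).

Definition L2_mx (g : E -> 'M[R]_3) :=
  forall i j, in_space (Lp 2%:E) (fun x => g x i j).

Definition mass (rho : E -> R) : \bar R := (\int[mu]_x (rho x)%:E)%E.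

Definition momentum (rho : E -> R) (u : E -> 'rV[R]_3) : 'rV[R]_3 :=
  \row_i \int[mu]_x (rho x * u x 0 i).

Definition sup_norm (u : E -> 'rV[R]_3) : \bar R :=
  Lp +oo%E (fun x => enorm (u x)).

End System.

(* Main.v *)
Require Import Defs.
From HB Require Import structures.
From mathcomp Require Import all_boot all_order all_algebra.
From mathcomp Require Import all_classical all_reals all_analysis measurable_realfun.
Import Order.TTheory GRing.Theory Num.Theory.
Import numFieldNormedType.Exports.
From mathcomp Require Import ess_sup_inf ring lra.
Local Open Scope classical_set_scope.
Local Open Scope ring_scope.
Set Implicit Arguments.
Unset Strict Implicit.
Unset Printing Implicit Defensive.

(* The total momentum is conserved, whereas |int rho u| <= |u|_oo int rho tends to
   0 if |u(t)|_oo does, so the initial momentum would vanish.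

   For conservation, the balance laws are tested with eta(t) chi(x / r).  A
   function with small L^p, D^1 and D^3 norms is uniformly small, so rho, u and
   e^{S/c_v} are bounded and rho, rho u are continuous in time for the sup norm
   (4 gamma + 3 delta <= 7 gives 1 / (gamma - 1) >= 1, so rho is a Lipschitz
   function of rho^{gamma-1}).  The mass flux satisfies |rho u| <= U rho, so the
   mass in a ball of radius r changes by at most (c / r) times the mass in the
   ball of radius 2r; starting from the bound c r^3 and iterating, the mass in any
   ball is at most m(0).  With w = rho^{(delta-1)/2} nabla u in L^2, the viscous
   flux is rho^{(delta+1)/2} |w| <= C (rho + |w|^2), so the whole momentum flux is
   bounded in L^1 and the momentum in a ball of radius r changes by O(1 / r). *)

(** * Smooth functions *)

(** The class of regular solutions does not impose rho or rho u in L^1: at positive times only a sup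
    bound of rho is at hand, so integrability has to be derived from the initial mass. The weak
    equations see only the open interval (0, T); continuity for the sup norm up to time 0 is what
    links them to the data. The constants depend on T, which is harmless: at each fixed t, with T =
    t + 1, the radius goes to infinity before t is chosen late.

    Membership in [D1star] and D^3 provides no norm of second derivatives. The sup bounds are
    obtained by duality, without interpolation: the pairing of f with a product a(x) b(y) c(z)
    supported in a unit cube is bounded by the product of the L^1 norms of a, b, c. Subtracting from
    each factor its mean times a fixed bump leaves a derivative, and integration by parts produces
    0, 1 or 3 derivatives of f. Bounds of averages over boxes follow, then pointwise bounds by
    differentiating integrals one variable at a time. All test functions of the proof are such
    products, with one more factor in t for the balance laws, so their smoothness is a
    one-dimensional matter. *)

Section SmoothCalculus.
Variables (R : realType) (V : normedModType R).
Implicit Types (f g : V -> R) (P : (V -> R) -> Prop).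

(** Smoothness is proved by exhibiting a class of differentiable functions stable under every
    ['D_v]; this coinductive form avoids formulas for iterated derivatives. *)
Lemma smooth_ind P :
  (forall f, P f -> (forall x, differentiable f x) /\ forall v, P ('D_v f)) ->
  forall f, P f -> smooth f.
Proof.
move=> PD f Pf vs x.
suff : P (foldr (fun v g => 'D_v g) f vs) by move=> /PD[].
by elim: vs => //= v vs IH; have [_] := PD _ IH.
Qed.

Lemma smooth_differentiable f x : smooth f -> differentiable f x.
Proof. by move=> /(_ [::]). Qed.

Lemma smoothD1 f v : smooth f -> smooth ('D_v f).
Proof.
move=> sf vs x; have := sf (rcons vs v) x.
by rewrite foldr_rcons.
Qed.

(** The Leibniz rule produces sums of products, so a class that proves products smooth has to be
    closed under both operations. *)
Inductive generated (B : set (V -> R)) : (V -> R) -> Prop :=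
| gen_base f : B f -> generated B f
| gen_add f g : generated B f -> generated B g -> generated B (f \+ g)
| gen_mul f g : generated B f -> generated B g -> generated B (f \* g).

Lemma deriveDf f g v : (forall x, differentiable f x) ->
  (forall x, differentiable g x) -> 'D_v (f \+ g) = 'D_v f \+ 'D_v g.
Proof.
move=> df dg; apply/funext => x.
by rewrite deriveD//; apply: diff_derivable.
Qed.

Lemma deriveMf f g v : (forall x, differentiable f x) ->
  (forall x, differentiable g x) -> 'D_v (f \* g) = f \* 'D_v g \+ g \* 'D_v f.
Proof.
move=> df dg; apply/funext => x.
by rewrite deriveM//; apply: diff_derivable.
Qed.

Lemma generated_smooth (B : set (V -> R)) :
  (forall f, B f -> (forall x, differentiable f x) /\ forall v, generated B ('D_v f)) ->
  forall f, generated B f -> smooth f.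
Proof.
move=> BD; apply: smooth_ind => f; elim=> {f}[f /BD//||] f g Bf [df Df] Bg [dg Dg].
- split=> [x|v]; first exact: differentiableD.
  by rewrite deriveDf//; apply: gen_add.
- split=> [x|v]; first exact: differentiableM.
  by rewrite deriveMf//; apply: gen_add; apply: gen_mul.
Qed.

Let generated_smooth_id f : generated (@smooth R V) f -> smooth f.
Proof.
apply: generated_smooth => {}f sf; split=> [x|v].
  exact: smooth_differentiable.
by apply: gen_base; apply: smoothD1.
Qed.

Lemma smooth_add f g : smooth f -> smooth g -> smooth (f \+ g).
Proof.
by move=> sf sg; apply: generated_smooth_id; apply: gen_add; apply: gen_base.
Qed.

Lemma smooth_mul f g : smooth f -> smooth g -> smooth (f \* g).
Proof.
by move=> sf sg; apply: generated_smooth_id; apply: gen_mul; apply: gen_base.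
Qed.

Lemma smooth_cst (c : R) : smooth (cst c : V -> R).
Proof.
apply: (@smooth_ind (fun f => exists c, f = cst c)); last by exists c.
move=> f [d ->]; split=> [x|v]; first exact: differentiable_cst.
by exists 0; apply/funext => x; rewrite derive_cst.
Qed.

Lemma smooth_scale c f : smooth f -> smooth (fun x => c * f x).
Proof. by move=> sf; apply: (@smooth_mul (cst c) f) => //; apply: smooth_cst. Qed.

End SmoothCalculus.

Section SmoothLine.
Variable R : realType.

Lemma derive_line (a : R -> R) v x : differentiable a x -> 'D_v a x = v * (derive1 a) x.
Proof. by move=> da; rewrite deriveE// derive1E' // -[v in LHS]mulr1 -[v * 1]/(v *: (1 : R)) linearZ. Qed.

Lemma smooth_derive1 (a : R -> R) : smooth a -> smooth (derive1 a).
Proof.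
move=> sa; have -> : (derive1 a) = 'D_1 a by apply/funext => x; rewrite derive1E.
exact: smoothD1.
Qed.

(** Made for primitives: on the line the derivative along [v] is [v] times [derive1], so one smooth
    derivative settles all orders. *)
Lemma smooth_of_derive1 (a : R -> R) :
  (forall x, differentiable a x) -> smooth (derive1 a) -> smooth a.
Proof.
move=> da sa'; apply: (@smooth_ind R R
  (fun f => (forall x, differentiable f x) /\ smooth (derive1 f))) => // f [df sf'].
split=> // v; rewrite (_ : 'D_v f = fun x => v * (derive1 f) x); last first.
  by apply/funext => x; rewrite derive_line.
split=> [x|]; first by apply: smooth_differentiable; apply: smooth_scale.
by apply: smooth_derive1; apply: smooth_scale.
Qed.

Variable V : normedModType R.

(** Affine functionals, described by what the chain rule uses: a directional derivative that does
    not depend on the point. Coordinates of products and the maps c x + d are the instances. *)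
Definition affine_form (l : V -> R) (l' : V -> R) :=
  forall x, differentiable l x /\ forall v, 'D_v l x = l' v.

Lemma derive_comp_affine (a : R -> R) l l' v x : affine_form l l' ->
  differentiable a (l x) -> 'D_v (a \o l) x = l' v * (derive1 a) (l x).
Proof.
move=> al da; have [dl ll] := al x.
rewrite deriveE; last exact: differentiable_comp.
by rewrite (diff_comp dl da) /= -!deriveE// derive_line// ll.
Qed.

Lemma smooth_comp_affine (a : R -> R) l l' :
  affine_form l l' -> smooth a -> smooth (a \o l).
Proof.
move=> al sa; apply: (@smooth_ind R V
  (fun f => exists c b, smooth b /\ f = (fun x => c * b (l x)))); last first.
  by exists 1, a; split=> //; apply/funext => x /=; rewrite mul1r.
move=> f [c [b [sb ->]]].
have db x : differentiable (b \o l) x.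
  by apply: differentiable_comp; [case: (al x)|apply: smooth_differentiable].
split=> [x|v].
  by apply: (@differentiableM _ _ (cst c) (b \o l)) => //; apply: differentiable_cst.
exists (c * l' v), (derive1 b); split; first exact: smooth_derive1.
apply/funext => x; rewrite -[fun x => _]/(c *: (b \o l)) deriveZ; last first.
  exact: diff_derivable.
rewrite (derive_comp_affine _ al); last exact: smooth_differentiable.
by rewrite /GRing.scale/= mulrA.
Qed.

End SmoothLine.

(** * Flat functions built from e^(-1/x) *)

Section Bump.
Variable R : realType.

Definition flat (p : {poly R}) (x : R) : R :=
  if 0 < x then p.[x^-1] * expR (- x^-1) else 0.

Let horner_bound (p : {poly R}) : exists2 C : R, 0 <= C &
  forall y, 1 <= y -> `|p.[y]| <= C * y ^+ size p.
Proof.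
exists (\sum_(i < size p) `|p`_i|); first by apply: sumr_ge0.
move=> y y1; rewrite horner_coef mulr_suml (le_trans (ler_norm_sum _ _ _))//.
apply: ler_sum => i _; rewrite normrM ler_wpM2l// ger0_norm ?exprn_ge0 ?(le_trans ler01)//.
by rewrite ler_weXn2l// ltnW.
Qed.

(** With y = 1/x, the exponential series gives e^y >= y^(n+2) / (n+2)!, which beats the polynomial
    by two powers of x. One power is absorbed by the difference quotient at 0, the other makes it
    tend to 0. *)
Let flat_bound p : exists2 C : R, 0 <= C &
  forall x, `|x| <= 1 -> `|flat p x| <= C * x ^+ 2.
Proof.
have [C C0 pC] := horner_bound p.
set n := size p.
exists (C * (n.+2)`!%:R); first by rewrite mulr_ge0.
move=> x x1; rewrite /flat; case: ifPn => x0; last first.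
  by rewrite normr0 mulr_ge0 ?sqr_ge0// mulr_ge0.
have y1 : 1 <= x^-1 by rewrite invf_ge1//; rewrite gtr0_norm in x1.
have y0 : 0 < x^-1 by rewrite invr_gt0.
rewrite normrM (ger0_norm (expR_ge0 _)) expRN.
have e0 := expR_gt0 x^-1.
rewrite ler_pdivrMr// (le_trans (pC _ y1))// -!mulrA ler_wpM2l//.
have : (x^-1) ^+ n.+2 / (n.+2)`!%:R <= expR x^-1.
  by apply: le_trans (expR_ge1Dxn n.+1 (ltW y0)); rewrite lerDr.
rewrite ler_pdivrMr ?ltr0n ?fact_gt0// => h.
have -> : x^-1 ^+ size p = x^-1 ^+ n.+2 * x ^+ 2.
  by rewrite -addn2 exprD -mulrA -exprMn mulVf ?gt_eqF// expr1n mulr1.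
rewrite [leRHS](_ : _ = expR x^-1 * (n.+2)`!%:R * x ^+ 2); last by ring.
by rewrite ler_wpM2r ?sqr_ge0.
Qed.

(** For x > 0 the derivative of p(1/x) e^(-1/x) is x^(-2) (p(1/x) - p'(1/x)) e^(-1/x), and x^(-2) is
    the value of X^2 at 1/x; at 0, [flat_bound] makes the derivative vanish. *)
Let flat_derive p (x : R) : is_derive x 1 (flat p) (flat ('X^2 * (p - p^`())) x).
Proof.
have [x0|x0|->] := ltgtP x 0.
- rewrite {2}/flat ltNge (ltW x0)/=.
  apply: (@near_eq_is_derive R R R (fun=> 0)).
  near=> y; rewrite /flat ifF//; apply/negbTE; rewrite -leNgt ltW//.
  by near: y; exact: lt_nbhsl.
- rewrite {2}/flat x0.
  apply: (@near_eq_is_derive R R R (fun y => p.[y^-1] * expR (- y^-1))).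
    near=> y; rewrite /flat ifT//.
    by near: y; exact: lt_nbhsr.
  have xn0 : x != 0 by rewrite gt_eqF.
  have dinv : is_derive x 1 (fun y : R => y^-1) (- x ^- 2).
    apply: is_derive_eq; first by apply: is_deriveV.
    by rewrite /GRing.scale/= mulr1.
  have dp : is_derive x 1 (fun y : R => p.[y^-1]) (- x ^- 2 * (p^`()).[x^-1]).
    have dh : is_derive (x^-1) 1 (horner p) (p^`()).[x^-1] := is_derive_poly p x^-1.
    apply: is_derive_eq (@is_derive1_comp _ _ _ _ _ _ dh dinv) _.
    by rewrite mulrC.
  have de : is_derive x 1 (fun y : R => expR (- y^-1)) (x ^- 2 * expR (- x^-1)).
    have dN : is_derive x 1 (fun y : R => - y^-1) (- - x ^- 2) := is_deriveN dinv.
    apply: is_derive_eq (@is_derive1_comp _ _ _ _ _ _ (is_derive_expR _) dN) _.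
    rewrite mulrC;  by rewrite opprK.
  apply: is_derive_eq (is_deriveM dp de) _.
  rewrite hornerM hornerXn hornerD hornerN /GRing.scale/= -!exprVn.
  set e := expR _; set d := (p^`()).[_]; ring.
- rewrite {2}/flat ltxx.
  suff H : (fun h : R => h^-1 *: ((flat p \o shift 0) (h *: 1) - flat p 0)) @ 0^' --> (0 : R).
    by apply: DeriveDef; [apply/cvg_ex; exists 0|apply/cvg_lim].
  have [C C0 pC] := flat_bound p.
  apply: (@norm_cvg0 _ R); apply: (@squeeze_cvgr _ _ _ _ (cst 0) (fun h => C * `|h|)).
  + near=> h => /=.
    rewrite normr_ge0/= /flat ltxx subr0 addr0 /GRing.scale/= mulr1 normrM.
    have hn0 : h != 0 by near: h; exact: nbhs_dnbhs_neq.
    rewrite normfV ler_pdivrMl ?normr_gt0// (le_trans (pC h _))//.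
      near: h; apply: cvg_within.
      by apply: (@nbhs0_le R R).
    suff -> : `|h| * (C * `|h|) = C * h ^+ 2 by [].
    by rewrite mulrCA -expr2 real_normK ?num_real.
  + exact: cvg_cst.
  + rewrite -[X in _ --> X](mulr0 C); apply: cvgM; first exact: cvg_cst.
    rewrite -[X in _ --> X](@normr0 _ R); apply: cvg_norm; exact: cvg_within.
Unshelve. all: by end_near. Qed.

(* The class of functions q(1/x) e^{-1/x} on x > 0, q a polynomial, is stable under
   differentiation. *)
Lemma smooth_flat p : smooth (flat p).
Proof.
apply: (@smooth_ind R R (fun f => exists p, f = flat p)); last by exists p.
move=> f [{}p ->].
have df x : differentiable (flat p) x.
  by apply/derivable1_diffP; case: (flat_derive p x).
split=> // v; exists (v *: ('X^2 * (p - p^`()))).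
apply/funext => x; rewrite derive_line// derive1E.
have [_ ->] := flat_derive p x.
by rewrite /flat; case: ifP; rewrite ?mulr0// hornerZ mulrA.
Qed.
End Bump.

(** * Integrability of real-valued functions *)

Section IntegrableReal.
Context d (T : measurableType d) (R : realType) (mu : {measure set T -> \bar R}).
Variables (D : set T) (mD : measurable D).
Implicit Types f g : T -> R.

Lemma integrable_addr f g : mu.-integrable D (EFin \o f) -> mu.-integrable D (EFin \o g) ->
  mu.-integrable D (EFin \o (fun x => f x + g x)).
Proof. by move=> fi gi; have := integrableD mD fi gi. Qed.

Lemma integrable_subr f g : mu.-integrable D (EFin \o f) -> mu.-integrable D (EFin \o g) ->
  mu.-integrable D (EFin \o (fun x => f x - g x)).
Proof. by move=> fi gi; have := integrableB mD fi gi. Qed.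

Lemma integrable_scaler c f : mu.-integrable D (EFin \o f) ->
  mu.-integrable D (EFin \o (fun x => c * f x)).
Proof. by move=> fi; have := integrableZl mD c fi. Qed.

Lemma integrable_le f g : measurable_fun D f -> mu.-integrable D (EFin \o g) ->
  (forall x, D x -> `|f x| <= g x) -> mu.-integrable D (EFin \o f).
Proof.
move=> mf gi fg; apply: le_integrable gi => //; first exact/measurable_EFinP.
by move=> x Dx /=; rewrite lee_fin (le_trans (fg _ Dx))// ler_norm.
Qed.

Lemma integrable_patch f : mu.-integrable D (EFin \o f) ->
  mu.-integrable setT (EFin \o (f \_ D)).
Proof. by move=> fi; rewrite -restrict_EFin -integrable_mkcond. Qed.

End IntegrableReal.

(** * Test functions on the line *)

Section LineTests.
Variable R : realType.
Notation leb := (@lebesgue_measure R).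
Implicit Types (a b : R -> R) (al be : R).

(** The segment is kept explicit because the bounds below rely on supports of length 1. *)
Definition line_test al be a := smooth a /\ forall x, x \notin `[al, be] -> a x = 0.

Lemma smooth_continuous a : smooth a -> continuous a.
Proof. by move=> sa x; apply/differentiable_continuous/smooth_differentiable. Qed.

Lemma smooth_derivable a x : smooth a -> derivable a x 1.
Proof. by move=> sa; apply/derivable1_diffP/smooth_differentiable. Qed.

Lemma line_test_patch al be a : line_test al be a -> a = a \_ `[al, be].
Proof.
move=> [_ a0]; apply/funext => x; rewrite patchE; case: ifPn => //.
by rewrite notin_setE/= => /negP/a0.
Qed.

Lemma line_test_Rintegral al be a : line_test al be a ->
  \int[leb]_x a x = \int[leb]_(x in `[al, be]) a x.
Proof. by move=> ta; rewrite [RHS]Rintegral_mkcond -line_test_patch. Qed.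

Lemma line_test_integrable al be a D : measurable D -> line_test al be a ->
  leb.-integrable D (EFin \o a).
Proof.
move=> mD ta; apply: (@integrableS _ _ _ _ setT) => //.
have : leb.-integrable `[al, be] (EFin \o a).
  apply: continuous_compact_integrable; first exact: segment_compact.
  by apply/continuous_subspaceT/smooth_continuous; case: ta.
move=> ia; suff -> : EFin \o a = (EFin \o a) \_ `[al, be] by rewrite -integrable_mkcond.
apply/funext => x; rewrite {1}(line_test_patch ta) /= !patchE.
by case: ifP.
Qed.

Lemma line_test_norm_integrable al be a D : measurable D -> line_test al be a ->
  leb.-integrable D (fun x => `|a x|%:E).
Proof.
by move=> mD ta; apply: (@integrable_norm _ _ _ leb); apply: line_test_integrable ta.
Qed.

Lemma line_test_derive1 al be a : line_test al be a -> line_test al be (derive1 a).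
Proof.
move=> [sa a0]; split; first exact: smooth_derive1.
move=> x xab; rewrite derive1E.
have : \forall y \near x, a y = cst 0 y.
  have H : nbhs x (~` `[al, be]%classic).
    apply: open_nbhs_nbhs; split; last by apply/negP.
    by apply: closed_openC; exact: interval_closed.
  by near=> y; apply: a0; apply/negP; near: y; exact: H.
by move=> /(@near_eq_derive R R R a (cst 0) x 1) ->; rewrite derive_cst.
Unshelve. all: by end_near. Qed.

Lemma line_test_add al be a b : line_test al be a -> line_test al be b ->
  line_test al be (a \+ b).
Proof.
move=> [sa a0] [sb b0]; split; first exact: smooth_add.
by move=> x xab /=; rewrite a0// b0// addr0.
Qed.

Lemma line_test_scale al be c a : line_test al be a ->
  line_test al be (fun x => c * a x).
Proof.
move=> [sa a0]; split; first exact: smooth_scale.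
by move=> x xab /=; rewrite a0// mulr0.
Qed.

Definition prim a x : R := \int[leb]_(y in `]-oo, x]) a y.

Lemma prim_derive al be a x : line_test al be a ->
  derivable (prim a) x 1 /\ derive1 (prim a) x = a x.
Proof.
move=> ta; apply: (@continuous_FTC1 _ a -oo%O x (x + 1)) => //.
- by rewrite ltrDl.
- by apply: line_test_integrable ta.
- by rewrite ltNyr.
- by case: ta => /smooth_continuous + _; apply.
Qed.

Lemma prim_smooth al be a : line_test al be a -> smooth (prim a).
Proof.
move=> ta; apply: smooth_of_derive1.
  by move=> x; apply/derivable1_diffP; case: (prim_derive x ta).
have -> : derive1 (prim a) = a; last by case: ta.
by apply/funext => x; case: (prim_derive x ta).
Qed.

Lemma derive1_prim al be a : line_test al be a -> derive1 (prim a) = a.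
Proof. by move=> ta; apply/funext => x; case: (prim_derive x ta). Qed.

Lemma prim_left al be a x : line_test al be a -> x < al -> prim a x = 0.
Proof.
move=> [_ a0] xa; rewrite /prim /Rintegral integral0_eq// => y /=.
rewrite in_itv/= => yx; rewrite a0// in_itv/= negb_and -ltNge.
by rewrite (le_lt_trans yx xa).
Qed.

Lemma prim_right al be a x : line_test al be a -> be <= x ->
  prim a x = \int[leb]_y a y.
Proof.
move=> ta bx; rewrite /prim Rintegral_mkcond; congr Rintegral.
apply/funext => y; rewrite patchE; case: ifPn => //.
rewrite notin_setE/= in_itv/= => /negP; rewrite -ltNge => xy.
by case: ta => _ ->//; rewrite in_itv/= negb_and -!ltNge (le_lt_trans bx xy) orbT.
Qed.

Lemma prim_norm al be a x : line_test al be a ->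
  `|prim a x| <= \int[leb]_y `|a y|.
Proof.
move=> ta; apply: le_trans (le_normr_Rintegral _ _) _ => //.
  by apply: line_test_integrable ta.
rewrite /Rintegral fine_le//.
- apply: integrable_fin_num => //; first exact: line_test_norm_integrable ta.
- apply: integrable_fin_num => //; first exact: line_test_norm_integrable ta.
- apply: ge0_subset_integral => //.
  by case/integrableP: (line_test_norm_integrable measurableT ta).
Qed.

Lemma prim_test al be a : line_test al be a -> \int[leb]_y a y = 0 ->
  line_test al be (prim a).
Proof.
move=> ta a0; split; first exact: prim_smooth ta.
move=> x; rewrite in_itv/= negb_and -!ltNge => /orP[|]; first exact: prim_left ta.
by move=> /ltW /(prim_right ta) ->.
Qed.

Lemma line_test_FTC al be b : al < be -> line_test al be (derive1 b) -> smooth b ->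
  \int[leb]_x (derive1 b) x = b be - b al.
Proof.
move=> ab tb sb; rewrite (line_test_Rintegral tb) /Rintegral.
rewrite (@continuous_FTC2 _ _ b)//.
- by apply/continuous_subspaceT/smooth_continuous; case: tb.
- split=> [x _||]; first exact: smooth_derivable.
  + by apply: cvg_at_right_filter; apply: smooth_continuous.
  + by apply: cvg_at_left_filter; apply: smooth_continuous.
Qed.

Lemma affine_line (c d : R) : affine_form (fun x : R => c * x + d) (fun v => c * v).
Proof.
have E : (fun x : R => c * x + d) = (fun x : R => c *: x) \+ cst d by [].
move=> x; split=> [|v].
  by rewrite E; apply: differentiableD => //; apply: differentiableZ.
rewrite E deriveD; last 2 first.
- by apply: derivableZ; exact: derivable_id.
- exact: derivable_cst.
by rewrite deriveZ// derive_id derive_cst addr0.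
Qed.

Lemma smooth_comp_line a (c d : R) : smooth a -> smooth (fun x : R => a (c * x + d)).
Proof. by move=> sa; apply: (smooth_comp_affine (affine_line c d)). Qed.

Lemma derive1_comp_line a (c d x : R) : smooth a ->
  derive1 (fun x => a (c * x + d)) x = c * derive1 a (c * x + d).
Proof.
move=> sa; rewrite derive1E (derive_comp_affine _ (affine_line c d)) ?mulr1//.
exact: smooth_differentiable.
Qed.

Lemma theta_exists : exists2 th : R -> R, line_test 0 1 th &
  (forall x, 0 <= th x) /\ \int[leb]_x th x = 1.
Proof.
pose e := @flat R 1.
have e0 x : 0 <= e x by rewrite /e /flat; case: ifP => //; rewrite hornerC mul1r expR_ge0.
(* The function e^(-1/x) on x > 0, times its reflection about 1/2: positive on (0, 1) and zero
   elsewhere. *)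
pose t x := e x * e ((-1) * x + 1).
have tt : line_test 0 1 t.
  split=> [|x].
    by apply: smooth_mul; [|apply: smooth_comp_line]; apply: smooth_flat.
  rewrite in_itv/= negb_and -!ltNge /t /e /flat => /orP[x0|x1].
    by rewrite ltNge (ltW x0)/= mul0r.
  by rewrite mulN1r [0 < - x + 1]ltNge addrC subr_le0 (ltW x1)/= mulr0.
have t0 x : 0 <= t x by rewrite mulr_ge0.
have I0 : 0 < \int[leb]_x t x.
  (* If the integral were 0, the primitive of [t] would be monotone and zero outside [0, 1], hence
     zero everywhere; its derivative at 1/2 would then vanish, although [t] is positive there. *)
  rewrite lt_neqAle Rintegral_ge0// andbT eq_sym; apply/negP => /eqP I0.
  have t2 := prim_test tt I0.
  have nd : {homo prim t : x y / x <= y}.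
    move=> x y; rewrite /prim => xy; rewrite fine_le//.
    - by apply: integrable_fin_num => //; apply: line_test_integrable tt.
    - by apply: integrable_fin_num => //; apply: line_test_integrable tt.
    - apply: ge0_subset_integral => //.
      + by case/integrableP: (line_test_integrable (measurable_itv `]-oo, y]) tt).
      + by move=> z _; rewrite lee_fin.
      + by apply: subset_itvl; rewrite bnd_simp.
  have p0 : prim t = cst 0.
    apply/funext => x; apply/eqP; rewrite eq_le.
    have -> : 0 = prim t (Num.max x 2).
      by case: t2 => _ ->//; rewrite in_itv/= negb_and -!ltNge lt_max ltr1n orbT orbT.
    rewrite nd ?le_max ?lexx//=.
    have -> : prim t (Num.max x 2) = prim t (Num.min x (-1)).
      case: t2 => _ h; rewrite !h//; rewrite in_itv/= negb_and -!ltNge.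
        by rewrite gt_min ltrN10 orbT.
      by rewrite lt_max ltr1n orbT orbT.
    by rewrite nd// ge_min lexx.
  have [_] := prim_derive 2^-1 tt.
  rewrite p0 derive1_cst /t /e /flat !hornerC !mul1r mulN1r.
  rewrite ifT ?invr_gt0// ifT; last by lra.
  by move/esym/eqP; rewrite mulf_eq0 !expR_eq0.
exists (fun x => (\int[leb]_x t x)^-1 * t x); first exact: line_test_scale.
split=> [x|]; first by rewrite mulr_ge0// invr_ge0 ltW.
rewrite RintegralZl//; last by apply: line_test_integrable tt.
by rewrite mulVf// gt_eqF.
Qed.

Definition theta : R -> R := projT1 (cid2 theta_exists).

Lemma theta_test : line_test 0 1 theta.
Proof. by rewrite /theta; case: cid2. Qed.

Lemma theta_ge0 x : 0 <= theta x.
Proof. by rewrite /theta; case: cid2 => ? ? []. Qed.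

Lemma theta_Rintegral : \int[leb]_x theta x = 1.
Proof. by rewrite /theta; case: cid2 => ? ? []. Qed.

Definition step := prim theta.

Lemma step_smooth : smooth step.
Proof. exact: prim_smooth theta_test. Qed.

Lemma derive1_step : derive1 step = theta.
Proof. exact: derive1_prim theta_test. Qed.

Lemma step_right x : 1 <= x -> step x = 1.
Proof. by move=> x1; rewrite /step (prim_right theta_test)// theta_Rintegral. Qed.

Lemma step_left x : x <= 0 -> step x = 0.
Proof.
rewrite le_eqVlt => /predU1P[->|]; last exact: prim_left theta_test.
rewrite /step /prim -Rintegral_itv_bndo_bndc; last by apply: line_test_integrable theta_test.
rewrite /Rintegral integral0_eq// => y /=.
by rewrite in_itv/= => y0; case: theta_test => _ ->//; rewrite in_itv/= negb_and -ltNge y0.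
Qed.

Lemma prim_ge0 a x : (forall y, 0 <= a y) -> 0 <= prim a x.
Proof. by move=> a0; apply: Rintegral_ge0. Qed.

Lemma step_ge0 x : 0 <= step x.
Proof. by apply: prim_ge0; exact: theta_ge0. Qed.

Lemma step_le1 x : step x <= 1.
Proof.
have := prim_norm x theta_test; rewrite -/(step x) (ger0_norm (step_ge0 x)).
rewrite (_ : (fun x => `|theta x|) = theta) ?theta_Rintegral//.
by apply/funext => y; rewrite ger0_norm// theta_ge0.
Qed.

Lemma theta_scale_test (c d : R) : 0 < c ->
  line_test d (d + c^-1) (fun x => theta (c * x + - (c * d))).
Proof.
move=> c0; split; first by apply: smooth_comp_line; case: theta_test.
move=> x; rewrite in_itv/= negb_and -!ltNge => xcd; case: theta_test => _ ->//.
rewrite in_itv/= negb_and -!ltNge -mulrBr; case/orP: xcd => xcd.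
  by rewrite pmulr_rlt0// subr_lt0 xcd.
by rewrite -ltr_pdivrMl// ltrBrDl mulr1 xcd orbT.
Qed.

(** The integrand is the derivative of a rescaled [step], so the fundamental theorem of calculus
    replaces a change of variables. *)
Lemma theta_scale_Rintegral (c d : R) : 0 < c ->
  \int[leb]_x (c * theta (c * x + - (c * d))) = 1.
Proof.
move=> c0.
have E : (fun x => c * theta (c * x + - (c * d))) =
         derive1 (fun x => step (c * x + - (c * d))).
  by apply/funext => x; rewrite derive1_comp_line ?derive1_step//; exact: step_smooth.
rewrite E (@line_test_FTC d (d + c^-1)).
- have -> : c * (d + c^-1) - c * d = 1 by field; rewrite gt_eqF.
  by rewrite subrr (step_left (lexx 0)) subr0 step_right.
- by rewrite ltrDl invr_gt0.
- by rewrite -E; apply: line_test_scale; apply: theta_scale_test.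
- by apply: smooth_comp_line; exact: step_smooth.
Qed.

(* Subtracting from [a] its integral times a translate of [theta] leaves a
   derivative of a test function with the same support. *)
Lemma line_test_split (j : R) a : line_test j (j + 1) a ->
  exists2 b, line_test j (j + 1) b &
   [/\ forall x, a x = (\int[leb]_y a y) * theta (x - j) + derive1 b x &
      forall x, `|b x| <= 2 * \int[leb]_y `|a y|].
Proof.
move=> ta; set I := \int[leb]_y a y.
have thj : line_test j (j + 1) (fun x => theta (x - j)).
  have := theta_scale_test j ltr01; rewrite invr1.
  by congr line_test; apply/funext => x; rewrite !mul1r.
have thI : \int[leb]_x theta (x - j) = 1.
  have := theta_scale_Rintegral j ltr01.
  by under eq_Rintegral do rewrite !mul1r.
pose c := a \+ (fun x => (- I) * theta (x - j)).
have tc : line_test j (j + 1) c by apply: line_test_add => //; exact: line_test_scale.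
exists (prim c).
  apply: prim_test => //; rewrite /c RintegralD//.
  - rewrite RintegralZl//; last exact: line_test_integrable thj.
    by rewrite thI mulr1 subrr.
  - exact: line_test_integrable ta.
  - by apply: line_test_integrable (line_test_scale _ thj).
split=> x.
  by rewrite (derive1_prim tc) /c/=; ring.
apply: le_trans (prim_norm x tc) _.
have nI : `|I| <= \int[leb]_y `|a y|.
  by apply: le_normr_Rintegral => //; exact: line_test_integrable ta.
(* The factor 2: the mean of [a] is at most its L^1 norm, and the translate of [theta] that it
   multiplies has mass 1. *)
have -> : 2 * \int[leb]_y `|a y| = \int[leb]_y `|a y| + (\int[leb]_y `|a y|) * \int[leb]_x theta (x - j).
  by rewrite thI; ring.
rewrite -RintegralZl//; last exact: line_test_integrable thj.
rewrite -RintegralD//; last 2 first.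
- exact: line_test_norm_integrable ta.
- by apply: line_test_integrable (line_test_scale _ thj).
apply: le_Rintegral => //.
- exact: line_test_norm_integrable tc.
- apply: integrable_addr => //; first exact: line_test_norm_integrable ta.
  by apply: line_test_integrable (line_test_scale _ thj).
move=> y _; rewrite /c/= (le_trans (ler_normD _ _))// lerD2l normrM normrN.
by rewrite (ger0_norm (theta_ge0 _)) ler_wpM2r// theta_ge0.
Qed.

End LineTests.

(** * Pointwise bounds from averages over boxes *)

Section AlmostEverywhere.
Context d (T : measurableType d) (R : realType) (mu : {measure set T -> \bar R}).

Lemma ae_imp (P Q : T -> Prop) : (forall x, P x -> Q x) ->
  {ae mu, forall x, P x} -> {ae mu, forall x, Q x}.
Proof. by move=> PQ; apply: filterS. Qed.

Lemma ae_imp2 (P1 P2 Q : T -> Prop) : (forall x, P1 x -> P2 x -> Q x) ->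
  {ae mu, forall x, P1 x} -> {ae mu, forall x, P2 x} -> {ae mu, forall x, Q x}.
Proof. by move=> PQ; apply: filterS2. Qed.

Lemma ae_forall_countable (I : countType) (P : I -> T -> Prop) :
  (forall i, {ae mu, forall x, P i x}) -> {ae mu, forall x, forall i, P i x}.
Proof.
move=> aeP.
have : {ae mu, forall x, forall n : nat, if unpickle n is Some i then P i x else True}.
  apply: ae_foralln => n; case: unpickle => [i|]; first exact: aeP.
  exact: aeW.
by apply: filterS => x H i; have := H (pickle i); rewrite pickleK.
Qed.

End AlmostEverywhere.

Section Line.
Variable R : realType.
Notation leb := (@lebesgue_measure R).

(** Rational points s < x < t on both sides of x suffice: the linearization errors at s and t add up
    to at most e (t - s), so the quotient between s and t is within e of the derivative at x, which
    may be irrational. *)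
Lemma straddle (F : R -> R) (x M : R) : derivable F x 1 ->
  (forall s t : rat, ratr s < ratr t :> R -> `|F (ratr t) - F (ratr s)| <= M * (ratr t - ratr s)) ->
  `|derive1 F x| <= M.
Proof.
move=> dF FM; apply/ler_addgt0Pr => e e0.
set l := derive1 F x.
have : \forall h \near (0:R)^', `|l - h^-1 *: ((F \o shift x) (h *: 1) - F x)| < e.
  have dF' : derivable F x 1 := dF; rewrite /l derive1E.
  by move: dF' => /cvgrPdist_lt; apply.
rewrite near_withinE => -[r /= r0 rP].
have key y : `|y - x| < r -> `|F y - F x - l * (y - x)| <= e * `|y - x|.
  move=> yr; have [->|yx] := eqVneq y x; first by rewrite !subrr mulr0 subrr normr0 mulr0.
  have h0 : y - x != 0 by rewrite subr_eq0.
  have := rP (y - x); rewrite /ball_/= sub0r normrN => /(_ yr h0).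
  rewrite /GRing.scale/= mulr1 subrK => /ltW.
  rewrite -(ler_pM2r (x := `|y - x|)) ?normr_gt0// -normrM mulrBl mulrAC mulVf// mul1r.
  by rewrite distrC.
have [s /[!in_itv]/= /andP[s1 s2]] : exists s : rat, ratr s \in `]x - r, x[.
  have := rat_in_itvoo (x := x - r) (y := x); rewrite ltrBlDr ltrDl; exact.
have [t /[!in_itv]/= /andP[t1 t2]] : exists s : rat, ratr s \in `]x, x + r[.
  have := rat_in_itvoo (x := x) (y := x + r); rewrite ltrDl; exact.
have st : ratr s < ratr t :> R by exact: lt_trans t1.
have ks : `|F (ratr s) - F x - l * (ratr s - x)| <= e * (x - ratr s).
  have -> : x - ratr s = `|ratr s - x| by rewrite ltr0_norm ?subr_lt0// opprB.
  by apply: key; rewrite ltr0_norm ?subr_lt0// opprB ltrBlDr addrC -ltrBlDr.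
have kt : `|F (ratr t) - F x - l * (ratr t - x)| <= e * (ratr t - x).
  rewrite -{2}(@gtr0_norm _ (ratr t - x)) ?subr_gt0//.
  by apply: key; rewrite gtr0_norm ?subr_gt0// ltrBlDr addrC.
have := FM s t st.
suff H : `|F (ratr t) - F (ratr s)| <= M * (ratr t - ratr s) ->
    `|l| * (ratr t - ratr s) <= (M + e) * (ratr t - ratr s).
  by move=> /H; rewrite ler_pM2r ?subr_gt0.
rewrite -{2}(@gtr0_norm _ (ratr t - ratr s)) ?subr_gt0// -normrM.
move: ks kt; rewrite !ler_norml => /andP[? ?] /andP[? ?] /andP[? ?].
by apply/andP; split; lra.
Qed.

(** Almost everywhere G is the derivative of its primitive, to which [straddle] applies. Rational
    endpoints make the hypothesis a countable one, so that it can itself hold for almost every slice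
    of a product. *)
Lemma ae_norm_le_of_itv (G : R -> R) (M : R) :
  leb.-integrable setT (EFin \o G) ->
  (forall s t : rat, ratr s < ratr t :> R ->
     `|\int[leb]_(x in `]ratr s, ratr t[) G x| <= M * (ratr t - ratr s)) ->
  {ae leb, forall x, `|G x| <= M}.
Proof.
move=> iG GM.
have iGS D : measurable D -> leb.-integrable D (EFin \o G).
  by move=> mD; apply: integrableS iG.
have lG : locally_integrable setT G.
  apply: open_integrable_locally => //; exact: openT.
have := FTC1Ny (fun y => iGS _ (measurable_itv `]-oo, y])) lG.
apply: ae_imp => x [dF <-]; apply: straddle => // s t st.
rewrite Rintegral_itvB//; last 2 first.
- exact: iGS.
- by rewrite bnd_simp ltW.
rewrite -Rintegral_itv_bndo_bndc ?GM//.
exact: iGS.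
Qed.

End Line.

(* Fubini's theorem and the differentiation theorem on the line reduce an a.e. bound
   in a product to bounds of averages over rational boxes. *)
Section Slices.
Context d (X : measurableType d) (R : realType).
Variable m : {sigma_finite_measure set X -> \bar R}.
Notation leb := (@lebesgue_measure R).
Definition leb_sf : {sigma_finite_measure set (measurableTypeR R) -> \bar R} := leb.

(* An alias, because the sigma-finite structure that Fubini's theorem for the triple
   product [mu3] needs is not inferred for [m \x leb_sf] itself. *)
Definition prod_leb : set (X * measurableTypeR R)%type -> \bar R :=
  (m \x leb_sf)%E.

HB.instance Definition _ := Measure.on prod_leb.

Let prod_leb_sigma_finite : sigma_finite setT prod_leb.
Proof.
have /sigma_finiteP[F [TF ndF Foo]] := sigma_finiteT m.
exists (fun n => F n `*` `[- n%:R, n%:R]).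
  apply/seteqP; split=> // -[x y] _.
  have [k _ Fkx] : (\bigcup_i F i) x by rewrite -TF.
  pose l := `|(Num.ceil `|y|)|%N.
  exists (maxn k l) => //; split=> /=.
    by move: x Fkx; exact/subsetPset/ndF/leq_maxl.
  have yl : `|y| <= l%:R.
    rewrite (le_trans (ceil_ge _))// /l natr_absz ler_int ler_norm//.
  rewrite in_itv/= -ler_norml (le_trans yl)// ler_nat; exact: leq_maxr.
move=> k; have [mF Fk] := Foo k; split; first exact: measurableX.
rewrite /prod_leb product_measure1E//.
rewrite lte_mul_pinfty// ?ge0_fin_numE//.
by rewrite /leb_sf/= lebesgue_measure_itv/=; case: ifP => _; rewrite ?ltry// -EFinB ltry.
Qed.

HB.instance Definition _ := Measure_isSigmaFinite.Build _ _ _ prod_leb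
  prod_leb_sigma_finite.

Implicit Type g : X * measurableTypeR R -> R.

Lemma prod_leb_integrable_restrict g A B : measurable A -> measurable B ->
  prod_leb.-integrable setT (EFin \o g) ->
  prod_leb.-integrable setT (EFin \o (g \_ (A `*` B))).
Proof.
move=> mA mB ig; rewrite -restrict_EFin -integrable_mkcond; last exact: measurableX.
by apply: integrableS ig => //; exact: measurableX.
Qed.


Lemma patchX g (A : set X) (B : set (measurableTypeR R)) x y :
  (g \_ (A `*` B)) (x, y) = if y \in B then (g \_ (A `*` setT)) (x, y) else 0.
Proof.
rewrite !patchE !in_setX.
by have [xA|xA] := boolP (x \in A); have [yB|yB] := boolP (y \in B); rewrite //= ?in_setT.
Qed.

Let Gh g A := fubini_G m (EFin \o (g \_ (A `*` [set: measurableTypeR R]))).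

Let GhE g A y : \int[m]_(x in A) g (x, y) = fine (Gh g A y).
Proof.
rewrite /Gh /fubini_G /Rintegral integral_mkcond; congr fine.
apply: eq_integral => x _; rewrite /= !patchE in_setX in_setT andbT.
by case: ifP.
Qed.

Let iGh g A : measurable A -> prod_leb.-integrable setT (EFin \o g) ->
  leb_sf.-integrable setT (Gh g A).
Proof.
move=> mA ig.
have ir := prod_leb_integrable_restrict mA measurableT ig.
have mr := measurable_int _ ir.
apply/integrableP; split; first exact: (measurable_fubini_G ir).
apply: le_lt_trans ((integrable21ltyP m leb_sf mr).1 ir).
apply: ge0_le_integral => //.
- apply: measurableT_comp => //; exact: (measurable_fubini_G ir).
- apply: (measurable_fun_fubini_tonelli_G (m1 := m) (fun z => `|(EFin \o g \_ (A `*` setT)) z|%E)) => //.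
  exact: measurableT_comp.
- move=> y _; apply: le_abse_integral => //.
  apply: (measurableT_comp mr); exact: measurable_pair2.
Qed.

Lemma prod_leb_slice_integrable g (A : set X) : measurable A ->
  prod_leb.-integrable setT (EFin \o g) ->
  leb_sf.-integrable setT (EFin \o (fun y => \int[m]_(x in A) g (x, y))).
Proof.
move=> mA ig; have iG := iGh mA ig.
apply: (le_integrable _ _ _ iG) => //.
  apply/measurable_EFinP; rewrite (_ : (fun y => _) = fine \o Gh g A); last first.
    by apply/funext => y; rewrite GhE.
  by apply: measurableT_comp => //; exact: measurable_int iG.
move=> y _ /=; rewrite GhE.
by case: (Gh g A y) => [r||] //=; rewrite leey.
Qed.

Lemma prod_leb_Rintegral g (A : set X) (B : set (measurableTypeR R)) :
  measurable A -> measurable B ->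
  prod_leb.-integrable setT (EFin \o g) ->
  \int[prod_leb]_(z in A `*` B) g z =
  \int[leb_sf]_(y in B) \int[m]_(x in A) g (x, y).
Proof.
move=> mA mB ig; have iG := iGh mA ig.
have ir := prod_leb_integrable_restrict mA mB ig.
rewrite Rintegral_mkcond /Rintegral; congr fine.
rewrite -(integral21_prod_meas1 ir).
transitivity (\int[leb_sf]_(y in B) Gh g A y)%E.
  rewrite [RHS]integral_mkcond; apply: eq_integral => y _.
  rewrite patchE /fubini_G; case: ifPn => yB.
    by apply: eq_integral => x _ /=; rewrite patchX yB.
  by rewrite integral0_eq// => x _ /=; rewrite patchX (negbTE yB).
have iGB : leb_sf.-integrable B (Gh g A) by apply: integrableS iG.
(* The real-valued slice integral takes the default value 0 where the extended one is infinite, so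
   the two agree only for almost every y. *)
apply: ae_eq_integral => //.
- exact: measurable_int iGB.
- apply/measurable_EFinP; apply: (@measurable_funS _ _ _ _ setT) => //.
  apply/measurable_EFinP; exact: measurable_int (prod_leb_slice_integrable mA ig).
- have := integrable_ae mB iGB; apply: ae_imp => y + yB => /(_ yB) fy /=.
  by rewrite -/(Rintegral m A (fun x => g (x, y))) GhE fineK.
Qed.

(** Peels off the last coordinate: for each i, the slice integral over [A i] is a function of y
    whose interval averages are bounded, hence is itself bounded a.e. Countability of [I] gives one
    null set for all i. *)
Lemma slice_bound (I : countType) (A : I -> set X) (M : I -> R) g :
  (forall i, measurable (A i)) ->
  prod_leb.-integrable setT (EFin \o g) ->
  (forall i (s t : rat), ratr s < ratr t :> R ->
    `|\int[prod_leb]_(z in A i `*` `]ratr s, ratr t[) g z| <= M i * (ratr t - ratr s)) ->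
  {ae leb, forall y, m.-integrable setT (fun x => (g (x, y))%:E) /\
     forall i, `|\int[m]_(x in A i) g (x, y)| <= M i}.
Proof.
move=> mA ig gM.
have a1 := ae_integrable2 ig.
have a2 : {ae leb, forall y i, `|\int[m]_(x in A i) g (x, y)| <= M i}.
  apply: (ae_forall_countable (mu := leb)) => i.
  apply: ae_norm_le_of_itv; first exact: prod_leb_slice_integrable.
  by move=> s t st; rewrite -prod_leb_Rintegral// gM.
by apply: ae_imp2 a1 a2 => y ? ?; split.
Qed.

Lemma ae_prod_leb g C : measurable_fun setT g ->
  {ae leb, forall y, {ae m, forall x, `|g (x, y)| <= C}} ->
  {ae prod_leb, forall z, `|g z| <= C}.
Proof.
move=> mg aeC.
pose N := [set z | C < `|g z|].
have mN : measurable N.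
  rewrite (_ : N = (fun z => `|g z|) @^-1` `]C, +oo[%classic); last first.
    by apply/seteqP; split=> z /=; rewrite in_itv/= andbT.
  rewrite -[X in measurable X]setTI.
  have mn : measurable_fun setT (fun z => `|g z|) by apply: measurableT_comp.
  by apply: mn.
exists N; split => //; last first.
  by move=> z /= /negP; rewrite -ltNge.
rewrite -[N]setIT -[LHS]integral_indic//.
have mI : measurable_fun [set: X * measurableTypeR R] (EFin \o (\1_N : _ -> R)).
  exact/measurable_EFinP.
have I0 z : (0 <= (EFin \o (\1_N : _ -> R)) z)%E by rewrite lee_fin.
rewrite (@fubini_tonelli2 _ _ _ _ R m leb_sf _ mI I0).
rewrite (@ae_eq_integral _ _ _ leb_sf setT (cst 0%E) (fubini_G m (EFin \o (\1_N : _ -> R))))//.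
- exact: integral0.
- exact: measurable_fun_fubini_tonelli_G.
apply: ae_imp aeC => y aey _; rewrite /fubini_G.
rewrite (@ae_eq_integral _ _ _ m setT (cst 0%E))//; first exact: integral0.
- apply: (measurableT_comp mI); exact: measurable_pair2.
apply: ae_imp aey => x gC _ /=; rewrite indicE.
by rewrite memNset// /N/=; apply/negP; rewrite -leNgt.
Qed.

End Slices.

(** * Tensor products of test functions *)

Section TestFunctions.
Variable R : realType.

Lemma test_function_of (V : normedModType R) (U K : set V) (phi : V -> R) :
  smooth phi -> compact K -> K `<=` U -> (forall x, ~ K x -> phi x = 0) ->
  test_function U phi.
Proof.
move=> sphi cK KU phi0.
have cl : closed K.
  by apply: compact_closed => //; exact: norm_hausdorff.
have sub : closure [set x | phi x != 0] `<=` K.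
  rewrite [X in _ `<=` X]((closure_id K).1 cl); apply: closure_subset.
  by move=> x /=; apply: contra_neqP; exact: phi0.
split=> //; last exact: subset_trans KU.
by apply: subclosed_compact sub => //; exact: closed_closure.
Qed.

Notation E := (R * R * R)%type.

Lemma affine_fst (V W : normedModType R) (l l' : V -> R) :
  affine_form l l' -> affine_form (fun x : V * W => l x.1) (fun v => l' v.1).
Proof.
move=> al x; have [dl ll] := al x.1.
have cf : continuous (fst : V * W -> V) by move=> z; exact: cvg_fst.
have df : differentiable (fst : V * W -> V) x.
  by apply: linear_differentiable; exact: cf.
split=> [|v]; first by apply: (@differentiable_comp _ _ _ _ fst l).
rewrite deriveE; last by apply: (@differentiable_comp _ _ _ _ fst l).
rewrite (diff_comp df dl) /= diff_lin//.
by rewrite -ll deriveE.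
Qed.

Lemma affine_snd (V W : normedModType R) (l l' : W -> R) :
  affine_form l l' -> affine_form (fun x : V * W => l x.2) (fun v => l' v.2).
Proof.
move=> al x; have [dl ll] := al x.2.
have cf : continuous (snd : V * W -> W) by move=> z; exact: cvg_snd.
have df : differentiable (snd : V * W -> W) x.
  by apply: linear_differentiable; exact: cf.
split=> [|v]; first by apply: (@differentiable_comp _ _ _ _ snd l).
rewrite deriveE; last by apply: (@differentiable_comp _ _ _ _ snd l).
rewrite (diff_comp df dl) /= diff_lin//.
by rewrite -ll deriveE.
Qed.

Lemma affine_id : affine_form (fun x : R => x) (fun v => v).
Proof. by move=> x; split=> [//|v]; rewrite derive_id. Qed.

Definition coord (i : 'I_3) (x : E) : R :=
  if i == 0 :> nat then x.1.1 else if i == 1 :> nat then x.1.2 else x.2.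

Lemma affine_coord i : affine_form (coord i) (coord i).
Proof.
case: i => [[|[|[|]]]//= ?].
- exact: (affine_fst (affine_fst affine_id)).
- exact: (affine_fst (affine_snd affine_id)).
- exact: (affine_snd affine_id).
Qed.

Definition tensor (a b c : R -> R) (x : E) : R := a x.1.1 * b x.1.2 * c x.2.

Lemma tensor_smooth a b c : smooth a -> smooth b -> smooth c -> smooth (tensor a b c).
Proof.
move=> sa sb sc; apply: (@smooth_mul R _ (fun x => a x.1.1 * b x.1.2) (fun x => c x.2)).
- apply: (@smooth_mul R _ (fun x => a x.1.1) (fun x => b x.1.2)).
  + exact: (smooth_comp_affine (affine_coord 0)).
  + exact: (smooth_comp_affine (affine_coord 1)).
- exact: (smooth_comp_affine (affine_coord 2)).
Qed.

Lemma derive_tensor a b c v : smooth a -> smooth b -> smooth c ->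
  'D_v (tensor a b c) = (fun x => v.1.1 * tensor (derive1 a) b c x +
     v.1.2 * tensor a (derive1 b) c x + v.2 * tensor a b (derive1 c) x).
Proof.
move=> sa sb sc.
have s0 : smooth (fun x : E => a x.1.1) := smooth_comp_affine (affine_coord 0) sa.
have s1 : smooth (fun x : E => b x.1.2) := smooth_comp_affine (affine_coord 1) sb.
have s2 : smooth (fun x : E => c x.2) := smooth_comp_affine (affine_coord 2) sc.
rewrite (@deriveMf R _ (fun x : E => a x.1.1 * b x.1.2) (fun x => c x.2)); last 2 first.
- by move=> x; apply: smooth_differentiable; apply: smooth_mul.
- by move=> x; apply: smooth_differentiable.
rewrite (@deriveMf R _ (fun x : E => a x.1.1) (fun x => b x.1.2)); last 2 first.
- by move=> x; apply: smooth_differentiable.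
- by move=> x; apply: smooth_differentiable.
apply/funext => x /=.
rewrite -[fun x : E => a x.1.1]/(a \o coord 0) -[fun x : E => b x.1.2]/(b \o coord 1).
rewrite -[fun x : E => c x.2]/(c \o coord 2).
rewrite (derive_comp_affine _ (affine_coord 0)); last exact: smooth_differentiable.
rewrite (derive_comp_affine _ (affine_coord 1)); last exact: smooth_differentiable.
rewrite (derive_comp_affine _ (affine_coord 2)); last exact: smooth_differentiable.
rewrite /tensor /coord/=; ring.
Qed.

Lemma derive_tensor0 a b c : smooth a -> smooth b -> smooth c ->
  'D_(unitv R 0) (tensor a b c) = tensor (derive1 a) b c.
Proof.
by move=> *; rewrite derive_tensor//; apply/funext => x /=; rewrite mul1r !mul0r !addr0.
Qed.

Lemma derive_tensor1 a b c : smooth a -> smooth b -> smooth c ->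
  'D_(unitv R 1) (tensor a b c) = tensor a (derive1 b) c.
Proof.
by move=> *; rewrite derive_tensor//; apply/funext => x /=; rewrite mul1r !mul0r add0r addr0.
Qed.

Lemma derive_tensor2 a b c : smooth a -> smooth b -> smooth c ->
  'D_(unitv R 2) (tensor a b c) = tensor a b (derive1 c).
Proof.
by move=> *; rewrite derive_tensor//; apply/funext => x /=; rewrite mul1r !mul0r !add0r.
Qed.

Definition box (l u : E) : set E :=
  [set x | [/\ x.1.1 \in `[l.1.1, u.1.1], x.1.2 \in `[l.1.2, u.1.2] & x.2 \in `[l.2, u.2]]].

Lemma boxE l u : box l u =
  (`[l.1.1, u.1.1] `*` `[l.1.2, u.1.2]) `*` `[l.2, u.2].
Proof.
apply/seteqP; split=> [x [x0 x1 x2]|x [[x0 x1] x2]]; first by split=> //; split.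
by split.
Qed.

Lemma compact_box l u : compact (box l u).
Proof.
rewrite boxE; apply: compact_setX; last exact: segment_compact.
by apply: compact_setX; exact: segment_compact.
Qed.

Lemma tensor_test l u a b c : line_test l.1.1 u.1.1 a -> line_test l.1.2 u.1.2 b ->
  line_test l.2 u.2 c -> test_function setT (tensor a b c).
Proof.
move=> [sa a0] [sb b0] [sc c0]; apply: (test_function_of _ (@compact_box l u)) => //.
  exact: tensor_smooth.
move=> x xB; rewrite /tensor.
have [x0|/a0->] := boolP (x.1.1 \in `[l.1.1, u.1.1]); last by rewrite !mul0r.
have [x1|/b0->] := boolP (x.1.2 \in `[l.1.2, u.1.2]); last by rewrite mulr0 mul0r.
have [x2|/c0->] := boolP (x.2 \in `[l.2, u.2]); last by rewrite mulr0.
by case: xB; split.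
Qed.

End TestFunctions.

(** * Pairings with bounded functions of bounded support *)

Section DominatedPairing.
Context d (T : measurableType d) (R : realType) (mu : {measure set T -> \bar R}).
Variables (B : set T) (mB : measurable B).
Implicit Types (f phi : T -> R) (K : R).

Lemma integrable_off f : (forall x, ~ B x -> f x = 0) ->
  mu.-integrable B (EFin \o f) -> mu.-integrable setT (EFin \o f).
Proof.
move=> f0 iB; suff -> : EFin \o f = (EFin \o f) \_ B by rewrite -integrable_mkcond.
apply/funext => x; rewrite patchE; case: ifPn => //.
by rewrite notin_setE => /f0 /= ->.
Qed.

Definition dominated_on K phi :=
  [/\ measurable_fun setT phi, (forall x, `|phi x| <= K) &
      forall x, ~ B x -> phi x = 0].

Lemma integrable_pair K f phi : measurable_fun setT f -> mu.-integrable B (EFin \o f) ->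
  dominated_on K phi -> mu.-integrable setT (EFin \o (fun x => f x * phi x)).
Proof.
move=> mf fi [mphi phiK phi0]; apply: integrable_off.
  by move=> x /phi0 ->; rewrite mulr0.
apply: (@integrable_le _ _ _ mu _ _ _ (fun x => K * `|f x|)).
- exact: mB.
- by apply: (@measurable_funS _ _ _ _ setT) => //; exact: measurable_funM.
- by apply: integrable_scaler => //; apply: (@integrable_norm _ _ _ mu).
- by move=> x _; rewrite normrM mulrC ler_wpM2r.
Qed.

Lemma dominated_powR K phi (q : R) : 0 <= K -> 0 < q -> dominated_on K phi ->
  (\int[mu]_x (`|phi x| `^ q)%:E <= (K `^ q)%:E * mu B)%E.
Proof.
move=> K0 q0 [mphi phiK phi0].
rewrite -integral_cst// [leRHS]integral_mkcond.
apply: ge0_le_integral => //.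
- apply/measurable_EFinP; apply: (@measurableT_comp _ _ _ _ _ _ (@powR R ^~ q)).
    exact: measurable_powR.
  exact: measurableT_comp.
- by apply/(measurable_restrictT _ _).1 => //; exact: measurable_cst.
move=> x _; rewrite patchE; case: ifPn => [_|].
  by rewrite lee_fin ge0_ler_powR ?nnegrE// ?(ltW q0)// normr_ge0.
by rewrite notin_setE => /phi0 ->; rewrite normr0 powR0 ?gt_eqF.
Qed.

(** Hoelder's inequality with the conjugate exponent q: since B has measure at most 1, the L^q norm
    of phi is at most K whatever q is, so the constant does not depend on p. *)
Lemma pair_bound K phi f (p e : R) : 1 < p -> 0 <= K -> (mu B <= 1)%E ->
  measurable_fun setT f -> ('N[mu]_p%:E[EFin \o f] <= e%:E)%E -> dominated_on K phi ->
  `|\int[mu]_x (f x * phi x)| <= e * K.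
Proof.
move=> p1 K0 B1 mf fe dphi.
have mphi : measurable_fun setT phi by case: dphi.
have p0 : 0 < p by exact: lt_trans p1.
pose q := (1 - p^-1)^-1.
have q0 : 0 < q by rewrite invr_gt0 subr_gt0 invf_lt1.
have pq : p^-1 + q^-1 = 1 by rewrite /q invrK addrC subrK.
have phiq : ('N[mu]_q%:E[EFin \o phi] <= K%:E)%E.
  rewrite unlock.
  apply: (@le_trans _ _ (((K `^ q)%:E) `^ q^-1)%E).
    apply: gt0_ler_poweR => //.
    - by rewrite invr_ge0 ltW.
    - rewrite in_itv/= leey andbT; apply: integral_ge0 => x _.
      by rewrite lee_fin powR_ge0.
    - by rewrite in_itv/= lee_fin powR_ge0 leey.
    - apply: le_trans (_ : _ <= (K `^ q)%:E * mu B)%E _.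
        apply: le_trans (dominated_powR K0 q0 dphi).
        by [].
      by rewrite -[leRHS]mule1 lee_pmul// lee_fin powR_ge0.
  by rewrite poweR_EFin -powRrM mulfV ?gt_eqF// powRr1.
have := hoelder mu mf mphi p0 q0 pq.
rewrite Lnorm1 => H.
have {}H : (\int[mu]_x `|f x * phi x|%:E <= e%:E * K%:E)%E.
  apply: le_trans (lee_pmul _ _ fe phiq); first exact: H.
  - exact: Lnorm_ge0.
  - exact: Lnorm_ge0.
have ifp : mu.-integrable setT (EFin \o (fun x => f x * phi x)).
  apply/integrableP; split; first by apply/measurable_EFinP; exact: measurable_funM.
  by apply: le_lt_trans H _; rewrite -EFinM ltry.
apply: le_trans (le_normr_Rintegral _ _) _ => //.
rewrite /Rintegral -lee_fin fineK//; apply: integrable_fin_num => //.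
exact: (@integrable_norm _ _ _ mu).
Qed.

End DominatedPairing.

Section Pairing.
Variable R : realType.
Notation leb := (@lebesgue_measure R).
Notation mu := (@mu3 R).
Notation E := (R * R * R)%type.
Implicit Types (f g phi : E -> R) (l u : E).

Lemma measurable_box l u : measurable (box l u).
Proof. by rewrite boxE; apply: measurableX => //; apply: measurableX. Qed.

Lemma mu3_itv (I J K : interval R) :
  mu (([set` I] `*` [set` J]) `*` [set` K]) = (leb [set` I] * leb [set` J] * leb [set` K])%E.
Proof.
rewrite /mu3 /= (@product_measure1E _ _ _ _ R (prod_leb (leb_sf R)) (leb_sf R))//; last first.
  exact: measurableX.
by congr (_ * _)%E; rewrite [LHS](@product_measure1E _ _ _ _ R (leb_sf R) (leb_sf R)).
Qed.

Lemma mu3_box l u : l.1.1 <= u.1.1 -> l.1.2 <= u.1.2 -> l.2 <= u.2 ->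
  mu (box l u) = ((u.1.1 - l.1.1) * (u.1.2 - l.1.2) * (u.2 - l.2))%:E.
Proof.
move=> h0 h1 h2; rewrite boxE mu3_itv !lebesgue_measure_itv/= !lte_fin.
have aux (x y : R) : x <= y -> (if x < y then (y%:E - x%:E)%E else 0%E) = (y - x)%:E.
  by rewrite le_eqVlt => /predU1P[->|->]; rewrite ?ltxx ?subrr.
by rewrite !aux// -!EFinM.
Qed.

Lemma mu3_box_lty l u : (mu (box l u) < +oo)%E.
Proof.
rewrite boxE mu3_itv !lebesgue_measure_itv/= !lte_fin.
have aux (x y : R) : exists r : R, (if x < y then (y%:E - x%:E)%E else 0%E) = r%:E.
  by case: ifP => _; eexists; rewrite -?EFinB.
have [r0 ->] := aux l.1.1 u.1.1; have [r1 ->] := aux l.1.2 u.1.2.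
by have [r2 ->] := aux l.2 u.2; rewrite -!EFinM ltry.
Qed.

Lemma measurable_coord (a : R -> R) (pr : E -> R) : measurable_fun setT a ->
  measurable_fun setT pr -> measurable_fun setT (fun x => a (pr x)).
Proof. by move=> ma mp; apply: (measurableT_comp ma mp). Qed.

Lemma tensor_measurable (a b c : R -> R) : measurable_fun setT a ->
  measurable_fun setT b -> measurable_fun setT c -> measurable_fun setT (tensor a b c).
Proof.
move=> ma mb mc; apply: measurable_funM; first apply: measurable_funM.
- apply: measurable_coord ma _.
  exact: (measurableT_comp (@measurable_fst _ _ _ _) (@measurable_fst _ _ _ _)).
- apply: measurable_coord mb _.
  exact: (measurableT_comp (@measurable_snd _ _ _ _) (@measurable_fst _ _ _ _)).
- exact: (measurable_coord mc (@measurable_snd _ _ _ _)).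
Qed.

Lemma loc_integrable_pair l u K f phi : loc_integrable f ->
  dominated_on (box l u) K phi -> mu.-integrable setT (EFin \o (fun x => f x * phi x)).
Proof.
move=> [mf fi]; apply: (@integrable_pair _ _ _ mu _ (measurable_box l u)) => //.
exact: fi (@compact_box _ l u).
Qed.

Lemma Lp_measurable p f (e : R) : (Lp p f <= e%:E)%E -> measurable_fun setT f.
Proof. by rewrite /Lp; case: asboolP. Qed.

Lemma Lp_pair_bound l u K phi f (p e : R) : 1 < p -> 0 <= K -> (mu (box l u) <= 1)%E ->
  (Lp p%:E f <= e%:E)%E -> dominated_on (box l u) K phi ->
  `|\int[mu]_x (f x * phi x)| <= e * K.
Proof.
move=> p1 K0 B1 fe dphi; have mf := Lp_measurable fe.
move: fe; rewrite /Lp asboolT// => fe.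
exact: (@pair_bound _ _ _ mu _ (measurable_box l u) K phi f p).
Qed.

Lemma tensor_dominated l u (a b c : R -> R) (A B C : R) :
  line_test l.1.1 u.1.1 a -> line_test l.1.2 u.1.2 b -> line_test l.2 u.2 c ->
  (forall x, `|a x| <= A) -> (forall x, `|b x| <= B) -> (forall x, `|c x| <= C) ->
  dominated_on (box l u) (A * B * C) (tensor a b c).
Proof.
move=> [sa a0] [sb b0] [sc c0] aA bB cC; split.
- by apply: tensor_measurable; apply: continuous_measurable_fun; exact: smooth_continuous.
- by move=> x; rewrite /tensor !normrM !ler_pM// mulr_ge0.
move=> x xB; rewrite /tensor.
have [x0|/a0->] := boolP (x.1.1 \in `[l.1.1, u.1.1]); last by rewrite !mul0r.
have [x1|/b0->] := boolP (x.1.2 \in `[l.1.2, u.1.2]); last by rewrite mulr0 mul0r.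
have [x2|/c0->] := boolP (x.2 \in `[l.2, u.2]); last by rewrite mulr0.
by case: xB; split.
Qed.

End Pairing.

(** * Trilinear functionals bounded in orders 0, 1 and 3 *)

Section TensorFunctional.
Variable R : realType.
Notation leb := (@lebesgue_measure R).
Notation dd := derive1.
Notation N1 a := (\int[leb]_y `|a y|).

Lemma line_test_bounded (al be : R) (a : R -> R) : line_test al be a ->
  exists2 K : R, 0 <= K & forall x, `|a x| <= K.
Proof.
move=> [sa a0]; have [ab|ba] := leP al be; last first.
  exists 0 => // x; rewrite a0 ?normr0// in_itv/= negb_and -!ltNge.
  by have [//|ax] := ltP x al; rewrite (lt_le_trans ba ax).
have cn : continuous (fun x : R => `|a x|).
  by move=> x; apply: cvg_norm; exact: smooth_continuous.
have [c _ cmax] := @EVT_max R (fun x => `|a x|) al be ab (continuous_subspaceT cn).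
exists `|a c| => // x.
by have [/cmax//|/a0->] := boolP (x \in `[al, be]); rewrite normr0.
Qed.

Lemma theta_bounded : exists2 K : R, 0 <= K & forall x,
  `|@theta R x| <= K /\ `|derive1 (@theta R) x| <= K.
Proof.
have [K1 K10 H1] := line_test_bounded (theta_test R).
have [K2 K20 H2] := line_test_bounded (line_test_derive1 (theta_test R)).
exists (K1 + K2); first by rewrite addr_ge0.
move=> x; split; [apply: le_trans (H1 x) _|apply: le_trans (H2 x) _].
  by rewrite lerDl.
by rewrite lerDr.
Qed.

Lemma N1_ge0 (a : R -> R) : 0 <= N1 a.
Proof. exact: Rintegral_ge0. Qed.

Lemma line_test_N1 (j : R) (a : R -> R) (K : R) : line_test j (j + 1) a -> (forall x, `|a x| <= K) ->
  N1 a <= K.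
Proof.
move=> ta aK.
have E : (fun y => `|a y|) = (fun y => `|a y|) \_ `[j, j + 1].
  apply/funext => y; rewrite patchE; case: ifPn => //.
  by rewrite notin_setE/= => /negP; case: ta => _ a0 /a0 ->; rewrite normr0.
rewrite E -Rintegral_mkcond.
have -> : K = \int[leb]_(x in `[j, j + 1]) cst K x.
  rewrite Rintegral_cst//= lebesgue_measure_itv/= lte_fin ltrDl ltr01.
  by rewrite -EFinB addrAC subrr add0r mulr1.
apply: le_Rintegral => //.
- exact: line_test_norm_integrable ta.
- apply: continuous_compact_integrable; first exact: segment_compact.
  by apply: continuous_subspaceT => x; exact: cst_continuous.
Qed.

Variable T : (R -> R) -> (R -> R) -> (R -> R) -> R.
Variables (j0 j1 j2 e : R).
Notation t0 := (line_test j0 (j0 + 1)).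
Notation t1 := (line_test j1 (j1 + 1)).
Notation t2 := (line_test j2 (j2 + 1)).
Hypothesis Tl : forall a a' b c k, t0 a -> t0 a' -> t1 b -> t2 c ->
  T (fun x => k * a x + a' x) b c = k * T a b c + T a' b c.
Hypothesis Tm : forall a b b' c k, t0 a -> t1 b -> t1 b' -> t2 c ->
  T a (fun x => k * b x + b' x) c = k * T a b c + T a b' c.
Hypothesis Tr : forall a b c c' k, t0 a -> t1 b -> t2 c -> t2 c' ->
  T a b (fun x => k * c x + c' x) = k * T a b c + T a b c'.
(** [T] models the pairing of a fixed function with the tensor product of its arguments. Orders 0, 1
    and 3 are those that L^p, D^1 and D^3 bounds control by duality; order 2 has no bound. The four
    patterns of order 3 are those that the decomposition below produces. *)
Hypothesis T_bound : forall a b c (A B C : R), t0 a -> t1 b -> t2 c ->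
  (forall x, `|a x| <= A) -> (forall x, `|b x| <= B) -> (forall x, `|c x| <= C) ->
  [/\ `|T a b c| <= e * (A * B * C),
    [/\ `|T (dd a) b c| <= e * (A * B * C), `|T a (dd b) c| <= e * (A * B * C) &
        `|T a b (dd c)| <= e * (A * B * C)] &
    [/\ `|T (dd a) (dd b) (dd c)| <= e * (A * B * C), `|T (dd (dd a)) (dd b) c| <= e * (A * B * C),
        `|T (dd (dd a)) b (dd c)| <= e * (A * B * C) & `|T a (dd (dd b)) (dd c)| <= e * (A * B * C)]].

Let shift_test (j : R) : line_test j (j + 1) (fun x => @theta R (x - j)).
Proof.
have := theta_scale_test j (@ltr01 R); rewrite invr1.
by congr line_test; apply/funext => x; rewrite !mul1r.
Qed.

Let shift_derive1 (j x : R) : derive1 (fun x : R => @theta R (x - j)) x = derive1 (@theta R) (x - j).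
Proof.
have -> : (fun x : R => @theta R (x - j)) = (fun x => theta (1 * x + - j)).
  by apply/funext => y; rewrite mul1r.
by rewrite derive1_comp_line ?mul1r//; case: (theta_test R).
Qed.

(* Writing each factor as a multiple of a translate of [theta] plus the derivative of
   a primitive leaves terms with 0 to 3 derivatives; in the terms with 2 derivatives
   one primitive is split again, so that only 0, 1 or 3 derivatives occur.  The
   primitives are bounded by L^1 norms. *)
Lemma tensor_functional_bound (K : R) : 0 <= e -> (forall x, `|@theta R x| <= K /\ `|derive1 (@theta R) x| <= K) ->
  forall a b c, t0 a -> t1 b -> t2 c ->
  `|T a b c| <= 64 * (1 + K) ^+ 3 * e * (N1 a * N1 b * N1 c).
Proof.
move=> e0 thK a b c ta tb tc.
have K0 : 0 <= K by apply: le_trans (proj1 (thK 0)).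
pose h j : R -> R := fun x => @theta R (x - j).
have hK j x : `|h j x| <= K := proj1 (thK _).
have hK' j x : `|(dd (h j)) x| <= K by rewrite shift_derive1; apply: (proj2 (thK _)).
have th j : line_test j (j + 1) (h j) := shift_test j.
(* Two successive splittings. The primitive f1 is bounded by 2 N1 f; as its support has length 1,
   its L^1 norm is at most 2 N1 f as well, which bounds n and, after another doubling, gives 4 N1 f
   for f2. *)
have split2 j f : line_test j (j + 1) f -> exists m n f1 f2,
    [/\ line_test j (j + 1) f1, line_test j (j + 1) f2,
     f = (fun x => m * h j x + (dd f1) x), f1 = (fun x => n * h j x + (dd f2) x) &
     [/\ `|m| <= N1 f, `|n| <= 2 * N1 f, (forall x, `|f1 x| <= 2 * N1 f) &
         forall x, `|f2 x| <= 4 * N1 f]].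
  move=> tf; have [f1 tf1 [fE f1b]] := line_test_split tf.
  have [f2 tf2 [f1E f2b]] := line_test_split tf1.
  have Nf1 : N1 f1 <= 2 * N1 f by apply: line_test_N1 tf1 _.
  exists (\int[leb]_y f y), (\int[leb]_y f1 y), f1, f2; split=> //.
  - by apply/funext.
  - by apply/funext.
  split=> //.
  - by apply: le_normr_Rintegral => //; apply: line_test_integrable tf.
  - apply: le_trans Nf1; apply: le_normr_Rintegral => //.
    by apply: line_test_integrable tf1.
  - by move=> x; rewrite (le_trans (f2b x))//; lra.
have [ma [na [a1 [a2 [ta1 ta2 aE a1E [ma_ na_ a1b a2b]]]]]] := split2 _ _ ta.
have [mb [nb [b1 [b2 [tb1 tb2 bE b1E [mb_ nb_ b1b b2b]]]]]] := split2 _ _ tb.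
have [mc [nc [c1 [c2 [tc1 tc2 cE c1E [mc_ nc_ c1b c2b]]]]]] := split2 _ _ tc.
have a1'E : (dd a1) = (fun x => na * (dd (h j0)) x + (dd (dd a2)) x).
  apply/funext => x; rewrite {1}a1E.
  rewrite !derive1E -[fun x => _]/((fun x => na * h j0 x) \+ (dd a2)) deriveD.
  - by rewrite -[fun x => _]/(na *: h j0) deriveZ//; apply: smooth_derivable; case: (th j0).
  - by apply: (@derivableZ _ _ _ (h j0) na); apply: smooth_derivable; case: (th j0).
  - by apply: smooth_derivable; apply: smooth_derive1; case: ta2.
have b1'E : (dd b1) = (fun x => nb * (dd (h j1)) x + (dd (dd b2)) x).
  apply/funext => x; rewrite {1}b1E.
  rewrite !derive1E -[fun x => _]/((fun x => nb * h j1 x) \+ (dd b2)) deriveD.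
  - by rewrite -[fun x => _]/(nb *: h j1) deriveZ//; apply: smooth_derivable; case: (th j1).
  - by apply: (@derivableZ _ _ _ (h j1) nb); apply: smooth_derivable; case: (th j1).
  - by apply: smooth_derivable; apply: smooth_derive1; case: tb2.
have ta1' := line_test_derive1 ta1; have tb1' := line_test_derive1 tb1.
have tc1' := line_test_derive1 tc1.
have ta2' := line_test_derive1 (line_test_derive1 ta2).
have tb2' := line_test_derive1 (line_test_derive1 tb2).
have h0' := line_test_derive1 (th j0); have h1' := line_test_derive1 (th j1).
set Na := N1 a; set Nb := N1 b; set Nc := N1 c.
have Na0 : 0 <= Na := N1_ge0 a; have Nb0 : 0 <= Nb := N1_ge0 b.
have Nc0 : 0 <= Nc := N1_ge0 c.
rewrite -/Na in ma_ na_ a1b a2b; rewrite -/Nb in mb_ nb_ b1b b2b.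
rewrite -/Nc in mc_ nc_ c1b c2b.
have TE : T a b c =
  ma * mb * mc * T (h j0) (h j1) (h j2) + ma * mb * T (h j0) (h j1) (dd c1) +
  ma * mc * T (h j0) (dd b1) (h j2) + ma * T (h j0) (dd b1) (dd c1) +
  mb * mc * T (dd a1) (h j1) (h j2) + mb * T (dd a1) (h j1) (dd c1) +
  mc * T (dd a1) (dd b1) (h j2) + T (dd a1) (dd b1) (dd c1).
  rewrite {1}aE Tl// {1 2}bE !Tm// {1 2 3 4}cE !Tr//; ring.
(* A term with two derivatives is not controlled. Expanding one primitive again gives a term where
   the derivative of [h] counts as a plain bounded factor, so that order 1 remains, and a term of
   order 3. *)
have E1 : T (h j0) (dd b1) (dd c1) = nb * T (h j0) (dd (h j1)) (dd c1) + T (h j0) (dd (dd b2)) (dd c1).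
  by rewrite {1}b1'E Tm.
have E2 : T (dd a1) (h j1) (dd c1) = na * T (dd (h j0)) (h j1) (dd c1) + T (dd (dd a2)) (h j1) (dd c1).
  by rewrite {1}a1'E Tl.
have E3 : T (dd a1) (dd b1) (h j2) = na * T (dd (h j0)) (dd b1) (h j2) + T (dd (dd a2)) (dd b1) (h j2).
  by rewrite {1}a1'E Tl.
have [B1 _ _] := T_bound (th j0) (th j1) (th j2) (hK _) (hK _) (hK _).
have [_ [_ _ B2] _] := T_bound (th j0) (th j1) tc1 (hK _) (hK _) c1b.
have [_ [_ B3 _] _] := T_bound (th j0) tb1 (th j2) (hK _) b1b (hK _).
have [_ [_ _ B4] _] := T_bound (th j0) h1' tc1 (hK _) (hK' _) c1b.
have [_ _ [_ _ _ B4']] := T_bound (th j0) tb2 tc1 (hK _) b2b c1b.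
have [_ [B5 _ _] _] := T_bound ta1 (th j1) (th j2) a1b (hK _) (hK _).
have [_ [_ _ B6] _] := T_bound h0' (th j1) tc1 (hK' _) (hK _) c1b.
have [_ _ [_ _ B6' _]] := T_bound ta2 (th j1) tc1 a2b (hK _) c1b.
have [_ [_ B7 _] _] := T_bound h0' tb1 (th j2) (hK' _) b1b (hK _).
have [_ _ [_ B7' _ _]] := T_bound ta2 tb1 (th j2) a2b b1b (hK _).
have [_ _ [B8 _ _ _]] := T_bound ta1 tb1 tc1 a1b b1b c1b.
set P := Na * Nb * Nc.
have P0 : 0 <= P by rewrite !mulr_ge0.
have M3 (x y z t X Y Z W : R) : `|x| <= X -> `|y| <= Y -> `|z| <= Z -> `|t| <= W ->
    `|x * y * z * t| <= X * Y * Z * W.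
  by move=> *; rewrite !normrM !ler_pM// !mulr_ge0.
have M2 (x y t X Y W : R) : `|x| <= X -> `|y| <= Y -> `|t| <= W -> `|x * y * t| <= X * Y * W.
  by move=> *; rewrite !normrM !ler_pM// !mulr_ge0.
have M1 (x t X W : R) : `|x| <= X -> `|t| <= W -> `|x * t| <= X * W.
  by move=> *; rewrite !normrM !ler_pM.
have C1 := M3 _ _ _ _ _ _ _ _ ma_ mb_ mc_ B1.
have C2 := M2 _ _ _ _ _ _ ma_ mb_ B2.
have C3 := M2 _ _ _ _ _ _ ma_ mc_ B3.
have C4 := M1 _ _ _ _ ma_ (le_trans (ler_normD _ _) (lerD (M1 _ _ _ _ nb_ B4) B4')).
have C5 := M2 _ _ _ _ _ _ mb_ mc_ B5.
have C6 := M1 _ _ _ _ mb_ (le_trans (ler_normD _ _) (lerD (M1 _ _ _ _ na_ B6) B6')).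
have C7 := M1 _ _ _ _ mc_ (le_trans (ler_normD _ _) (lerD (M1 _ _ _ _ na_ B7) B7')).
rewrite TE E1 E2 E3.
have nD (x y X Y : R) : `|x| <= X -> `|y| <= Y -> `|x + y| <= X + Y.
  by move=> hx hy; apply: le_trans (ler_normD _ _) _; apply: lerD.
apply: le_trans (nD _ _ _ _ (nD _ _ _ _ (nD _ _ _ _ (nD _ _ _ _ (nD _ _ _ _
  (nD _ _ _ _ (nD _ _ _ _ C1 C2) C3) C4) C5) C6) C7) B8) _.
have -> : 64 * (1 + K) ^+ 3 * e * P = e * P * (64 * (1 + K) ^+ 3) by ring.
(* By number of differentiated factors: K^3 for none, 2 K^2 for each of the three terms with one, 4
   K^2 + 8 K for each of the three with two, and 8 for the term with three. *)
rewrite [leLHS](_ : _ = e * P * (K ^+ 3 + 6 * K ^+ 2 + 12 * K ^+ 2 + 24 * K + 8)); last first.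
  rewrite /P; ring.
rewrite ler_wpM2l ?mulr_ge0//; nra.
Qed.

End TensorFunctional.

(** * Sup bounds from Sobolev norms *)

Section SobolevPairing.
Variable R : realType.
Notation leb := (@lebesgue_measure R).
Notation mu := (@mu3 R).
Notation E := (R * R * R)%type.
Notation i0 := (0 : 'I_3).
Notation i1 := (1 : 'I_3).
Notation i2 := (2 : 'I_3).

(** What [D1star] with D^3 (p = 6) and H^3 (p = 2) have in common; order 2 is left out because the
    former pair does not measure it. *)
Definition sobolev_le (p e : R) (g : E -> R) :=
  [/\ loc_integrable g,
   exists2 g0, is_weak_deriv [::] g g0 & (Lp p%:E g0 <= e%:E)%E &
   forall s : seq 'I_3, (size s == 1%N) || (size s == 3%N) ->
     exists2 gs, is_weak_deriv s g gs & (Lp 2%:E gs <= e%:E)%E].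

(** The derivatives of the test function are moved onto [g], so only sup norms of the
    undifferentiated factors enter. *)
Lemma weak_tensor_bound s g gs (p e : R) l u (a b c : R -> R) (A B C : R) :
  1 < p -> is_weak_deriv s g gs -> (Lp p%:E gs <= e%:E)%E ->
  (mu (box l u) <= 1)%E ->
  line_test l.1.1 u.1.1 a -> line_test l.1.2 u.1.2 b -> line_test l.2 u.2 c ->
  (forall x, `|a x| <= A) -> (forall x, `|b x| <= B) -> (forall x, `|c x| <= C) ->
  `|\int[mu]_x (g x * partials s (tensor a b c) x)| <= e * (A * B * C).
Proof.
move=> p1 [_ _ wg] gse muB ta tb tc aA bB cC.
rewrite wg; last exact: tensor_test ta tb tc.
have K0 : 0 <= A * B * C by rewrite !mulr_ge0// ?(le_trans (normr_ge0 _) (aA 0))//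
  ?(le_trans (normr_ge0 _) (bB 0))// (le_trans (normr_ge0 _) (cC 0)).
have := Lp_pair_bound p1 K0 muB gse (tensor_dominated ta tb tc aA bB cC).
by rewrite normrM normrX normrN1 expr1n mul1r.
Qed.

Lemma sobolev_tensor_bound (p e : R) g : 1 < p -> sobolev_le p e g ->
  forall (j0 j1 j2 : R) (a b c : R -> R) (A B C : R),
  line_test j0 (j0 + 1) a -> line_test j1 (j1 + 1) b -> line_test j2 (j2 + 1) c ->
  (forall x, `|a x| <= A) -> (forall x, `|b x| <= B) -> (forall x, `|c x| <= C) ->
  let T a b c := \int[mu]_x (g x * tensor a b c x) in
  let d := (@derive1 R R) in
  [/\ `|T a b c| <= e * (A * B * C),
    [/\ `|T (d a) b c| <= e * (A * B * C), `|T a (d b) c| <= e * (A * B * C) &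
        `|T a b (d c)| <= e * (A * B * C)] &
    [/\ `|T (d a) (d b) (d c)| <= e * (A * B * C), `|T (d (d a)) (d b) c| <= e * (A * B * C),
        `|T (d (d a)) b (d c)| <= e * (A * B * C) & `|T a (d (d b)) (d c)| <= e * (A * B * C)]].
Proof.
move=> p1 [lg [g0 wg0 gp] gD] j0 j1 j2 a b c A B C ta tb tc aA bB cC T d.
pose l : E := ((j0, j1), j2); pose u : E := ((j0 + 1, j1 + 1), j2 + 1).
have muB : (mu (box l u) <= 1)%E.
  rewrite mu3_box/= ?lerDl//.
  by rewrite !(addrAC _ 1) !subrr !add0r !mulr1.
have W s : (size s == 1%N) || (size s == 3%N) ->
    `|\int[mu]_x (g x * partials s (tensor a b c) x)| <= e * (A * B * C).
  move=> /gD[gs wgs gse].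
  by apply: (@weak_tensor_bound s g gs 2 e l u) => //; rewrite ltr1n.
have [sa sb sc] : [/\ smooth a, smooth b & smooth c] by case: ta tb tc => ? _ [? _] [? _].
have sa' := smooth_derive1 sa; have sb' := smooth_derive1 sb; have sc' := smooth_derive1 sc.
have sb'' := smooth_derive1 sb'.
have sa'' := smooth_derive1 sa'.
split.
- exact: (@weak_tensor_bound [::] g g0 p e l u).
- split.
  + have E : partials [:: i0] (tensor a b c) = tensor (d a) b c := derive_tensor0 sa sb sc.
    by have := W [:: i0] isT; rewrite E.
  + have E : partials [:: i1] (tensor a b c) = tensor a (d b) c := derive_tensor1 sa sb sc.
    by have := W [:: i1] isT; rewrite E.
  + have E : partials [:: i2] (tensor a b c) = tensor a b (d c) := derive_tensor2 sa sb sc.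
    by have := W [:: i2] isT; rewrite E.
- split.
  + have E : partials [:: i0; i1; i2] (tensor a b c) = tensor (d a) (d b) (d c).
      by rewrite /partials/= (derive_tensor2 sa sb sc) (derive_tensor1 sa sb sc') (derive_tensor0 sa sb' sc').
    by have := W [:: i0; i1; i2] isT; rewrite E.
  + have E : partials [:: i0; i0; i1] (tensor a b c) = tensor (d (d a)) (d b) c.
      by rewrite /partials/= (derive_tensor1 sa sb sc) (derive_tensor0 sa sb' sc) (derive_tensor0 sa' sb' sc).
    by have := W [:: i0; i0; i1] isT; rewrite E.
  + have E : partials [:: i0; i0; i2] (tensor a b c) = tensor (d (d a)) b (d c).
      by rewrite /partials/= (derive_tensor2 sa sb sc) (derive_tensor0 sa sb sc') (derive_tensor0 sa' sb sc').
    by have := W [:: i0; i0; i2] isT; rewrite E.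
  + have E : partials [:: i1; i1; i2] (tensor a b c) = tensor a (d (d b)) (d c).
      by rewrite /partials/= (derive_tensor2 sa sb sc) (derive_tensor1 sa sb sc') (derive_tensor1 sa sb' sc').
    by have := W [:: i1; i1; i2] isT; rewrite E.
Qed.

Lemma sobolev_pairing_bound : exists2 K : R, 0 <= K & forall (p e : R) g, 1 < p -> 0 <= e ->
  sobolev_le p e g ->
  forall (j0 j1 j2 : R) (a b c : R -> R),
  line_test j0 (j0 + 1) a -> line_test j1 (j1 + 1) b -> line_test j2 (j2 + 1) c ->
  `|\int[mu]_x (g x * tensor a b c x)| <=
    K * e * ((\int[leb]_y `|a y|) * (\int[leb]_y `|b y|) * (\int[leb]_y `|c y|)).
Proof.
have [K K0 thK] := theta_bounded R.
exists (64 * (1 + K) ^+ 3); first by rewrite mulr_ge0// exprn_ge0// addr_ge0.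
move=> p e g p1 e0 sg j0 j1 j2 a b c ta tb tc.
have [lg _ _] := sg.
have int a' b' c' j0' j1' j2' : line_test j0' (j0' + 1) a' -> line_test j1' (j1' + 1) b' ->
    line_test j2' (j2' + 1) c' ->
    mu.-integrable setT (EFin \o (fun x => g x * tensor a' b' c' x)).
  move=> ta' tb' tc'.
  have [A _ aA] := line_test_bounded ta'; have [B _ bB] := line_test_bounded tb'.
  have [C _ cC] := line_test_bounded tc'.
  exact: (loc_integrable_pair lg (@tensor_dominated R ((j0', j1'), j2')
    ((j0' + 1, j1' + 1), j2' + 1) _ _ _ _ _ _ ta' tb' tc' aA bB cC)).
apply: (@tensor_functional_bound R (fun a b c => \int[mu]_x (g x * tensor a b c x)) j0 j1 j2) => //.
- move=> f f' b' c' k tf tf' tb' tc'; rewrite -RintegralZl//; last exact: int tf tb' tc'.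
  rewrite -RintegralD//; last 2 first.
  + by apply: integrable_scaler => //; exact: int tf tb' tc'.
  + exact: int tf' tb' tc'.
  by apply: eq_Rintegral => x _; rewrite /tensor; ring.
- move=> f b' b'' c' k tf tb' tb'' tc'; rewrite -RintegralZl//; last exact: int tf tb' tc'.
  rewrite -RintegralD//; last 2 first.
  + by apply: integrable_scaler => //; exact: int tf tb' tc'.
  + exact: int tf tb'' tc'.
  by apply: eq_Rintegral => x _; rewrite /tensor; ring.
- move=> f b' c' c'' k tf tb' tc' tc''; rewrite -RintegralZl//; last exact: int tf tb' tc'.
  rewrite -RintegralD//; last 2 first.
  + by apply: integrable_scaler => //; exact: int tf tb' tc'.
  + exact: int tf tb' tc''.
  by apply: eq_Rintegral => x _; rewrite /tensor; ring.
- move=> f f' f'' A B C tf tf' tf'' fA fB fC.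
  exact: (sobolev_tensor_bound p1 sg tf tf' tf'' fA fB fC).
Qed.

(** The product of step (n (x - s)) and step (n (t - x)): a smooth approximation, from inside, of
    the indicator of the open interval between s and t. *)
Definition plateau (s t : R) (n : nat) (x : R) : R :=
  step (n%:R * x + - (n%:R * s)) * step (- n%:R * x + n%:R * t).

Lemma plateau_test s t n : line_test s t (plateau s t n).
Proof.
split; first by apply: smooth_mul; apply: smooth_comp_line; exact: step_smooth.
move=> x; rewrite in_itv/= negb_and -!ltNge => /orP[xs|tx].
  rewrite /plateau step_left ?mul0r// -mulrBr.
  by rewrite mulr_ge0_le0// subr_le0 ltW.
rewrite /plateau mulrC step_left ?mul0r// mulNr addrC -mulrBr.
by rewrite mulr_ge0_le0// subr_le0 ltW.
Qed.

Lemma plateau_ge0 s t n x : 0 <= plateau s t n x.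
Proof. by rewrite mulr_ge0// step_ge0. Qed.

Lemma plateau_le1 s t n x : plateau s t n x <= 1.
Proof. by rewrite -[leRHS]mulr1 ler_pM ?step_ge0 ?step_le1. Qed.

Lemma plateau_cvg s t x : plateau s t n x @[n --> \oo] --> (\1_(`]s, t[%classic) x : R).
Proof.
have [xst|xst] := boolP (x \in `]s, t[); last first.
  rewrite indicE memNset/=; last exact/negP.
  rewrite (_ : (fun n => _) = cst 0); first exact: cvg_cst.
  apply/funext => n; move: xst; rewrite in_itv/= negb_and -!leNgt => /orP[xs|tx].
    rewrite /plateau step_left ?mul0r// -mulrBr.
    by rewrite mulr_ge0_le0// subr_le0.
  rewrite /plateau mulrC step_left ?mul0r// mulNr addrC -mulrBr.
  by rewrite mulr_ge0_le0// subr_le0.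
rewrite indicE mem_set//; apply: cvg_near_cst.
move: xst; rewrite in_itv/= => /andP[sx xt].
have step1 (y : R) : 0 < y -> \forall n \near \oo, step (n%:R * y) = 1 :> R.
  move=> y0; near=> n; rewrite step_right// -ler_pdivrMr// mul1r.
  by near: n; exact: nbhs_infty_ger.
near=> n; rewrite /plateau -mulrBr mulNr addrC -addrC [X in _ * step X]addrC -mulrBr.
have -> : step (n%:R * (x - s)) = 1 :> R by near: n; apply: step1; rewrite subr_gt0.
have -> : step (n%:R * (t - x)) = 1 :> R by near: n; apply: step1; rewrite subr_gt0.
by rewrite mulr1.
Unshelve. all: by end_near. Qed.

Lemma plateau_N1 s t n : s <= t -> \int[leb]_y `|plateau s t n y| <= t - s.
Proof.
move=> st.
have -> : t - s = \int[leb]_(x in `[s, t]) cst 1 x.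
  rewrite Rintegral_cst//= lebesgue_measure_itv/= lte_fin mul1r.
  by move: st; rewrite le_eqVlt => /predU1P[->|->]; rewrite ?ltxx ?subrr.
have -> : (fun y => `|plateau s t n y|) = plateau s t n.
  by apply/funext => y; rewrite ger0_norm// plateau_ge0.
rewrite (line_test_Rintegral (plateau_test s t n)); apply: le_Rintegral => //.
- by apply: line_test_integrable (plateau_test s t n).
- apply: continuous_compact_integrable; first exact: segment_compact.
  by apply: continuous_subspaceT => x; exact: cst_continuous.
- by move=> x _; exact: plateau_le1.
Qed.

Definition obox (l u : E) : set E :=
  (`]l.1.1, u.1.1[ `*` `]l.1.2, u.1.2[) `*` `]l.2, u.2[.

Lemma measurable_obox l u : measurable (obox l u).
Proof. by apply: measurableX => //; apply: measurableX. Qed.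

End SobolevPairing.

Section RealDominated.
Context d (T : measurableType d) (R : realType) (mu : {measure set T -> \bar R}).

Lemma Rdominated_cvg (D : set T) (f_ : nat -> T -> R) (f g : T -> R) : measurable D ->
  (forall n, measurable_fun D (f_ n)) -> measurable_fun D f ->
  {ae mu, forall x, D x -> f_ n x @[n --> \oo] --> f x} ->
  mu.-integrable D (EFin \o g) ->
  {ae mu, forall x, forall n, D x -> `|f_ n x| <= g x} ->
  mu.-integrable D (EFin \o f) /\
  \int[mu]_(x in D) f_ n x @[n --> \oo] --> \int[mu]_(x in D) f x.
Proof.
move=> mD mf_ mf f_f ig f_g.
have aec : {ae mu, forall x, D x -> (EFin \o f_ n) x @[n --> \oo] --> (EFin \o f) x}.
  apply: ae_imp f_f => x h Dx; apply: cvg_EFin; first exact: nearW.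
  exact: h.
have [if_ _ cv] := @dominated_convergence _ _ _ mu D mD (fun n => EFin \o f_ n)
  (EFin \o f) (EFin \o g) (fun n => (measurable_EFinP _ _).2 (mf_ n))
  ((measurable_EFinP _ _).2 mf) aec ig f_g.
split=> //; apply: fine_cvg.
rewrite fineK; last exact: integrable_fin_num.
exact: cv.
Qed.

Lemma cvg_norm_le (u : nat -> R) (l C : R) : u n @[n --> \oo] --> l ->
  (forall n, `|u n| <= C) -> `|l| <= C.
Proof.
move=> ul uC; have nl : `|u n| @[n --> \oo] --> `|l| by exact: cvg_norm.
by apply: (ler_cvg_to nl (cvg_cst C)); apply: nearW.
Qed.

End RealDominated.

Section SobolevSup.
Variable R : realType.
Notation leb := (@lebesgue_measure R).
Notation mu := (@mu3 R).
Notation E := (R * R * R)%type.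
Implicit Types (g : E -> R) (l u : E).

Lemma line_test_sub (s t al be : R) (a : R -> R) : al <= s -> t <= be ->
  line_test s t a -> line_test al be a.
Proof.
move=> als tbe [sa a0]; split=> // x; rewrite in_itv/= negb_and -!ltNge => xab.
apply: a0; rewrite in_itv/= negb_and -!ltNge; case/orP: xab => [xa|bx].
  by rewrite (lt_le_trans xa).
by rewrite (le_lt_trans tbe bx) orbT.
Qed.

Definition sobolev_constant : R := projT1 (cid2 (sobolev_pairing_bound R)).

Lemma sobolev_constant_ge0 : 0 <= sobolev_constant.
Proof. by rewrite /sobolev_constant; case: cid2. Qed.

Lemma sobolev_constantP (p e : R) g : 1 < p -> 0 <= e -> sobolev_le p e g ->
  forall (j0 j1 j2 : R) (a b c : R -> R),
  line_test j0 (j0 + 1) a -> line_test j1 (j1 + 1) b -> line_test j2 (j2 + 1) c ->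
  `|\int[mu]_x (g x * tensor a b c x)| <= sobolev_constant * e *
    ((\int[leb]_y `|a y|) * (\int[leb]_y `|b y|) * (\int[leb]_y `|c y|)).
Proof. by rewrite /sobolev_constant; case: cid2 => /= K _; apply. Qed.

Lemma tensor_indic l u x :
  tensor (\1_(`]l.1.1, u.1.1[%classic)) (\1_(`]l.1.2, u.1.2[%classic))
    (\1_(`]l.2, u.2[%classic)) x = \1_(obox l u) x :> R.
Proof.
rewrite /tensor !indicE /obox !in_setX -!natrM !mulnb.
by [].
Qed.

(** Tensors of plateaus converge boundedly to the indicator of the box and have L^1 norms at most
    the side lengths. Here the L^1 norms of [sobolev_constantP] matter: with sup norms the volume
    factor would be lost. *)
Lemma box_average (p e : R) g : 1 < p -> 0 <= e -> sobolev_le p e g ->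
  forall j l u : E,
  j.1.1 <= l.1.1 -> l.1.1 <= u.1.1 -> u.1.1 <= j.1.1 + 1 ->
  j.1.2 <= l.1.2 -> l.1.2 <= u.1.2 -> u.1.2 <= j.1.2 + 1 ->
  j.2 <= l.2 -> l.2 <= u.2 -> u.2 <= j.2 + 1 ->
  `|\int[mu]_(x in obox l u) g x| <= sobolev_constant * e *
     ((u.1.1 - l.1.1) * (u.1.2 - l.1.2) * (u.2 - l.2)).
Proof.
move=> p1 e0 sg j l u jl0 lu0 uj0 jl1 lu1 uj1 jl2 lu2 uj2.
have [lg _ _] := sg; have [mg ig] := lg.
pose a n := tensor (plateau l.1.1 u.1.1 n) (plateau l.1.2 u.1.2 n) (plateau l.2 u.2 n).
have ta n := line_test_sub jl0 uj0 (plateau_test l.1.1 u.1.1 n).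
have tb n := line_test_sub jl1 uj1 (plateau_test l.1.2 u.1.2 n).
have tc n := line_test_sub jl2 uj2 (plateau_test l.2 u.2 n).
have pl (s t : R) n x : `|plateau s t n x| <= 1 by rewrite ger0_norm ?plateau_le1 ?plateau_ge0.
have da n : dominated_on (box l u) (1 * 1 * 1) (a n).
  rewrite /a; exact: (@tensor_dominated R l u _ _ _ _ _ _ (plateau_test _ _ n) (plateau_test _ _ n) (plateau_test _ _ n)
    (pl _ _ n) (pl _ _ n) (pl _ _ n)).
have igB : mu.-integrable setT (EFin \o (g \_ (box l u))).
  apply: integrable_patch; first exact: measurable_box.
  exact: ig (@compact_box _ l u).
have igN : mu.-integrable setT (EFin \o (fun x => `|(g \_ (box l u)) x|)).
  exact: (@integrable_norm _ _ _ mu _ _ igB).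
have mI : measurable_fun setT (fun x => g x * (\1_(obox l u) x : R)).
  by apply: measurable_funM => //; apply: measurable_indic; exact: measurable_obox.
have [_ cv] : mu.-integrable setT (EFin \o (fun x => g x * (\1_(obox l u) x : R))) /\
  \int[mu]_x (g x * a n x) @[n --> \oo] --> \int[mu]_x (g x * (\1_(obox l u) x : R)).
  apply: (@Rdominated_cvg _ _ _ mu setT (fun n x => g x * a n x) _ (fun x => `|(g \_ (box l u)) x|)) => //.
  - by move=> n; apply: measurable_funM => //; case: (da n).
  - apply: aeW => x _; apply: cvgM; first exact: cvg_cst.
    rewrite -tensor_indic; apply: cvgM; last exact: plateau_cvg.
    by apply: cvgM; exact: plateau_cvg.
  - apply: aeW => x n _; have [_ aK a0] := da n; rewrite patchE normrM.
    case: ifPn => [_|].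
      by rewrite ler_piMr//; have := aK x; rewrite !mulr1.
    by rewrite notin_setE => /a0 ->; rewrite normr0 mulr0.
have -> : \int[mu]_(x in obox l u) g x = \int[mu]_x (g x * (\1_(obox l u) x : R)).
  rewrite Rintegral_mkcond; apply: eq_Rintegral => x _.
  by rewrite patchE indicE; case: ifP => _; rewrite ?mulr1 ?mulr0.
apply: cvg_norm_le cv _ => n.
apply: le_trans (sobolev_constantP p1 e0 sg (ta n) (tb n) (tc n)) _.
rewrite ler_wpM2l ?mulr_ge0 ?sobolev_constant_ge0//.
have N0 (s t : R) : 0 <= \int[leb]_y `|plateau s t n y| by apply: Rintegral_ge0.
by rewrite !ler_pM ?mulr_ge0 ?plateau_N1.
Qed.

(** Truncated at 0 so that bounds can be indexed by all pairs of rationals, including those of empty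
    intervals. *)
Definition len (s t : rat) : R := Num.max 0 (ratr t - ratr s).

Lemma len_ge0 s t : 0 <= len s t.
Proof. by rewrite /len le_max lexx. Qed.

(** Restricting [g] to a unit cube lifts the limit on the size of the box: a box meets the cube in a
    box with sides no longer, to which [box_average] applies unless it is empty. *)
Lemma sobolev_box_restrict (p e : R) g (q : E) (s t : rat * rat * rat)
  (Q := obox q ((q.1.1 + 1, q.1.2 + 1), q.2 + 1))
  (l : E := ((ratr s.1.1, ratr s.1.2), ratr s.2))
  (u : E := ((ratr t.1.1, ratr t.1.2), ratr t.2)) :
  1 < p -> 0 <= e -> sobolev_le p e g ->
  `|\int[mu]_(x in obox l u) (g \_ Q) x| <=
    sobolev_constant * e * (len s.1.1 t.1.1 * len s.1.2 t.1.2 * len s.2 t.2).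
Proof.
move=> p1 e0 sg.
have C0 : 0 <= sobolev_constant * e by rewrite mulr_ge0// sobolev_constant_ge0.
have L0 : 0 <= sobolev_constant * e * (len s.1.1 t.1.1 * len s.1.2 t.1.2 * len s.2 t.2).
  by rewrite !mulr_ge0 ?len_ge0 ?sobolev_constant_ge0.
pose l' : E := ((Num.max l.1.1 q.1.1, Num.max l.1.2 q.1.2), Num.max l.2 q.2).
pose u' : E := ((Num.min u.1.1 (q.1.1 + 1), Num.min u.1.2 (q.1.2 + 1)), Num.min u.2 (q.2 + 1)).
have lenP (a b c : R) : Num.min b (c + 1) - Num.max a c <= Num.max 0 (b - a).
  rewrite le_max lerB ?orbT// ?ge_min ?lexx// le_max lexx//.
have itvI (a b c x : R) : (x \in `]a, b[) && (x \in `]c, c + 1[) =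
    (x \in `]Num.max a c, Num.min b (c + 1)[).
  by rewrite !in_itv/= gt_max lt_min; case: (a < x); case: (x < b); case: (c < x); case: (x < c + 1).
have -> : \int[mu]_(x in obox l u) (g \_ Q) x = \int[mu]_(x in obox l' u') g x.
  rewrite -Rintegral_mkcondr; congr (Rintegral _ _ _).
  apply/seteqP; split=> x.
    by move=> [[[a0 a1] a2] [[b0 b1] b2]]; split; [split|]; rewrite /= -itvI; apply/andP.
  move=> [[/=]]; rewrite -!itvI => /andP[a0 b0] /andP[a1 b1] /andP[a2 b2].
  by split; split=> //; split.
have empty (H : obox l' u' = set0) : `|\int[mu]_(x in obox l' u') g x| <=
    sobolev_constant * e * (len s.1.1 t.1.1 * len s.1.2 t.1.2 * len s.2 t.2).
  by rewrite H Rintegral_set0 normr0.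
have itv0 (a b : R) : b < a -> `]a, b[%classic = set0 :> set R.
  by move=> ba; rewrite set_itv_ge// bnd_simp -leNgt ltW.
have [h0|h0] := leP l'.1.1 u'.1.1; last first.
  by apply: empty; rewrite /obox (itv0 _ _ h0) !set0X.
have [h1|h1] := leP l'.1.2 u'.1.2; last first.
  by apply: empty; rewrite /obox (itv0 _ _ h1) setX0 set0X.
have [h2|h2] := leP l'.2 u'.2; last first.
  by apply: empty; rewrite /obox (itv0 _ _ h2) setX0.
apply: le_trans (box_average p1 e0 sg (j := q) _ h0 _ _ h1 _ _ h2 _) _.
- by rewrite /= le_max lexx orbT.
- by rewrite /= ge_min lexx orbT.
- by rewrite /= le_max lexx orbT.
- by rewrite /= ge_min lexx orbT.
- by rewrite /= le_max lexx orbT.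
- by rewrite /= ge_min lexx orbT.
by rewrite ler_wpM2l// !ler_pM ?mulr_ge0 ?subr_ge0// lenP.
Qed.

Lemma len_lt (s t : rat) : ratr s < ratr t :> R -> len s t = ratr t - ratr s.
Proof. by move=> st; rewrite /len max_r// subr_ge0 ltW. Qed.

(** [slice_bound] removes the last coordinate, then the middle one, and differentiation on the line
    handles the first. The boxes in the remaining coordinates have rational corners, which gives the
    countable index. *)
Lemma sobolev_cube_sup (p e : R) g (q : E) : 1 < p -> 0 <= e -> sobolev_le p e g ->
  let Q := obox q ((q.1.1 + 1, q.1.2 + 1), q.2 + 1) in
  {ae mu, forall x, `|(g \_ Q) x| <= sobolev_constant * e}.
Proof.
move=> p1 e0 sg Q; set h := g \_ Q; set C := sobolev_constant * e.
have [[mg ig] _ _] := sg.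
have ih : mu.-integrable setT (EFin \o h).
  apply: integrable_patch; first exact: measurable_obox.
  apply: (@integrableS _ _ _ mu (box q ((q.1.1 + 1, q.1.2 + 1), q.2 + 1))).
  - exact: measurable_box.
  - exact: measurable_obox.
  - by move=> x [[x0 x1] x2]; split; apply: subset_itv_oo_cc.
  - exact: ig (@compact_box _ _ _).
pose leb1 := leb_sf R; pose leb2 := prod_leb leb1.
have mh : measurable_fun setT h by apply/measurable_EFinP; exact: measurable_int ih.
apply: (@ae_prod_leb _ _ R leb2 h C mh).
have s1 := @slice_bound _ _ R leb2 (rat * rat * (rat * rat))%type
  (fun i => `]ratr i.1.1, ratr i.2.1[ `*` `]ratr i.1.2, ratr i.2.2[)
  (fun i => C * (len i.1.1 i.2.1 * len i.1.2 i.2.2)) h.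
apply: ae_imp (s1 _ ih _).
- move=> z [iz bz].
  have mz : measurable_fun setT (fun x => h (x, z)).
    by apply/measurable_EFinP; exact: measurable_int iz.
  apply: (@ae_prod_leb _ _ R leb1 (fun x => h (x, z)) C mz).
  have s2 := @slice_bound _ _ R leb1 (rat * rat)%type
    (fun i => `]ratr i.1, ratr i.2[%classic) (fun i => C * len i.1 i.2) (fun x => h (x, z)).
  apply: ae_imp (s2 _ iz _).
  + move=> y [iy b_y]; apply: ae_norm_le_of_itv => // s t st.
    by have := b_y (s, t); rewrite /= len_lt.
  + by move=> i; exact: measurable_itv.
  + move=> i s t st; have := bz ((i.1, s), (i.2, t)).
    by rewrite /= [len s t]len_lt// mulrA.
- by move=> i; apply: measurableX; exact: measurable_itv.
- move=> i s t st; have := sobolev_box_restrict q (i.1, s) (i.2, t) p1 e0 sg.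
  by rewrite /= [len s t]len_lt// mulrA.
Qed.

Lemma sobolev_sup (p e : R) g : 1 < p -> 0 <= e -> sobolev_le p e g ->
  {ae mu, forall x, `|g x| <= sobolev_constant * e}.
Proof.
move=> p1 e0 sg.
have H : {ae mu, forall x, forall i : rat * rat * rat,
    `|(g \_ (obox (ratr i.1.1, ratr i.1.2, ratr i.2)
      (ratr i.1.1 + 1, ratr i.1.2 + 1, ratr i.2 + 1))) x| <= sobolev_constant * e}.
  apply: (ae_forall_countable (mu := mu)) => i.
  exact: (sobolev_cube_sup ((ratr i.1.1, ratr i.1.2), ratr i.2) p1 e0 sg).
apply: ae_imp H => -[[x y] z] Hx.
(* Open unit cubes with rational corners are countably many and cover the space; r is taken in (w -
   1, w). *)
have near_rat (w : R) : exists r : rat, w \in `]ratr r, ratr r + 1[.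
  have [] := rat_in_itvoo (x := w - 1) (y := w); first by rewrite ltrBlDr ltrDl.
  move=> r; rewrite in_itv/= => /andP[r1 r2]; exists r.
  by rewrite in_itv/= r2 -ltrBlDr.
have [r0 x0] := near_rat x; have [r1 y0] := near_rat y; have [r2 z0] := near_rat z.
have := Hx ((r0, r1), r2); rewrite patchE mem_set; first exact.
by split=> //; split.
Qed.

End SobolevSup.

Section Norms.
Variable R : realType.
Notation mu := (@mu3 R).
Notation E := (R * R * R)%type.
Implicit Types (f g : E -> R).

Lemma Lp_ge0 p g : (0 <= Lp p g)%E.
Proof. by rewrite /Lp; case: asboolP => _; [exact: Lnorm_ge0|rewrite leey]. Qed.

Lemma inf_Lp_ge0 s r g : (0 <= ereal_inf [set Lp r h | h in [set h | is_weak_deriv s g h]])%E.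
Proof. by apply: le_ereal_inf_tmp => _ [h _ <-]; exact: Lp_ge0. Qed.

Lemma Dn_ge0 k r g : (0 <= Dn k r g)%E.
Proof. by apply: sume_ge0 => s _; exact: inf_Lp_ge0. Qed.

Lemma Dn_lt k r g e s : (Dn k r g < e)%E -> size s = k ->
  exists2 gs, is_weak_deriv s g gs & (Lp r gs < e)%E.
Proof.
move=> ge sk; have sk' : size s == k by apply/eqP.
have : (ereal_inf [set Lp r h | h in [set h | is_weak_deriv (Tuple sk') g h]] < e)%E.
  apply: le_lt_trans ge; rewrite /Dn (bigD1 (Tuple sk'))//=.
  by rewrite leeDl// sume_ge0// => t _; exact: inf_Lp_ge0.
by move=> /ereal_inf_lt[_ [h wh <-] he]; exists h.
Qed.

Lemma D1star_sobolev (e : R) g : (D1star g < e%:E)%E -> (Dn 3 2%:E g < e%:E)%E ->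
  sobolev_le 6 e g.
Proof.
move=> g1 g3.
have L6 : (Lp 6%:E g < e%:E)%E by apply: le_lt_trans g1; rewrite leeDl// Dn_ge0.
have D1 : (Dn 1 2%:E g < e%:E)%E by apply: le_lt_trans g1; rewrite leeDr// Lp_ge0.
(* Local integrability of [g] is part of the existence of a first-order weak derivative; any
   direction does. *)
have [h [lg _ _] _] := Dn_lt (s := [:: 0]) D1 erefl.
split=> //.
  exists g; last exact: ltW.
  by split=> // phi _; rewrite expr0 mul1r.
move=> s /orP[] /eqP.
- by move=> /(Dn_lt D1)[gs wgs gse]; exists gs => //; exact: ltW.
- by move=> /(Dn_lt g3)[gs wgs gse]; exists gs => //; exact: ltW.
Qed.

Lemma Hn_Dn k n g : (k <= n)%N -> (Dn k 2%:E g <= Hn n g)%E.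
Proof.
rewrite -ltnS => kn; rewrite /Hn (bigD1 (Ordinal kn))//=.
by rewrite leeDl// sume_ge0// => t _; exact: Dn_ge0.
Qed.

Lemma Hn_sobolev (e : R) g : (Hn 3 g < e%:E)%E -> sobolev_le 2 e g.
Proof.
move=> gH.
have D k : (k <= 3)%N -> (Dn k 2%:E g < e%:E)%E.
  by move=> k3; apply: le_lt_trans gH; exact: Hn_Dn.
have [g0 w0 L0] := Dn_lt (s := [::]) (D 0 isT) erefl.
have [lg _ _] := w0.
split=> //; first by exists g0 => //; exact: ltW.
move=> s /orP[] /eqP.
- by move=> /(Dn_lt (D 1%N isT))[gs wgs gse]; exists gs => //; exact: ltW.
- by move=> /(Dn_lt (D 3%N isT))[gs wgs gse]; exists gs => //; exact: ltW.
Qed.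

End Norms.

(** * Curves that are continuous for the sup norm *)

Section Curves.
Variable R : realType.
Notation mu := (@mu3 R).
Notation E := (R * R * R)%type.
Implicit Types (f g : E -> R) (F G : R -> E -> R) (T : R).

(** Used to choose small parameters: dividing by c + 1 instead of c covers c = 0. *)
Lemma ler_frac_succ (c e : R) : 0 <= c -> 0 < e -> c * (e / (c + 1)) <= e.
Proof.
move=> c0 e0; rewrite mulrCA ler_piMr ?(ltW e0)// ler_pdivrMr ?ltr_pwDr//.
by rewrite mul1r lerDl.
Qed.

Definition ae_le g (C : R) := {ae mu, forall x, `|g x| <= C}.

Lemma ae_le_trans g (C D : R) : ae_le g C -> C <= D -> ae_le g D.
Proof. by move=> gC CD; apply: ae_imp gC => x; move/le_trans; apply. Qed.

(** Compactness of the segment, for statements monotone in the constant. It applies to bounds valid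
    for almost every x without introducing a norm as a function of t. *)
Lemma segment_locally_bounded (a b : R) (P : R -> R -> Prop) :
  (forall t C D, P t C -> C <= D -> P t D) ->
  (forall t0, t0 \in `[a, b] -> exists d C : R, 0 < d /\
     forall t, t \in `[a, b] -> `|t - t0| < d -> P t C) ->
  exists C, forall t, t \in `[a, b] -> P t C.
Proof.
move=> Pm loc.
have /compact_near_coveringP/(_ _ (pinfty_nbhs R) (fun C t => t \in `[a, b] -> P t C) _) :=
  @segment_compact R a b.
have near_loc : forall x : R, `[a, b]%classic x ->
    \forall x' \near x & i \near +oo, x' \in `[a, b] -> P x' i.
  move=> t0 t0ab; have [d [C [d0 dC]]] := loc _ t0ab.
  exists ([set t | `|t - t0| < d], [set D | C <= D]) => /=.
    split; last by apply: nbhs_pinfty_ge; exact: num_real.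
    by exists d => //= t; rewrite /ball_/= distrC.
  by move=> [t D] /= [td CD] tab; apply: Pm CD; exact: dC.
move=> /(_ near_loc).
case=> [C [_ H]]; exists (C + 1) => t tab; apply: (H (C + 1)) => //.
by rewrite ltrDl.
Qed.

(** Written with bounds for almost every x so that products and powers can be treated pointwise. The
    time t0 may be an endpoint: continuity at 0 connects the solution with its data. *)
Definition sup_continuous T F :=
  [/\ forall t, t \in `[0, T] -> measurable_fun setT (F t),
      forall t, t \in `[0, T] -> exists C, ae_le (F t) C &
      forall t0 e, t0 \in `[0, T] -> 0 < e -> exists2 d, 0 < d &
        forall t, t \in `[0, T] -> `|t - t0| < d -> ae_le (F t \- F t0) e].

Lemma sup_continuous_bounded T F : sup_continuous T F ->
  exists2 B, 0 <= B & forall t, t \in `[0, T] -> ae_le (F t) B.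
Proof.
move=> [_ Fb Fc].
have [|C HC] := @segment_locally_bounded 0 T (fun t C => ae_le (F t) C)
  (fun t C D => @ae_le_trans (F t) C D); last first.
  exists (Num.max 0 C); first by rewrite le_max lexx.
  by move=> t /HC/ae_le_trans; apply; rewrite le_max lexx orbT.
move=> t0 t0T; have [C FC] := Fb _ t0T.
have [d d0 dF] := Fc _ 1 t0T ltr01.
exists d, (C + 1); split=> // t tT td.
apply: ae_imp2 FC (dF _ tT td) => x h1 h2.
rewrite -[F t x](subrK (F t0 x)) addrC (le_trans (ler_normD _ _))//.
by rewrite lerD.
Qed.

Lemma Ct_near T (N : (E -> R) -> \bar R) F t0 (e : R) : Ct T N F -> t0 \in `[0, T] ->
  0 < e -> exists2 d, 0 < d &
    forall t, t \in `[0, T] -> `|t - t0| < d -> (N (F t \- F t0)%R < e%:E)%E.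
Proof.
move=> CF t0T e0; have [_ cv] := CF _ t0T.
have : \forall t \near within `[0, T]%classic (nbhs t0), (N (F t \- F t0)%R < e%:E)%E.
  have H : nbhs (0%E : \bar R) [set y | (y < e%:E)%E].
    apply: open_nbhs_nbhs; split; first exact: open_ereal_lt_ereal.
    by rewrite /= lte_fin.
  exact: cv _ H.
rewrite near_withinE => -[d /= d0 H]; exists d => // t tT td.
by apply: H => //; rewrite /ball_/= distrC.
Qed.

Lemma sup_continuous_sobolev T F (p : R) : 1 < p ->
  (forall t, t \in `[0, T] -> exists2 e, 0 <= e & sobolev_le p e (F t)) ->
  (forall t0 e, t0 \in `[0, T] -> 0 < e -> exists2 d, 0 < d &
     forall t, t \in `[0, T] -> `|t - t0| < d -> sobolev_le p e (F t \- F t0)) ->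
  sup_continuous T F.
Proof.
move=> p1 Fb Fc; split=> [t tT|t tT|t0 e t0T e0].
- by have [e _ [[mF _] _ _]] := Fb _ tT.
- have [e e0 Fe] := Fb _ tT.
  by exists (sobolev_constant R * e); exact: sobolev_sup Fe.
have C0 : 0 < sobolev_constant R + 1 by rewrite ltr_pwDr// sobolev_constant_ge0.
have e'0 : 0 < e / (sobolev_constant R + 1) by rewrite divr_gt0.
have [d d0 dF] := Fc _ _ t0T e'0.
exists d => // t tT td; apply: ae_le_trans (sobolev_sup p1 (ltW e'0) (dF t tT td)) _.
by rewrite ler_frac_succ// sobolev_constant_ge0.
Qed.

Lemma in_space_lt (N : (E -> R) -> \bar R) f : in_space N f -> (0 <= N f)%E ->
  exists2 e : R, 0 <= e & (N f < e%:E)%E.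
Proof.
rewrite /in_space; case: (N f) => [r _ r0|//|_ //].
by exists (r + 1); rewrite ?lte_fin ?ltrDl// addr_ge0.
Qed.

Lemma D1star_ge0 f : (0 <= D1star f)%E.
Proof. by rewrite adde_ge0 ?Lp_ge0 ?Dn_ge0. Qed.

Lemma Hn_ge0 n f : (0 <= Hn n f)%E.
Proof. by apply: sume_ge0 => i _; exact: Dn_ge0. Qed.

Lemma D1star_sup_continuous T F : Ct T (@D1star R) F -> Ct T (Dn 3 2%:E) F ->
  sup_continuous T F.
Proof.
move=> C1 C3; apply: (@sup_continuous_sobolev T F 6); first by rewrite ltr1n.
- move=> t tT; have [e e0 Fe] := in_space_lt (proj1 (C1 _ tT)) (D1star_ge0 _).
  have [e' e'0 Fe'] := in_space_lt (proj1 (C3 _ tT)) (Dn_ge0 _ _ _).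
  exists (e + e'); first by rewrite addr_ge0.
  apply: D1star_sobolev; [apply: lt_le_trans Fe _|apply: lt_le_trans Fe' _].
    by rewrite lee_fin lerDl.
  by rewrite lee_fin lerDr.
- move=> t0 e t0T e0; have [d d0 dF] := Ct_near C1 t0T e0.
  have [d' d'0 d'F] := Ct_near C3 t0T e0.
  exists (Num.min d d'); first by rewrite lt_min d0.
  by move=> t tT; rewrite lt_min => /andP[td td']; apply: D1star_sobolev; [exact: dF|exact: d'F].
Qed.

Lemma Hn_sup_continuous T F : Ct T (Hn 3) F -> sup_continuous T F.
Proof.
move=> C3; apply: (@sup_continuous_sobolev T F 2); first by rewrite ltr1n.
- move=> t tT; have [e e0 Fe] := in_space_lt (proj1 (C3 _ tT)) (Hn_ge0 _ _).
  by exists e => //; exact: Hn_sobolev.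
- move=> t0 e t0T e0; have [d d0 dF] := Ct_near C3 t0T e0.
  by exists d => // t tT td; apply: Hn_sobolev; exact: dF.
Qed.

Lemma sup_continuous_mul T F G : sup_continuous T F -> sup_continuous T G ->
  sup_continuous T (fun t x => F t x * G t x).
Proof.
move=> cF cG; have [A A0 FA] := sup_continuous_bounded cF.
have [B B0 GB] := sup_continuous_bounded cG.
have [mF _ Fc] := cF; have [mG _ Gc] := cG.
split=> [t tT|t tT|t0 e t0T e0].
- by apply: measurable_funM; [exact: mF|exact: mG].
- exists (A * B); apply: ae_imp2 (FA _ tT) (GB _ tT) => x h1 h2.
  by rewrite normrM ler_pM.
have D0 : 0 < A + B + 1 by rewrite ltr_pwDr// addr_ge0.
have e'0 : 0 < e / (A + B + 1) by rewrite divr_gt0.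
have [d d0 dF] := Fc _ _ t0T e'0; have [d' d'0 dG] := Gc _ _ t0T e'0.
exists (Num.min d d'); first by rewrite lt_min d0.
move=> t tT; rewrite lt_min => /andP[td td'].
have h1 := ae_imp2 (fun x a b => conj a b) (FA _ tT) (dG _ tT td').
have h2 := ae_imp2 (fun x a b => conj a b) (GB _ t0T) (dF _ tT td).
apply: ae_imp2 h1 h2 => x /= [h1 h2] [h3 h4].
have -> : F t x * G t x - F t0 x * G t0 x =
    F t x * (G t x - G t0 x) + G t0 x * (F t x - F t0 x) by ring.
apply: le_trans (ler_normD _ _) _; rewrite !normrM.
apply: le_trans (lerD (ler_pM _ _ h1 h2) (ler_pM _ _ h3 h4)) _ => //.
by rewrite -mulrDl ler_frac_succ// addr_ge0.
Qed.

(** Mean value theorem: for k >= 1 the derivative k x^(k-1) stays bounded as x tends to 0, where the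
    density may come arbitrarily close. *)
Lemma powR_lipschitz (k B a b : R) : 1 <= k -> 0 < a <= B -> 0 < b <= B ->
  `|a `^ k - b `^ k| <= k * B `^ (k - 1) * `|a - b|.
Proof.
move=> k1; wlog ab : a b / a <= b.
  move=> H ha hb; have [ab|ba] := leP a b; first exact: H.
  by rewrite distrC [X in _ * X]distrC; apply: H => //; exact: ltW.
move=> /andP[a0 aB] /andP[b0 bB].
have [->|anb] := eqVneq a b; first by rewrite !subrr normr0 mulr0.
have altb : a < b by rewrite lt_neqAle anb.
have der (x : R) : 0 < x -> is_derive x 1 (@powR R ^~ k) (k * x `^ (k - 1)).
  by move=> x0; apply: is_derive_eq (is_derive1_powR k x0) _.
have [||c /[!in_itv]/= /andP[ac cb] E] := @MVT R (@powR R ^~ k) (fun x => k * x `^ (k - 1)) a b altb.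
- by move=> x /[!in_itv]/= /andP[ax _]; apply: der; exact: lt_trans ax.
- apply: derivable_within_continuous => x /[!in_itv]/= /andP[ax _].
  by have [] := der x (lt_le_trans a0 ax).
rewrite distrC E distrC normrM ler_wpM2r// ger0_norm; last first.
  by rewrite mulr_ge0 ?powR_ge0// (le_trans ler01).
rewrite ler_wpM2l// ?(le_trans ler01)// ge0_ler_powR ?nnegrE ?subr_ge0//.
- by rewrite ltW// (lt_trans a0).
- by rewrite ltW// (lt_le_trans b0).
- by rewrite ltW// (lt_le_trans cb).
Qed.

Lemma sup_continuous_powR T F (k : R) : 1 <= k -> (forall t x, t \in `[0, T] -> 0 < F t x) ->
  sup_continuous T F -> sup_continuous T (fun t x => F t x `^ k).
Proof.
move=> k1 F0 cF; have [B B0 FB] := sup_continuous_bounded cF.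
have [mF _ Fc] := cF; have k0 : 0 <= k by exact: le_trans k1.
split=> [t tT|t tT|t0 e t0T e0].
- exact: (measurableT_comp (measurable_powR k) (mF _ tT)).
- exists (B `^ k); apply: ae_imp (FB _ tT) => x h1.
  have Fx := F0 t x tT; rewrite ger0_norm ?powR_ge0// ge0_ler_powR ?nnegrE//.
    exact: ltW.
  by rewrite (le_trans (ler_norm _)).
have D0 : 0 < k * B `^ (k - 1) + 1 by rewrite ltr_pwDr// mulr_ge0// powR_ge0.
have e'0 : 0 < e / (k * B `^ (k - 1) + 1) by rewrite divr_gt0.
have [d d0 dF] := Fc _ _ t0T e'0.
exists d => // t tT td.
have h1 := ae_imp2 (fun x a b => conj a b) (FB _ tT) (FB _ t0T).
apply: ae_imp2 h1 (dF _ tT td) => x /= [h1 h2] h3.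
apply: le_trans (@powR_lipschitz k B _ _ k1 _ _) _.
- by rewrite F0//= (le_trans (ler_norm _)).
- by rewrite F0//= (le_trans (ler_norm _)).
apply: le_trans (ler_wpM2l _ h3) _; first by rewrite mulr_ge0// powR_ge0.
by rewrite ler_frac_succ// mulr_ge0// powR_ge0.
Qed.

End Curves.

(** * Integrals under almost everywhere bounds *)

Section AePairing.
Context d (T : measurableType d) (R : realType) (mu : {measure set T -> \bar R}).

(** If g is not integrable and c is nonzero, both integrals have the default value 0. This lets time
    factors be pulled out at every t, although the balance laws grant local integrability only for
    almost every t. *)
Lemma Rintegral_scale (D : set T) (c : R) (g : T -> R) : measurable D -> measurable_fun D g ->
  \int[mu]_(x in D) (c * g x) = c * \int[mu]_(x in D) g x.
Proof.
move=> mD mg; have [ig|nig] := boolP (mu.-integrable D (EFin \o g)).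
  by rewrite RintegralZl.
have [->|c0] := eqVneq c 0.
  rewrite mul0r /Rintegral; under eq_integral do rewrite mul0r.
  by rewrite integral0.
have aux (f : T -> R) : measurable_fun D f -> ~~ mu.-integrable D (EFin \o f) ->
    \int[mu]_(x in D) f x = 0.
  move=> mf nif; rewrite /Rintegral.
  have : ~~ ((\int[mu]_(x in D) (f x)%:E)%E \is a fin_num).
    apply: contra nif => fin; apply/integrableP; split; first exact/measurable_EFinP.
    by rewrite (integral_fin_num_abs mu mD mf).
  by case: (\int[mu]_(x in D) _)%E.
rewrite aux ?aux ?mulr0//; first exact: measurable_funM.
apply: contra nig => /(integrable_scaler mD c^-1); congr (_.-integrable _ _).
by apply/funext => x /=; rewrite mulKf.
Qed.

Variables (B : set T) (mB : measurable B).

Lemma integrable_le_ae (f g : T -> R) : measurable_fun setT f -> mu.-integrable setT (EFin \o g) ->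
  {ae mu, forall x, `|f x| <= g x} -> mu.-integrable setT (EFin \o f).
Proof.
move=> mf ig fg; apply/integrableP; split; first exact/measurable_EFinP.
have /integrableP[mg] := ig; apply: le_lt_trans.
apply: ae_ge0_le_integral => //.
- by apply: measurableT_comp => //; exact/measurable_EFinP.
- by apply: measurableT_comp.
by apply: ae_imp fg => x h _ /=; rewrite lee_fin (le_trans h)// ler_norm.
Qed.

Lemma Rintegral_le_ae (f g : T -> R) : measurable_fun setT f -> mu.-integrable setT (EFin \o g) ->
  {ae mu, forall x, `|f x| <= g x} -> `|\int[mu]_x f x| <= \int[mu]_x g x.
Proof.
move=> mf ig fg; have iF := integrable_le_ae mf ig fg.
apply: le_trans (le_normr_Rintegral _ _) _ => //.
have inf : mu.-integrable setT (EFin \o (fun x => `|f x|)) by exact: (@integrable_norm _ _ _ mu).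
rewrite /Rintegral fine_le//.
- exact: (integrable_fin_num measurableT inf).
- exact: (integrable_fin_num measurableT ig).
apply: le_trans (_ : _ <= \int[mu]_x `|g x|%:E)%E _.
  apply: ae_ge0_le_integral => //.
  - by apply/measurable_EFinP; exact: measurableT_comp.
  - apply/measurable_EFinP; apply: measurableT_comp => //.
    by apply/measurable_EFinP; exact: measurable_int ig.
  by apply: ae_imp fg => x h _; rewrite lee_fin (le_trans h)// ler_norm.
have mg : measurable_fun setT g by apply/measurable_EFinP; exact: measurable_int ig.
rewrite (@ae_eq_integral _ _ _ mu setT (EFin \o g) (fun x => `|g x|%:E))//.
- by apply/measurable_EFinP; exact: measurableT_comp.
- by apply/measurable_EFinP.
by apply: ae_imp fg => x h _ /=; rewrite ger0_norm// (le_trans _ h).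
Qed.

Lemma dominated_Rintegral_bound (K C : R) (g phi : T -> R) : (mu B < +oo)%E -> 0 <= C ->
  measurable_fun setT g -> {ae mu, forall x, `|g x| <= C} -> dominated_on B K phi ->
  mu.-integrable setT (EFin \o (fun x => g x * phi x)) /\
  `|\int[mu]_x (g x * phi x)| <= C * K * fine (mu B).
Proof.
move=> Bf C0 mg gC [mphi phiK phi0].
have icst : mu.-integrable setT (EFin \o (cst (C * K) \_ B)).
  apply: integrable_patch => //; apply/integrableP; split; first exact/measurable_EFinP.
  rewrite [X in (X < _)%E](_ : _ = (\int[mu]_(x in B) cst (`|C * K|%:E) x)%E)//.
  by rewrite integral_cst//=; apply: lte_mul_pinfty.
have ale : {ae mu, forall x, `|g x * phi x| <= (cst (C * K) \_ B) x}.
  apply: ae_imp gC => x h; rewrite patchE; case: ifPn => [_|].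
    by rewrite normrM ler_pM.
  by rewrite notin_setE => /phi0 ->; rewrite mulr0 normr0.
have mgp : measurable_fun setT (fun x => g x * phi x) by exact: measurable_funM.
split; first exact: integrable_le_ae ale.
apply: le_trans (Rintegral_le_ae mgp icst ale) _.
by rewrite -Rintegral_mkcond Rintegral_cst.
Qed.

End AePairing.

(** * From weak time derivatives to increments *)

Section TimeIncrement.
Variable R : realType.
Notation leb := (@lebesgue_measure R).
Implicit Types (h eta : R -> R) (T : R).

Definition segment_continuous T h := forall t0 e, t0 \in `[0, T] -> 0 < e ->
  exists2 d, 0 < d & forall t, t \in `[0, T] -> `|t - t0| < d -> `|h t - h t0| <= e.

Lemma segment_continuous_within T h : segment_continuous T h ->
  {within `[0, T], continuous h}.
Proof.
move=> ch; apply/subspace_continuousP => t0 t0T.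
apply/cvgrPdist_le => e e0; have [d d0 hd] := ch t0 e t0T e0.
rewrite near_withinE; exists d => //= t; rewrite /ball_/= => td tT.
by rewrite distrC hd// distrC.
Qed.

Lemma segment_continuous_integrable T h : segment_continuous T h ->
  leb.-integrable `[0, T] (EFin \o h).
Proof.
move=> ch; apply: continuous_compact_integrable; first exact: segment_compact.
exact: segment_continuous_within.
Qed.

(** A unit mass on [d, d + 1/c], lying to the right of d only, so that times near 0 are approached
    from inside (0, T). *)
Definition mollifier (c d x : R) : R := c * theta (c * x + - (c * d)).

Lemma mollifier_test (c d : R) : 0 < c -> line_test d (d + c^-1) (mollifier c d).
Proof. by move=> c0; apply: line_test_scale; exact: theta_scale_test. Qed.

Lemma mollifier_ge0 (c d x : R) : 0 < c -> 0 <= mollifier c d x.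
Proof. by move=> c0; rewrite mulr_ge0 ?theta_ge0// ltW. Qed.

Lemma mollifier_average T h (c d e v : R) : 0 < c -> 0 <= d -> d + c^-1 <= T ->
  leb.-integrable `[0, T] (EFin \o h) ->
  (forall t, t \in `[d, d + c^-1] -> `|h t - v| <= e) ->
  leb.-integrable `[0, T] (EFin \o (fun t => mollifier c d t * h t)) /\
  `|\int[leb]_(t in `[0, T]) (mollifier c d t * h t) - v| <= e.
Proof.
move=> c0 d0 dT ih hv.
have tb := line_test_sub d0 dT (mollifier_test d c0).
have [Kb _ bK] := line_test_bounded tb.
have mb : measurable_fun setT (mollifier c d).
  by apply: continuous_measurable_fun; apply: smooth_continuous; case: tb.
have ibh : leb.-integrable `[0, T] (EFin \o (fun t => mollifier c d t * h t)).
  apply: (@integrable_le _ _ _ leb _ _ _ (fun t => Kb * `|h t|)) => //.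
  - apply: measurable_funM; first by apply: (@measurable_funS _ _ _ _ setT).
    by apply/measurable_EFinP; exact: measurable_int ih.
  - by apply: integrable_scaler => //; apply: (@integrable_norm _ _ _ leb).
  - by move=> t _; rewrite normrM ler_wpM2r.
split=> //.
have I1 : \int[leb]_(t in `[0, T]) mollifier c d t = 1.
  by rewrite -(line_test_Rintegral tb) theta_scale_Rintegral.
have ib : leb.-integrable `[0, T] (EFin \o mollifier c d) by apply: line_test_integrable tb.
have -> : v = \int[leb]_(t in `[0, T]) (v * mollifier c d t) by rewrite RintegralZl// I1 mulr1.
rewrite -RintegralB//; last by apply: integrable_scaler.
have -> : e = \int[leb]_(t in `[0, T]) (e * mollifier c d t) by rewrite RintegralZl// I1 mulr1.
apply: le_trans (le_normr_Rintegral _ _) _ => //.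
  by apply: integrable_subr => //; apply: integrable_scaler.
apply: le_Rintegral => //.
- apply: (@integrable_norm _ _ _ leb); apply: integrable_subr => //.
  exact: integrable_scaler.
- exact: integrable_scaler.
move=> t _; rewrite mulrC -mulrBl normrM (ger0_norm (mollifier_ge0 _ _ c0)).
have [tcd|tcd] := boolP (t \in `[d, d + c^-1]).
  by rewrite ler_wpM2r ?mollifier_ge0// hv.
by have [_ ->//] := mollifier_test d c0; rewrite !mulr0.
Qed.

(* [eta] is the primitive of a mollified Dirac mass near 0 minus one near t. *)
Lemma increment_bound T h (G : 'I_3 -> R -> R) (c : R) : 0 < T -> 0 <= c ->
  segment_continuous T h -> leb.-integrable `[0, T] (EFin \o h) ->
  (forall j, measurable_fun `[0, T] (G j)) ->
  (forall j t, 0 < t < T -> `|G j t| <= c) ->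
  (forall s e eta, 0 < s -> e < T -> line_test s e eta ->
     \int[leb]_(t in `[0, T]) (derive1 eta t * h t) =
     - \sum_j \int[leb]_(t in `[0, T]) (eta t * G j t)) ->
  forall t, 0 < t < T -> `|h t - h 0| <= 6 * c * T.
Proof.
move=> T0 c0 ch ih mG Gc hG t /andP[t0 tT].
apply/ler_addgt0Pr => e e0.
have e20 : 0 < e / 2 by rewrite divr_gt0.
have tin : t \in `[0, T] by rewrite in_itv/= !ltW.
have zin : 0 \in `[0, T] by rewrite in_itv/= lexx ltW.
have [d1 d10 hd1] := ch _ _ tin e20; have [d2 d20 hd2] := ch _ _ zin e20.
pose m := Num.min (Num.min d1 d2) (Num.min (T - t) t).
have m0 : 0 < m by rewrite !lt_min d10 d20 subr_gt0 tT t0.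
have [md1 md2 mT mt] : [/\ m <= d1, m <= d2, m <= T - t & m <= t].
  by rewrite /m; split; rewrite !ge_min lexx ?orbT.
(* With a third of m, the supports [l, 2 l] and [t, t + l] stay within the continuity radii of 0 and
   t, and both lie in [l, t + l], inside (0, T). *)
pose l := m / 3; have l0 : 0 < l by rewrite divr_gt0.
have ml : m = 3 * l by rewrite /l; field.
pose k := l^-1; have k0 : 0 < k by rewrite invr_gt0.
have kl : k^-1 = l by rewrite /k invrK.
have [ib1 b1] : leb.-integrable `[0, T] (EFin \o (fun t => mollifier k l t * h t)) /\
    `|\int[leb]_(t in `[0, T]) (mollifier k l t * h t) - h 0| <= e / 2.
  apply: mollifier_average => //; rewrite ?kl ?(ltW l0)//; first lra.
  move=> s; rewrite in_itv/= => /andP[s1 s2]; apply: hd2; first by rewrite in_itv/=; lra.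
  by rewrite subr0 ger0_norm; lra.
have [ib2 b2] : leb.-integrable `[0, T] (EFin \o (fun s => mollifier k t s * h s)) /\
    `|\int[leb]_(s in `[0, T]) (mollifier k t s * h s) - h t| <= e / 2.
  apply: mollifier_average => //; rewrite ?kl ?(ltW t0)//; first lra.
  move=> s; rewrite in_itv/= => /andP[s1 s2]; apply: hd1; first by rewrite in_itv/=; lra.
  by rewrite ger0_norm; lra.
have tl : t + l < T by lra.
have tb1 : line_test l (t + l) (mollifier k l).
  by apply: line_test_sub (mollifier_test l k0) => //; rewrite kl; lra.
have tb2 : line_test l (t + l) (mollifier k t).
  by apply: line_test_sub (mollifier_test t k0); rewrite ?kl//; lra.
pose a := mollifier k l \+ (fun s => (-1) * mollifier k t s).
have ta : line_test l (t + l) a by apply: line_test_add => //; exact: line_test_scale.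
have I1 : \int[leb]_x mollifier k l x = 1 by exact: theta_scale_Rintegral.
have I2 : \int[leb]_x mollifier k t x = 1 by exact: theta_scale_Rintegral.
have a0 : \int[leb]_x a x = 0.
  rewrite /a RintegralD//.
  - have -> : \int[leb]_x (-1 * mollifier k t x) = -1 * \int[leb]_x mollifier k t x.
      by apply: RintegralZl => //; apply: line_test_integrable tb2.
    by rewrite I1 I2 mulr1 subrr.
  - exact: line_test_integrable tb1.
  - by apply: line_test_integrable (line_test_scale (-1) tb2).
have tp := prim_test ta a0.
have pa2 s : `|prim a s| <= 2.
  apply: le_trans (prim_norm s ta) _.
  have -> : 2 = \int[leb]_x (mollifier k l x + mollifier k t x).
    rewrite RintegralD ?I1 ?I2//; first exact: line_test_integrable tb1.
    exact: line_test_integrable tb2.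
  apply: le_Rintegral => //.
  - exact: line_test_norm_integrable ta.
  - by apply: line_test_integrable (line_test_add tb1 tb2).
  move=> x _; rewrite /a/= mulN1r (le_trans (ler_normB _ _))//.
  by rewrite !ger0_norm ?mollifier_ge0.
have := hG _ _ _ l0 tl tp; rewrite (derive1_prim ta).
have -> : \int[leb]_(s in `[0, T]) (a s * h s) =
    \int[leb]_(s in `[0, T]) (mollifier k l s * h s) - \int[leb]_(s in `[0, T]) (mollifier k t s * h s).
  rewrite -RintegralB//; apply: eq_Rintegral => s _; rewrite /a/=; ring.
move=> E.
(* The constant 6 is 2, the bound of the primitive, times the three fluxes. *)
have GE : `|\sum_j \int[leb]_(s in `[0, T]) (prim a s * G j s)| <= 6 * c * T.
  apply: le_trans (ler_norm_sum _ _ _) _.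
  have -> : 6 * c * T = \sum_(j < 3) (2 * c * T) by rewrite !big_ord_recr big_ord0/=; ring.
  apply: ler_sum => j _.
  have bd s : `|prim a s * G j s| <= 2 * c.
    have [sin|sout] := boolP (s \in `[l, t + l]); last first.
      by have [_ ->//] := tp; rewrite mul0r normr0 mulr_ge0.
    rewrite normrM ler_pM//; apply: Gc.
    by move: sin; rewrite in_itv/= => /andP[? ?]; apply/andP; split; lra.
  have -> : 2 * c * T = \int[leb]_(s in `[0, T]) cst (2 * c) s.
    by rewrite Rintegral_cst//= lebesgue_measure_itv/= lte_fin T0/= ?oppr0 ?addr0.
  have icst : leb.-integrable `[0, T] (EFin \o cst (2 * c)).
    apply: continuous_compact_integrable; first exact: segment_compact.
    by apply: continuous_subspaceT => x; exact: cst_continuous.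
  have mpG : measurable_fun `[0, T] (fun s => prim a s * G j s).
    apply: measurable_funM; last exact: mG.
    apply: (@measurable_funS _ _ _ _ setT) => //; apply: continuous_measurable_fun.
    by apply: smooth_continuous; case: tp.
  have ipG : leb.-integrable `[0, T] (EFin \o (fun s => prim a s * G j s)).
    by apply: (@integrable_le _ _ _ leb _ _ _ _ mpG icst).
  apply: le_trans (le_normr_Rintegral _ _) _ => //; apply: le_Rintegral => //.
  exact: (@integrable_norm _ _ _ leb).
move: GE; rewrite -normrN -E => GE.
move: GE b1 b2; rewrite !ler_norml => /andP[? ?] /andP[? ?] /andP[? ?].
by apply/andP; split; lra.
Qed.

End TimeIncrement.

(** * Balance laws tested with cutoffs *)

Section BalanceLaws.
Variable R : realType.
Notation leb := (@lebesgue_measure R).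
Notation mu := (@mu3 R).
Notation E := (R * R * R)%type.
Implicit Types (f : R -> E -> R) (T : R) (a b c eta : R -> R).

Definition dtensor (j : 'I_3) a b c : E -> R :=
  tensor (if j == 0 :> nat then derive1 a else a) (if j == 1 :> nat then derive1 b else b)
    (if j == 2 :> nat then derive1 c else c).

Lemma derive_dtensor j a b c : smooth a -> smooth b -> smooth c ->
  'D_(unitv R j) (tensor a b c) = dtensor j a b c.
Proof.
move=> sa sb sc; case: j => [[|[|[|]]]//= ?].
- by rewrite (_ : Ordinal _ = 0) ?derive_tensor0//; exact/val_inj.
- by rewrite (_ : Ordinal _ = 1) ?derive_tensor1//; exact/val_inj.
- by rewrite (_ : Ordinal _ = 2) ?derive_tensor2//; exact/val_inj.
Qed.

Lemma dtensor_test l u j a b c : line_test l.1.1 u.1.1 a -> line_test l.1.2 u.1.2 b ->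
  line_test l.2 u.2 c -> test_function setT (dtensor j a b c).
Proof.
move=> ta tb tc; apply: (@tensor_test R l u).
- by case: ifP => // _; exact: line_test_derive1.
- by case: ifP => // _; exact: line_test_derive1.
- by case: ifP => // _; exact: line_test_derive1.
Qed.

Lemma derive_separated (V W : normedModType R) (f : V -> R) (g : W -> R) v (z : V * W) :
  differentiable f z.1 -> differentiable g z.2 ->
  'D_v (fun z : V * W => f z.1 * g z.2) z =
  g z.2 * 'D_(v.1) f z.1 + f z.1 * 'D_(v.2) g z.2.
Proof.
move=> df dg.
have d1 : differentiable (fst : V * W -> V) z.
  have cf : continuous (fst : V * W -> V) by move=> y; exact: cvg_fst.
  by apply: linear_differentiable; exact: cf.
have d2 : differentiable (snd : V * W -> W) z.
  have cf : continuous (snd : V * W -> W) by move=> y; exact: cvg_snd.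
  by apply: linear_differentiable; exact: cf.
have df1 : differentiable (f \o fst : V * W -> R) z.
  by apply: (@differentiable_comp _ _ _ _ fst f).
have dg2 : differentiable (g \o snd : V * W -> R) z.
  by apply: (@differentiable_comp _ _ _ _ snd g).
have e1 : 'D_v (f \o fst : V * W -> R) z = 'D_(v.1) f z.1.
  have cf : continuous (fst : V * W -> V) by move=> y; exact: cvg_fst.
  by rewrite deriveE// (diff_comp d1 df) /= diff_lin// deriveE.
have e2 : 'D_v (g \o snd : V * W -> R) z = 'D_(v.2) g z.2.
  have cf : continuous (snd : V * W -> W) by move=> y; exact: cvg_snd.
  by rewrite deriveE// (diff_comp d2 dg) /= diff_lin// deriveE.
rewrite -[fun z => _]/((f \o fst) * (g \o snd)).
rewrite deriveM; [|exact: diff_derivable|exact: diff_derivable].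
by rewrite e1 e2 addrC; congr (_ + _).
Qed.

Definition time_tensor eta a b c (z : R * E) : R := eta z.1 * tensor a b c z.2.

Section TimeTensor.
Variables (eta a b c : R -> R).
Hypotheses (se : smooth eta) (sa : smooth a) (sb : smooth b) (sc : smooth c).

Let smooth_e : smooth (fun z : R * E => eta z.1).
Proof. exact: (smooth_comp_affine (affine_fst (@affine_id R)) se). Qed.

Let smooth_t : smooth (fun z : R * E => tensor a b c z.2).
Proof.
apply: (@smooth_mul R _ (fun z : R * E => a z.2.1.1 * b z.2.1.2) (fun z => c z.2.2)).
- apply: (@smooth_mul R _ (fun z : R * E => a z.2.1.1) (fun z => b z.2.1.2)).
  + exact: (smooth_comp_affine (affine_snd (V:=R) (affine_fst (W:=R) (affine_fst (W:=R) (@affine_id R)))) sa).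
  + exact: (smooth_comp_affine (affine_snd (V:=R) (affine_fst (W:=R) (affine_snd (V:=R) (@affine_id R)))) sb).
- exact: (smooth_comp_affine (affine_snd (V:=R) (affine_snd (V:=(R*R)%type) (@affine_id R))) sc).
Qed.

Lemma time_tensor_smooth : smooth (time_tensor eta a b c).
Proof. exact: (smooth_mul smooth_e smooth_t). Qed.

Lemma derive_time_tensor v z : 'D_v (time_tensor eta a b c) z =
  v.1 * derive1 eta z.1 * tensor a b c z.2 + eta z.1 * 'D_(v.2) (tensor a b c) z.2.
Proof.
have de : differentiable eta z.1 by exact: smooth_differentiable.
have dt : differentiable (tensor a b c) z.2.
  by apply: smooth_differentiable; exact: tensor_smooth.
by apply: (etrans (derive_separated v de dt)); rewrite (derive_line _ de) mulrC.
Qed.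

Lemma dt_time_tensor z : dt (time_tensor eta a b c) z = derive1 eta z.1 * tensor a b c z.2.
Proof. by rewrite /dt derive_time_tensor/= derive0 mulr0 addr0 mul1r. Qed.

Lemma dx_time_tensor j z : dx j (time_tensor eta a b c) z = eta z.1 * dtensor j a b c z.2.
Proof. by rewrite /dx derive_time_tensor/= !mul0r add0r -derive_dtensor. Qed.

End TimeTensor.

Lemma time_tensor_test T s e l u eta a b c : 0 < s -> e < T -> line_test s e eta ->
  line_test l.1.1 u.1.1 a -> line_test l.1.2 u.1.2 b -> line_test l.2 u.2 c ->
  test_function [set z : R * E | 0 < z.1 < T] (time_tensor eta a b c).
Proof.
move=> s0 eT [se e0] [sa a0] [sb b0] [sc c0].
apply: (@test_function_of R _ _ (`[s, e] `*` box l u)).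
- exact: time_tensor_smooth.
- by apply: compact_setX; [exact: segment_compact|exact: compact_box].
- move=> [t x] [/= /[!in_itv]/= /andP[st te] _].
  by rewrite (lt_le_trans s0 st) (le_lt_trans te eT).
move=> z zB; rewrite /time_tensor.
have [z1|/e0->] := boolP (z.1 \in `[s, e]); last by rewrite mul0r.
have [x0|/a0 h] := boolP (z.2.1.1 \in `[l.1.1, u.1.1]); last by rewrite /tensor h !mul0r mulr0.
have [x1|/b0 h] := boolP (z.2.1.2 \in `[l.1.2, u.1.2]); last by rewrite /tensor h mulr0 mul0r mulr0.
have [x2|/c0 h] := boolP (z.2.2 \in `[l.2, u.2]); last by rewrite /tensor h !mulr0.
by case: zB; split.
Qed.

Lemma pairing_split T f (k : R -> R) (psi : E -> R) (phi : R * E -> R) :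
  (forall t, t \in `[0, T] -> measurable_fun setT (f t)) -> measurable_fun setT psi ->
  (forall z, phi z = k z.1 * psi z.2) ->
  pairing T f phi = \int[leb]_(t in `[0, T]) (k t * \int[mu]_x (f t x * psi x)).
Proof.
move=> mf mpsi phiE; apply: eq_Rintegral => t /[!inE] tT.
rewrite -Rintegral_scale//; last by apply: measurable_funM => //; exact: mf.
by apply: eq_Rintegral => x _; rewrite phiE/= mulrCA.
Qed.

(** Separated test functions turn the balance law into the one-dimensional identity that
    [increment_bound] takes as input. *)
Lemma balance_tested T f (F : 'I_3 -> R -> E -> R) s e l u eta a b c :
  balance T f F (fun _ _ => 0) ->
  (forall t, t \in `[0, T] -> measurable_fun setT (f t)) ->
  (forall j t, t \in `[0, T] -> measurable_fun setT (F j t)) ->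
  0 < s -> e < T -> line_test s e eta ->
  line_test l.1.1 u.1.1 a -> line_test l.1.2 u.1.2 b -> line_test l.2 u.2 c ->
  \int[leb]_(t in `[0, T]) (derive1 eta t * \int[mu]_x (f t x * tensor a b c x)) =
  - \sum_j \int[leb]_(t in `[0, T]) (eta t * \int[mu]_x (F j t x * dtensor j a b c x)).
Proof.
move=> [_ _ _ bal] mf mF s0 eT te ta tb tc.
have [[se _] [sa _] [sb _] [sc _]] := And4 te ta tb tc.
have mc (h : R -> R) : smooth h -> measurable_fun setT h.
  by move=> sh; apply: continuous_measurable_fun; exact: smooth_continuous.
have := bal _ (time_tensor_test s0 eT te ta tb tc).
have -> : pairing T (fun _ _ => 0) (time_tensor eta a b c) = 0.
  rewrite /pairing /Rintegral integral0_eq// => t _; rewrite integral0_eq// => x _.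
  by rewrite mul0r.
rewrite (@pairing_split T f (derive1 eta) (tensor a b c)) => //; last 2 first.
- by apply: tensor_measurable; exact: mc.
- by move=> z; rewrite dt_time_tensor.
move=> /eqP; rewrite subr_eq0 eqr_oppLR => /eqP ->; congr (- _).
apply: eq_bigr => j _; apply: pairing_split => //.
- by move=> t; exact: mF.
- apply: tensor_measurable; case: ifP => _; apply: mc => //; exact: smooth_derive1.
- by move=> z; rewrite dx_time_tensor.
Qed.

Lemma sup_continuous_pairing T f l u K phi : sup_continuous T f -> 0 <= K ->
  dominated_on (box l u) K phi ->
  segment_continuous T (fun t => \int[mu]_x (f t x * phi x)).
Proof.
move=> cf K0 dphi t0 e t0T e0; have [mf fb fc] := cf.
set m := fine (mu (box l u)).
have m0 : 0 <= m by rewrite /m fine_ge0.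
have e'0 : 0 < e / (K * m + 1) by rewrite divr_gt0// ltr_pwDr// mulr_ge0.
have [d d0 df] := fc _ _ t0T e'0; exists d => // t tT td.
have [B B0 fB] := sup_continuous_bounded cf.
have int s : s \in `[0, T] -> mu.-integrable setT (EFin \o (fun x => f s x * phi x)).
  move=> sT; have [h _] := @dominated_Rintegral_bound _ _ R mu _ (measurable_box l u) K B
    (f s) phi (mu3_box_lty l u) B0 (mf s sT) (fB s sT) dphi.
  exact: h.
rewrite -RintegralB//; [|exact: int|exact: int].
under eq_Rintegral do rewrite -mulrBl.
have mfB : measurable_fun setT (f t \- f t0).
  by apply: measurable_funB; [exact: mf|exact: mf].
have [_] := @dominated_Rintegral_bound _ _ R mu _ (measurable_box l u) K _ _ phi
    (mu3_box_lty l u) (ltW e'0) mfB (df t tT td) dphi.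
by move=> /le_trans; apply; rewrite -mulrA mulrC ler_frac_succ// mulr_ge0.
Qed.

End BalanceLaws.

(** * Cutoffs at radius r and their gradients *)

Section Cutoff.
Variable R : realType.
Notation leb := (@lebesgue_measure R).
Notation mu := (@mu3 R).
Notation E := (R * R * R)%type.
Implicit Types (r s x : R).

Definition cut1 r x : R := @step R (- r^-1 * x + 2) * @step R (r^-1 * x + 2).

Lemma cut1_ge0 r x : 0 <= cut1 r x.
Proof. by rewrite mulr_ge0// step_ge0. Qed.

Lemma cut1_le1 r x : cut1 r x <= 1.
Proof. by rewrite -[leRHS]mulr1 ler_pM// ?step_ge0// step_le1. Qed.

Lemma cut1_in r x : 0 < r -> `|x| <= r -> cut1 r x = 1.
Proof.
move=> r0; rewrite ler_norml => /andP[xl xr].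
have h1 : - 1 <= r^-1 * x by rewrite mulrC ler_pdivlMr// mulN1r.
have h2 : r^-1 * x <= 1 by rewrite mulrC ler_pdivrMr// mul1r.
by rewrite /cut1 !step_right ?mulr1//; lra.
Qed.

Lemma cut1_out r x : 0 < r -> 2 * r <= `|x| -> cut1 r x = 0.
Proof.
move=> r0; rewrite ler_normr => /orP[|] h; rewrite /cut1.
- by rewrite step_left ?mul0r// mulNr addrC subr_le0 mulrC ler_pdivlMr.
- by rewrite [X in _ * X]step_left ?mulr0// -lerBrDr sub0r mulrC ler_pdivrMr//; lra.
Qed.

Lemma cut1_test r : 0 < r -> line_test (- (2 * r)) (2 * r) (cut1 r).
Proof.
move=> r0; split.
  by apply: smooth_mul; apply: smooth_comp_line; exact: step_smooth.
move=> x; rewrite in_itv/= -ler_norml -ltNge => /ltW; exact: cut1_out.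
Qed.

(** [cut1 s] is already 1 on the support of [cut1 r], whence the factor 2 between the radii. *)
Lemma cut1_le r s x : 0 < r -> 2 * r <= s -> cut1 r x <= cut1 s x.
Proof.
move=> r0 rs; have s0 : 0 < s by lra.
have [xr|/ltW rx] := leP `|x| (2 * r).
  by rewrite (cut1_in s0) ?cut1_le1// (le_trans xr).
by rewrite cut1_out// cut1_ge0.
Qed.

(** The derivative lives where |x| <= 2 r, and there [cut1 (2 * r)] is 1. Keeping this larger cutoff
    on the right lets a flux at radius r be estimated by the mass at radius 2 r. *)
Lemma cut1_derive : exists2 c : R, 0 <= c & forall r x, 0 < r ->
  `|derive1 (cut1 r) x| <= c / r * cut1 (2 * r) x.
Proof.
have [K K0 HK] := theta_bounded R; exists (2 * K); first by rewrite mulr_ge0.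
move=> r x r0; have r20 : 0 < 2 * r by rewrite mulr_gt0.
have [xr|rx] := leP `|x| (2 * r); last first.
  have [_ ->] := line_test_derive1 (cut1_test r0).
    by rewrite normr0 mulr_ge0 ?cut1_ge0// divr_ge0 ?mulr_ge0 ?(ltW r0).
  by rewrite in_itv/= -ler_norml -ltNge.
rewrite (cut1_in r20 xr) mulr1.
have s1 (c : R) : smooth (fun x : R => @step R (c * x + 2)).
  by apply: smooth_comp_line; exact: step_smooth.
have -> : derive1 (cut1 r) x =
    @step R (- r^-1 * x + 2) * (r^-1 * @theta R (r^-1 * x + 2)) +
    @step R (r^-1 * x + 2) * (- r^-1 * @theta R (- r^-1 * x + 2)).
  rewrite derive1E.
  have := deriveMf (1 : R) (fun x => smooth_differentiable x (s1 (- r^-1)))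
    (fun x => smooth_differentiable x (s1 (r^-1))).
  move=> /(congr1 (fun f => f x)) => h; apply: (etrans h) => /=.
  rewrite -!derive1E !derive1_comp_line; [|exact: step_smooth|exact: step_smooth].
  by rewrite derive1_step.
have aux (a b c : R) : `|a| <= 1 -> `|b| <= K -> `|c| = r^-1 -> `|a * (c * b)| <= K / r.
  move=> a1 bK cr; rewrite !normrM cr mulrCA [leRHS]mulrC ler_wpM2l//.
    by rewrite invr_ge0 ltW.
  by rewrite -[leRHS]mul1r ler_pM.
have sn y : `|@step R y| <= 1 by rewrite ger0_norm ?step_ge0// step_le1.
have ri : `|r^-1| = r^-1 by rewrite ger0_norm// invr_ge0 ltW.
have -> : 2 * K / r = K / r + K / r by rewrite -mulrA mulr_natl mulr2n.
apply: le_trans (ler_normD _ _) _; apply: lerD; apply: aux; rewrite ?normrN//.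
- exact: (HK _).1.
- exact: (HK _).1.
Qed.

Definition cutoff r : E -> R := tensor (cut1 r) (cut1 r) (cut1 r).
Definition dcutoff j r : E -> R := dtensor j (cut1 r) (cut1 r) (cut1 r).
Definition cbox r : set E := box (- (2 * r), - (2 * r), - (2 * r)) (2 * r, 2 * r, 2 * r).

Let cut1_mul_ge0 r x y : 0 <= cut1 r x * cut1 r y.
Proof. by apply: mulr_ge0; exact: cut1_ge0. Qed.

Lemma cutoff_ge0 r (x : E) : 0 <= cutoff r x.
Proof. by apply: mulr_ge0; [exact: cut1_mul_ge0|exact: cut1_ge0]. Qed.

Lemma cutoff_le1 r (x : E) : cutoff r x <= 1.
Proof.
have h y : 0 <= cut1 r y <= 1 by rewrite cut1_ge0 cut1_le1.
move: (h x.1.1) (h x.1.2) (h x.2); rewrite /cutoff /tensor.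
move: (cut1 r _) (cut1 r _) (cut1 r _) => a b d /andP[a0 a1] /andP[b0 b1] /andP[d0 d1].
by rewrite mulr_ile1 ?mulr_ge0// mulr_ile1.
Qed.

Lemma cutoff_le r s (x : E) : 0 < r -> 2 * r <= s -> cutoff r x <= cutoff s x.
Proof.
move=> r0 rs; have h y : cut1 r y <= cut1 s y by exact: cut1_le.
apply: ler_pM; [exact: cut1_mul_ge0|exact: cut1_ge0| |exact: h].
by apply: ler_pM; [exact: cut1_ge0|exact: cut1_ge0|exact: h|exact: h].
Qed.

Lemma cutoff_in r (x : E) : 0 < r -> `|x.1.1| <= r -> `|x.1.2| <= r -> `|x.2| <= r -> cutoff r x = 1.
Proof. by move=> r0 h0 h1 h2; rewrite /cutoff /tensor !cut1_in// !mulr1. Qed.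

Lemma cutoff_dominated r : 0 < r -> dominated_on (cbox r) 1 (cutoff r).
Proof.
move=> r0; have n1 x : `|cut1 r x| <= 1 by rewrite ger0_norm ?cut1_ge0// cut1_le1.
have := @tensor_dominated R (- (2 * r), - (2 * r), - (2 * r)) (2 * r, 2 * r, 2 * r)
  _ _ _ 1 1 1 (cut1_test r0) (cut1_test r0) (cut1_test r0) n1 n1 n1.
by rewrite !mulr1.
Qed.

Lemma cutoff_measurable r : 0 < r -> measurable_fun setT (cutoff r).
Proof. by move=> /cutoff_dominated[]. Qed.

Lemma mu3_cbox r : 0 < r -> fine (mu (cbox r)) = (4 * r) ^+ 3.
Proof.
move=> r0; have h : - (2 * r) <= 2 * r by lra.
by rewrite mu3_box//=; ring.
Qed.

Lemma dcutoff_test j r : 0 < r -> test_function setT (dcutoff j r).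
Proof.
move=> r0; apply: (@dtensor_test R (- (2 * r), - (2 * r), - (2 * r)) (2 * r, 2 * r, 2 * r));
  exact: cut1_test.
Qed.

Lemma dcutoff_le : exists2 c : R, 0 <= c & forall j r (x : E), 0 < r ->
  `|dcutoff j r x| <= c / r * cutoff (2 * r) x.
Proof.
have [c c0 hc] := cut1_derive; exists c => // j r x r0.
have cl (y : R) : `|cut1 r y| <= cut1 (2 * r) y.
  by rewrite ger0_norm ?cut1_ge0// cut1_le.
have aux (a a' b b' d d' : R) : `|a| <= c / r * a' -> `|b| <= b' -> `|d| <= d' ->
    `|a| * `|b| * `|d| <= c / r * (a' * b' * d').
  by move=> ha hb hd; rewrite !mulrA ler_pM ?mulr_ge0// ler_pM.
rewrite /dcutoff /dtensor /cutoff /tensor !normrM; case: j => [[|[|[|]]]//= _].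
- by apply: aux; [exact: hc|exact: cl|exact: cl].
- rewrite -mulrA mulrCA mulrA [X in _ <= _ * (X * _)]mulrC.
  by apply: aux; [exact: hc|exact: cl|exact: cl].
- have rot (k A B D a b d : R) : D * A * B <= k * (d * a * b) -> A * B * D <= k * (a * b * d).
    have e (u v w : R) : w * u * v = u * v * w by ring.
    by rewrite (e A B D) (e a b d).
  exact: rot (aux _ _ _ _ _ _ (hc r x.2 r0) (cl x.1.1) (cl x.1.2)).
Qed.

End Cutoff.

(** * Propagation of the mass bound *)

Section CutoffBalance.
Variable R : realType.
Notation leb := (@lebesgue_measure R).
Notation mu := (@mu3 R).
Notation E := (R * R * R)%type.
Implicit Types (f : R -> E -> R) (r s t T : R).

Lemma cutoff_integrable (g : E -> R) (B r : R) : 0 < r -> 0 <= B -> measurable_fun setT g ->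
  ae_le g B -> mu.-integrable setT (EFin \o (fun x => g x * cutoff r x)) /\
  `|\int[mu]_x (g x * cutoff r x)| <= B * (4 * r) ^+ 3.
Proof.
move=> r0 B0 mg gB.
have [ig] := @dominated_Rintegral_bound _ _ R mu _ (measurable_box _ _) 1 B g _
  (mu3_box_lty _ _) B0 mg gB (cutoff_dominated r0).
by rewrite mulr1 (mu3_cbox r0).
Qed.

Lemma dcutoff_bound : exists2 c : R, 0 <= c & forall j r (F g : E -> R), 0 < r ->
  measurable_fun setT F -> {ae mu, forall x, `|F x| <= g x} ->
  mu.-integrable setT (EFin \o (fun x => g x * cutoff (2 * r) x)) ->
  `|\int[mu]_x (F x * dcutoff j r x)| <= c / r * \int[mu]_x (g x * cutoff (2 * r) x).
Proof.
have [c c0 hc] := dcutoff_le R; exists c => // j r F g r0 mF Fg ig.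
have md : measurable_fun setT (dcutoff j r).
  have mc : measurable_fun setT (cut1 r).
    by apply: continuous_measurable_fun; apply: smooth_continuous; case: (cut1_test r0).
  have mc' : measurable_fun setT (derive1 (cut1 r)).
    apply: continuous_measurable_fun; apply: smooth_continuous.
    by case: (line_test_derive1 (cut1_test r0)).
  by apply: tensor_measurable; case: ifP.
have -> : c / r * \int[mu]_x (g x * cutoff (2 * r) x) =
    \int[mu]_x (c / r * (g x * cutoff (2 * r) x)).
  by rewrite [RHS](RintegralZl _ _ ig).
apply: (@Rintegral_le_ae _ _ R mu).
- by apply: measurable_funM.
- by apply: (@integrable_scaler _ _ R mu _ measurableT); exact: ig.
- apply: ae_imp Fg => x Fx; rewrite normrM mulrCA.
  have g0 : 0 <= g x by apply: le_trans Fx.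
  by rewrite ler_pM// hc.
Qed.

Lemma cutoff_increment T f (F : 'I_3 -> R -> E -> R) r (c : R) : 0 < T -> 0 < r -> 0 <= c ->
  balance T f F (fun _ _ => 0) -> sup_continuous T f ->
  (forall j t, t \in `[0, T] -> measurable_fun setT (F j t)) ->
  (forall j t, 0 < t < T -> `|\int[mu]_x (F j t x * dcutoff j r x)| <= c) ->
  forall t, 0 < t < T ->
  `|\int[mu]_x (f t x * cutoff r x) - \int[mu]_x (f 0 x * cutoff r x)| <= 6 * c * T.
Proof.
move=> T0 r0 c0 bal cf mF Fc; have [mf _ _] := cf.
have sc : segment_continuous T (fun t => \int[mu]_x (f t x * cutoff r x)).
  exact: (sup_continuous_pairing cf ler01 (cutoff_dominated r0)).
apply: (increment_bound (G := fun j t => \int[mu]_x (F j t x * dcutoff j r x))) => //.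
- exact: segment_continuous_integrable.
- move=> j; have [_ LF _ _] := bal; have [mLF _ _] := LF j.
  by apply: mLF; exact: dcutoff_test.
- move=> s e eta s0 eT te.
  exact: (balance_tested (l := (- (2 * r), - (2 * r), - (2 * r))) (u := (2 * r, 2 * r, 2 * r))
    bal mf mF s0 eT te (cut1_test r0) (cut1_test r0) (cut1_test r0)).
Qed.

(* The bound A r^(n+1) on the mass in the ball of radius r for r >= 1 improves to
   A' r^n, and then to m0 since the flux is O(1 / r). *)
Lemma mass_le T (rho : R -> E -> R) (v : 'I_3 -> R -> E -> R) (m0 : R) : 0 < T ->
  balance T rho (fun j t x => rho t x * v j t x) (fun _ _ => 0) ->
  sup_continuous T rho -> (forall j, sup_continuous T (v j)) ->
  (forall t x, t \in `[0, T] -> 0 <= rho t x) ->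
  (forall r, 0 < r -> \int[mu]_x (rho 0 x * cutoff r x) <= m0) ->
  forall r t, 0 < r -> 0 < t < T -> \int[mu]_x (rho t x * cutoff r x) <= m0.
Proof.
move=> T0 bal crho cv rho0 m0P.
have [B B0 rhoB] := sup_continuous_bounded crho; have [mrho _ _] := crho.
have [U U0 vU] : exists2 U : R, 0 <= U & forall j t, t \in `[0, T] -> ae_le (v j t) U.
  have /choice[b hb] : forall j, exists b : R, 0 <= b /\ forall t, t \in `[0, T] -> ae_le (v j t) b.
    by move=> j; have [b b0 hb] := sup_continuous_bounded (cv j); exists b.
  exists (\sum_j b j); first by apply: sumr_ge0 => j _; exact: (hb j).1.
  move=> j t tT; apply: ae_le_trans ((hb j).2 t tT) _.
  by rewrite (bigD1 j)//= lerDl sumr_ge0// => i _; exact: (hb i).1.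
have mv j t : t \in `[0, T] -> measurable_fun setT (v j t) by have [mv _ _] := cv j; exact: mv.
have seg t : 0 < t < T -> t \in `[0, T] by rewrite in_itv/= => /andP[/ltW-> /ltW->].
pose M r t := \int[mu]_x (rho t x * cutoff r x).
have iM r t : 0 < r -> t \in `[0, T] -> mu.-integrable setT (EFin \o (fun x => rho t x * cutoff r x)).
  by move=> r0 tT; exact: (cutoff_integrable r0 B0 (mrho t tT) (rhoB t tT)).1.
have M0 r t : t \in `[0, T] -> 0 <= M r t.
  by move=> tT; apply: Rintegral_ge0 => x _; rewrite mulr_ge0 ?cutoff_ge0 ?rho0.
have T0in : 0 \in `[0, T] by rewrite in_itv/= lexx ltW.
have m00 : 0 <= m0 by apply: le_trans (M0 1 _ T0in) (m0P _ ltr01).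
have [c c0 hc] := dcutoff_bound.
have K0 : 0 <= 6 * c * U * T by rewrite !mulr_ge0// ltW.
(* The mass at radius 2 r controls the flux at radius r with a factor c U / r; the factor 6 T is
   that of [increment_bound]. *)
have step r (A : R) t : 0 < r -> 0 <= A -> (forall t, 0 < t < T -> M (2 * r) t <= A) -> 0 < t < T ->
    M r t <= m0 + 6 * c * U * T * A / r.
  move=> r0 A0 MA tT; have r20 : 0 < 2 * r by rewrite mulr_gt0.
  have cA0 : 0 <= c / r * (U * A) by rewrite !mulr_ge0// invr_ge0 ltW.
  have flux j s : 0 < s < T -> `|\int[mu]_x (rho s x * v j s x * dcutoff j r x)| <= c / r * (U * A).
    move=> sT; have sI := seg s sT.
    have iU : mu.-integrable setT (EFin \o (fun x => U * rho s x * cutoff (2 * r) x)).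
      have -> : (fun x => U * rho s x * cutoff (2 * r) x) = (fun x => U * (rho s x * cutoff (2 * r) x)).
        by apply/funext => x; rewrite mulrA.
      by apply: (@integrable_scaler _ _ R mu _ measurableT); exact: (iM _ _ r20 sI).
    have bd : {ae mu, forall x, `|rho s x * v j s x| <= U * rho s x}.
      apply: ae_imp (vU j s sI) => x vx; rewrite normrM (ger0_norm (rho0 _ _ sI)) mulrC.
      by rewrite ler_wpM2r ?rho0.
    have mF : measurable_fun setT (fun x => rho s x * v j s x).
      by apply: measurable_funM; [exact: mrho|exact: mv].
    apply: le_trans (hc j r _ _ r0 mF bd iU) _.
    rewrite ler_wpM2l ?divr_ge0 ?(ltW r0)//.
    have -> : \int[mu]_x (U * rho s x * cutoff (2 * r) x) = U * M (2 * r) s.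
      rewrite -[RHS](RintegralZl _ _ (iM _ _ r20 sI))//.
      by apply: eq_Rintegral => x _; rewrite mulrA.
    by rewrite ler_wpM2l// MA.
  have mF j s : s \in `[0, T] -> measurable_fun setT (fun x => rho s x * v j s x).
    by move=> sI; apply: measurable_funM; [exact: mrho|exact: mv].
  have := cutoff_increment T0 r0 cA0 bal crho mF flux tT.
  rewrite -/(M r t) -/(M r 0) => /ler_normlW; rewrite lerBlDr => /le_trans; apply.
  rewrite addrC lerD//; first exact: m0P.
  by rewrite le_eqVlt; apply/orP; left; apply/eqP; field; rewrite gt_eqF.
have growth n : (exists2 A : R, 0 <= A & forall r t, 1 <= r -> 0 < t < T -> M r t <= A * r ^+ n.+1) ->
    exists2 A : R, 0 <= A & forall r t, 1 <= r -> 0 < t < T -> M r t <= A * r ^+ n.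
  move=> [A A0 MA]; exists (m0 + 6 * c * U * T * (A * 2 ^+ n.+1)).
    by rewrite addr_ge0// mulr_ge0// mulr_ge0// exprn_ge0.
  move=> r t r1 tT; have r0 : 0 < r by exact: lt_le_trans r1.
  have r21 : 1 <= 2 * r by lra.
  have A'0 : 0 <= A * (2 * r) ^+ n.+1 by rewrite mulr_ge0// exprn_ge0// mulr_ge0// ltW.
  apply: le_trans (step r _ t r0 A'0 (fun t => MA _ t r21) tT) _.
  rewrite [leRHS]mulrDl; apply: lerD; first by rewrite ler_peMr// exprn_ege1.
  rewrite exprMn [r ^+ n.+1]exprSr le_eqVlt; apply/orP; left; apply/eqP; field.
  by rewrite gt_eqF.
have [A A0 MA] : exists2 A : R, 0 <= A & forall r t, 1 <= r -> 0 < t < T -> M r t <= A * r ^+ 0.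
  (* The start is the exponent 3: density at most B in a cube of side 4 r. Three rounds bring the
     exponent down to 0. *)
  apply: (growth 0%N _); apply: (growth 1%N _); apply: (growth 2%N _); exists (B * 4 ^+ 3).
    by rewrite mulr_ge0// exprn_ge0.
  move=> r t r1 tT; have r0 : 0 < r by exact: lt_le_trans r1.
  have [_] := cutoff_integrable r0 B0 (mrho t (seg _ tT)) (rhoB t (seg _ tT)).
  by move=> /ler_normlW; rewrite exprMn mulrA.
move=> r t r0 tT; rewrite -/(M r t); apply/ler_addgt0Pr => e e0.
set K := 6 * c * U * T in K0 step *.
(* One summand per requirement: s >= 1 for the uniform bound A, s >= 2 r for monotonicity of the
   cutoff, and K A / s <= e for the error. *)
pose s := 1 + 2 * r + K * A / e.
have KA0 : 0 <= K * A by rewrite mulr_ge0.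
have s1 : 1 <= s by rewrite /s -addrA lerDl addr_ge0 ?divr_ge0// ?mulr_ge0// ltW.
have rs : 2 * r <= s by rewrite /s addrAC lerDr addr_ge0// divr_ge0// ltW.
have s0 : 0 < s by exact: lt_le_trans s1.
have Mrs : M r t <= M s t.
  apply: le_Rintegral => //; [exact: iM (seg _ tT)|exact: iM (seg _ tT)|].
  by move=> x _; rewrite ler_wpM2l ?rho0 ?seg// cutoff_le.
have s21 : 1 <= 2 * s by rewrite (le_trans s1)// mulr_natl mulr2n lerDl ltW.
have MA1 t' : 0 < t' < T -> M (2 * s) t' <= A.
  by move=> t'T; have := MA (2 * s) t' s21 t'T; rewrite expr0 mulr1; apply.
apply: le_trans Mrs (le_trans (step s A t s0 A0 MA1 tT) _).
rewrite lerD2l ler_pdivrMr// [e * s]mulrC -ler_pdivrMr//.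
by rewrite /s lerDr addr_ge0// mulr_ge0// ltW.
Qed.

End CutoffBalance.

(** * Flux bounds and conservation of momentum *)

Section SquareIntegrable.
Context d (X : measurableType d) (R : realType) (mu : {measure set X -> \bar R}).

Lemma Lnorm2_sqr (f : X -> R) (e : R) : measurable_fun setT f ->
  (Lnorm mu 2%:E (EFin \o f) <= e%:E)%E ->
  mu.-integrable setT (EFin \o (fun x => f x ^+ 2)) /\ \int[mu]_x (f x ^+ 2) <= e ^+ 2.
Proof.
move=> mf fe; have e0 : 0 <= e by rewrite -lee_fin (le_trans (Lnorm_ge0 _ _ _) fe).
have mf2 : measurable_fun setT (fun x => f x ^+ 2) by apply: measurable_funX.
have I2 : (\int[mu]_x (f x ^+ 2)%:E <= (e ^+ 2)%:E)%E.
  have -> : (\int[mu]_x (f x ^+ 2)%:E)%E = (\int[mu]_x (`|(EFin \o f) x| `^ 2))%E.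
    apply: eq_integral => x _ /=.
    by rewrite powR_mulrn// real_normK// num_real.
  rewrite -poweR_Lnorm ?pnatr_eq0//.
  have -> : ((e ^+ 2)%:E = e%:E `^ 2)%E by rewrite poweR_EFin powR_mulrn.
  by rewrite gt0_ler_poweR// in_itv/= ?leey ?andbT ?lee_fin ?Lnorm_ge0.
have i2 : mu.-integrable setT (EFin \o (fun x => f x ^+ 2)).
  apply/integrableP; split; first exact/measurable_EFinP.
  apply: le_lt_trans (ltry (e ^+ 2)); apply: le_trans I2.
  rewrite le_eqVlt; apply/orP; left; apply/eqP; apply: eq_integral => x _ /=.
  by rewrite ger0_norm// sqr_ge0.
split=> //; rewrite -lee_fin fineK//; exact: (integrable_fin_num measurableT i2).
Qed.

End SquareIntegrable.

Section SystemBounds.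
Variable R : realType.
Notation leb := (@lebesgue_measure R).
Notation mu := (@mu3 R).
Notation E := (R * R * R)%type.

Lemma Lp2_sqr (f : E -> R) (e : R) : (Lp 2%:E f <= e%:E)%E ->
  mu.-integrable setT (EFin \o (fun x => f x ^+ 2)) /\ \int[mu]_x (f x ^+ 2) <= e ^+ 2.
Proof.
move=> fe; have mf := Lp_measurable fe; move: fe; rewrite /Lp asboolT//.
exact: (@Lnorm2_sqr _ _ R mu).
Qed.

Lemma Ct_Lp2_sqr (T : R) (w : R -> E -> R) : Ct T (Lp 2%:E) w ->
  exists C : R, forall t, t \in `[0, T] ->
    [/\ measurable_fun setT (w t), mu.-integrable setT (EFin \o (fun x => w t x ^+ 2)) &
        \int[mu]_x (w t x ^+ 2) <= C].
Proof.
move=> Cw.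
have sq t : t \in `[0, T] -> exists2 C : R, measurable_fun setT (w t) &
    mu.-integrable setT (EFin \o (fun x => w t x ^+ 2)) /\ \int[mu]_x (w t x ^+ 2) <= C.
  move=> tT; have [e e0 we] := in_space_lt (proj1 (Cw _ tT)) (Lp_ge0 _ _).
  by exists (e ^+ 2); [exact: Lp_measurable (ltW we)|exact: Lp2_sqr (ltW we)].
have [|C HC] := @segment_locally_bounded R 0 T (fun t C => \int[mu]_x (w t x ^+ 2) <= C)
    (fun t C D => @le_trans _ _ C _ D); last first.
  exists C => t tT; have [_ mw [iw _]] := sq t tT; split=> //; exact: HC.
move=> t0 t0T; have [C mw0 [iw0 wC]] := sq t0 t0T.
have [d d0 dw] := Ct_near Cw t0T ltr01.
(* From w^2 <= 2 (w - w0)^2 + 2 w0^2, where w - w0 has L^2 norm at most 1 near t0. *)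
exists d, (2 * 1 ^+ 2 + 2 * C); split=> // t tT td.
have [id dle] := Lp2_sqr (ltW (dw t tT td)).
have [_ mw [iw _]] := sq t tT.
have ig : mu.-integrable setT (EFin \o (fun x => 2 * (w t \- w t0) x ^+ 2 + 2 * w t0 x ^+ 2)).
  by apply: (@integrable_addr _ _ R mu _ measurableT);
    apply: (@integrable_scaler _ _ R mu _ measurableT).
apply: le_trans (_ : \int[mu]_x (2 * (w t \- w t0) x ^+ 2 + 2 * w t0 x ^+ 2) <= _).
  apply: le_Rintegral => // x _ /=; rewrite -subr_ge0.
  have -> : 2 * (w t x - w t0 x) ^+ 2 + 2 * w t0 x ^+ 2 - w t x ^+ 2 =
    (w t x - 2 * w t0 x) ^+ 2 by ring.
  exact: sqr_ge0.
rewrite [leLHS]RintegralD//; last 2 first.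
- by apply: (@integrable_scaler _ _ R mu _ measurableT).
- by apply: (@integrable_scaler _ _ R mu _ measurableT).
rewrite [X in X + _ <= _](RintegralZl _ _ id)// [X in _ + X <= _](RintegralZl _ _ iw0)//.
by rewrite lerD// ler_wpM2l.
Qed.

(** The choice [wD] is either a weak derivative, hence locally integrable, or the default 0. *)
Lemma wD_measurable s (f : E -> R) : measurable_fun setT (wD s f).
Proof.
rewrite /wD; case: xgetP => [g _ [_ [mg _] _] //|_]; exact: measurable_cst.
Qed.

Lemma flux_increment T f (F : 'I_3 -> R -> E -> R) (g : R -> E -> R) (G : R) : 0 < T -> 0 <= G ->
  balance T f F (fun _ _ => 0) -> sup_continuous T f ->
  (forall j t, t \in `[0, T] -> measurable_fun setT (F j t)) ->
  (forall j t, 0 < t < T -> {ae mu, forall x, `|F j t x| <= g t x}) ->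
  (forall r t, 0 < r -> 0 < t < T ->
    mu.-integrable setT (EFin \o (fun x => g t x * cutoff r x)) /\
    \int[mu]_x (g t x * cutoff r x) <= G) ->
  exists2 C, 0 <= C & forall r t, 0 < r -> 0 < t < T ->
    `|\int[mu]_x (f t x * cutoff r x) - \int[mu]_x (f 0 x * cutoff r x)| <= C / r.
Proof.
move=> T0 G0 bal cf mF Fg gG; have [c c0 hc] := dcutoff_bound R.
exists (6 * c * G * T); first by rewrite !mulr_ge0// ltW.
move=> r t r0 tT; have cr0 : 0 <= c / r by rewrite divr_ge0// ltW.
have -> : 6 * c * G * T / r = 6 * (c / r * G) * T by field; rewrite gt_eqF.
apply: (cutoff_increment T0 r0 _ bal cf mF _ tT); first by rewrite mulr_ge0.
move=> j s sT; have r20 : 0 < 2 * r by rewrite mulr_gt0.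
have sI : s \in `[0, T] by move: sT; rewrite in_itv/= => /andP[/ltW-> /ltW->].
have [ig gl] := gG _ _ r20 sT.
by apply: le_trans (hc j r _ _ r0 (mF j s sI) (Fg j s sT) ig) _; rewrite ler_wpM2l.
Qed.

Lemma viscous_product (delta r B d : R) : 0 < delta -> 0 < r <= B ->
  r `^ delta * `|d| <= B `^ delta * r + (r `^ ((delta - 1) / 2) * d) ^+ 2.
Proof.
move=> del0 /andP[r0 rB]; set w := r `^ ((delta - 1) / 2) * d.
have B0 : 0 < B by exact: lt_le_trans rB.
(* What remains of r^delta once the weight with exponent (delta - 1) / 2 goes to the gradient. Its
   square r^delta r keeps a full factor r, which the mass bound can integrate. *)
set a := r `^ ((delta + 1) / 2).
have rn : r != 0 by rewrite gt_eqF.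
have -> : r `^ delta * `|d| = a * `|w|.
  rewrite /w normrM (ger0_norm (powR_ge0 _ _)) mulrA -powRD ?rn ?implybT//.
  by congr (_ `^ _ * _); lra.
have a2 : a ^+ 2 = r `^ delta * r.
  rewrite -powR_mulrn ?powR_ge0// -powRrM.
  rewrite (_ : _ * _ = delta + 1); last by lra.
  by rewrite powRD ?rn ?implybT// powRr1// ltW.
apply: le_trans (_ : a ^+ 2 + w ^+ 2 <= _).
  rewrite -(@real_normK R w) ?num_real//; have := sqr_ge0 (a - `|w|).
  have : 0 <= a * `|w| by rewrite mulr_ge0// powR_ge0.
  by rewrite sqrrB; lra.
rewrite lerD2r a2 ler_wpM2r ?(ltW r0)//.
by apply: ge0_ler_powR; rewrite ?nnegrE ?(ltW del0) ?(ltW r0) ?(ltW B0).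
Qed.

End SystemBounds.

(** * Pointwise bound of the momentum flux *)

Section FluxBound.
Variable R : realType.
Implicit Types (p : params R) (d : 'I_3 -> 'I_3 -> R) (v : 'I_3 -> R).

(* [d k l] stands for the derivative of the k-th velocity component along l, and
   [s] for S / c_v. *)
Definition stress p d (i j : 'I_3) : R :=
  alpha p * (d i j + d j i) + (beta p * \sum_k d k k) *+ (i == j).

Definition flux p (r s : R) v d (i j : 'I_3) : R :=
  r * v i * v j + (i == j)%:R * (cA p * expR s * r `^ gamma p)
  - cA p `^ nu p * cR p `^ (- nu p) * (r `^ delta p * expR (s * nu p) * stress p d i j).

Lemma stress_le p d i j :
  `|stress p d i j| <= (2 * `|alpha p| + `|beta p|) * \sum_k \sum_l `|d k l|.
Proof.
have row k : 0 <= \sum_l `|d k l| by apply: sumr_ge0.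
have dle k l : `|d k l| <= \sum_k \sum_l `|d k l|.
  rewrite (bigD1 k)//= (bigD1 l)//= -addrA lerDl addr_ge0// sumr_ge0//.
rewrite mulrDl; apply: le_trans (ler_normD _ _) _; apply: lerD.
  have -> (D : R) : 2 * `|alpha p| * D = `|alpha p| * (D + D) by ring.
  by rewrite normrM ler_wpM2l// (le_trans (ler_normD _ _))// lerD.
have D0 : 0 <= \sum_k \sum_l `|d k l| by apply: sumr_ge0.
case: eqP => _; last by rewrite mulr0n normr0 mulr_ge0.
rewrite mulr1n normrM ler_wpM2l// (le_trans (ler_norm_sum _ _ _))//.
apply: ler_sum => k _; rewrite (bigD1 k)//= lerDl sumr_ge0//.
Qed.

Lemma powR_expR (s a : R) : expR (s * a) = expR s `^ a.
Proof. by rewrite /powR gt_eqF ?expR_gt0// expRK mulrC. Qed.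

Lemma flux_le p (B U e : R) : 1 < gamma p -> 0 < delta p -> 0 <= cA p -> 0 <= nu p ->
  exists C3 C2 : R, [/\ 0 <= C3, 0 <= C2 & forall r s v d i j,
    0 < r <= B -> (forall k, `|v k| <= U) -> expR s <= e ->
    `|flux p r s v d i j| <=
    C3 * r + C2 * \sum_k \sum_l (r `^ ((delta p - 1) / 2) * d k l) ^+ 2].
Proof.
move=> g1 d0 A0 nu0.
pose q := 2 * `|alpha p| + `|beta p|.
have q0 : 0 <= q by rewrite addr_ge0// mulr_ge0.
pose K := cA p `^ nu p * cR p `^ (- nu p).
have K0 : 0 <= K by rewrite mulr_ge0// powR_ge0.
pose C2 := K * (e `^ nu p * q).
have C20 : 0 <= C2 by rewrite mulr_ge0// mulr_ge0// powR_ge0.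
pose b := \sum_(k < 3) \sum_(l < 3) B `^ delta p.
have b0 : 0 <= b by apply: sumr_ge0 => k _; apply: sumr_ge0 => l _; exact: powR_ge0.
(* The three terms come from convection, pressure and viscosity, [b] collecting B^delta over the
   nine pairs (k, l). The absolute value of [e] makes the constant nonnegative before any s with
   [expR s <= e] is given. *)
exists (U ^+ 2 + cA p * `|e| * B `^ (gamma p - 1) + C2 * b), C2; split=> //.
  by rewrite !addr_ge0 ?sqr_ge0 ?mulr_ge0// powR_ge0.
move=> r s v d i j /andP[r0 rB] vU es.
have B0 : 0 < B by exact: lt_le_trans rB.
have e0 : 0 < e by apply: lt_le_trans es; exact: expR_gt0.
set W := \sum_k _.
have U0 : 0 <= U by apply: le_trans (vU 0).
have h1 : `|r * v i * v j| <= U ^+ 2 * r.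
  rewrite !normrM (gtr0_norm r0) -mulrA mulrC ler_wpM2r ?(ltW r0)//.
  by rewrite expr2 ler_pM.
have h2 : `|(i == j)%:R * (cA p * expR s * r `^ gamma p)| <= cA p * `|e| * B `^ (gamma p - 1) * r.
  have P0 : 0 <= cA p * expR s * r `^ gamma p by rewrite !mulr_ge0 ?expR_ge0 ?powR_ge0.
  apply: le_trans (_ : cA p * expR s * r `^ gamma p <= _).
    rewrite normrM (ger0_norm P0); case: (i == j); rewrite ?normr1 ?normr0 ?mul1r ?mul0r//.
  have -> : r `^ gamma p = r `^ (gamma p - 1) * r.
    rewrite -{3}(powRr1 (ltW r0)) -powRD ?(gt_eqF r0) ?implybT//.
    by congr (_ `^ _); lra.
  rewrite mulrA ler_wpM2r ?(ltW r0)// ler_pM ?mulr_ge0 ?expR_ge0 ?powR_ge0//.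
    by rewrite ler_wpM2l// (le_trans es)// ler_norm.
  by apply: ge0_ler_powR; rewrite ?nnegrE ?(ltW r0) ?(ltW B0)// subr_ge0 ltW.
have h3 : r `^ delta p * \sum_k \sum_l `|d k l| <= b * r + W.
  rewrite mulr_sumr mulr_suml -big_split/=; apply: ler_sum => k _.
  rewrite mulr_sumr mulr_suml -big_split/=; apply: ler_sum => l _.
  by apply: viscous_product => //; rewrite r0 rB.
have h4 : `|K * (r `^ delta p * expR (s * nu p) * stress p d i j)| <= C2 * (b * r + W).
  rewrite normrM (ger0_norm K0) /C2 -[leRHS]mulrA; apply: ler_wpM2l => //.
  rewrite !normrM (ger0_norm (powR_ge0 _ _)) (ger0_norm (expR_ge0 _)) powR_expR.
  apply: le_trans (_ : r `^ delta p * e `^ nu p * (q * \sum_k \sum_l `|d k l|) <= _).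
    rewrite ler_pM ?mulr_ge0 ?powR_ge0 ?stress_le//.
    rewrite ler_wpM2l ?powR_ge0//.
    by apply: ge0_ler_powR; rewrite ?nnegrE ?expR_ge0 ?(ltW e0).
  have -> (x y D : R) : x * y * (q * D) = y * q * (x * D) by ring.
  by rewrite ler_wpM2l ?mulr_ge0 ?powR_ge0.
rewrite /flux -/K; apply: le_trans (ler_normB _ _) _.
have -> : (U ^+ 2 + cA p * `|e| * B `^ (gamma p - 1) + C2 * b) * r + C2 * W =
  U ^+ 2 * r + cA p * `|e| * B `^ (gamma p - 1) * r + C2 * (b * r + W) by ring.
by rewrite lerD// (le_trans (ler_normD _ _))// lerD.
Qed.

End FluxBound.

Section SumIntegrable.
Context d (X : measurableType d) (R : realType) (mu : {measure set X -> \bar R}).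

Lemma sum_integrable_le (I : finType) (f : I -> X -> R) (C : I -> R) :
  (forall i, mu.-integrable setT (EFin \o f i) /\ \int[mu]_x f i x <= C i) ->
  mu.-integrable setT (EFin \o (fun x => \sum_i f i x)) /\
  \int[mu]_x (\sum_i f i x) <= \sum_i C i.
Proof.
move=> fC; elim: (index_enum I) => [|i s [IHi IHC]].
  rewrite big_nil; have -> : (fun x : X => \sum_(i <- [::]) f i x) = cst 0 by apply/funext => x; rewrite big_nil.
  split; first exact: integrable0.
  by rewrite /Rintegral integral0_eq.
have -> : (fun x : X => \sum_(j <- i :: s) f j x) = (fun x => f i x + \sum_(j <- s) f j x).
  by apply/funext => x; rewrite big_cons.
have [fi Ci] := fC i; rewrite big_cons.
split; first exact: (integrable_addr measurableT fi IHi).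
by rewrite RintegralD// lerD.
Qed.

End SumIntegrable.

Section Solution.
Variable R : realType.
Notation mu := (@mu3 R).
Notation E := (R * R * R)%type.
Implicit Types (p : params R) (T : R).

Lemma sup_continuous_ext T (F G : R -> E -> R) :
  (forall t, t \in `[0, T] -> F t = G t) -> sup_continuous T F -> sup_continuous T G.
Proof.
move=> FG [mF bF cF]; split.
- by move=> t tT; rewrite -FG//; exact: mF.
- by move=> t tT; rewrite -FG//; exact: bF.
move=> t0 e t0T e0; have [d d0 hd] := cF t0 e t0T e0; exists d => // t tT td.
by rewrite -!FG//; exact: hd.
Qed.

Lemma norm_mul_cutoff_le (a r : R) (x : E) : 0 <= a -> `|a * cutoff r x| <= a.
Proof.
move=> a0; have c0 := cutoff_ge0 r x; rewrite ger0_norm; last exact: mulr_ge0.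
by apply: ler_piMr => //; exact: cutoff_le1.
Qed.

Lemma powR_root (x a : R) : 0 <= x -> a != 0 -> (x `^ a) `^ a^-1 = x.
Proof. by move=> x0 a0; rewrite -powRrM mulfV// powRr1. Qed.

Variables (p : params R) (q T : R) (rho0 : E -> R) (u0 : E -> 'rV[R]_3) (S0 : E -> R).
Variables (rho : R -> E -> R) (u : R -> E -> 'rV[R]_3) (S : R -> E -> R).
Hypotheses (hA : 0 < cA p) (hR : 0 < cR p) (hgamma : 1 < gamma p) (hdelta : 0 < delta p < 1)
  (hgd : 4 * gamma p + 3 * delta p <= 7).
Hypotheses (data : admissible_data p q rho0 u0 S0) (T0 : 0 < T).
Hypothesis (sol : regular_solution p T rho0 u0 S0 rho u S).

Let g1 : gamma p - 1 != 0.
Proof. by rewrite subr_eq0 gt_eqF. Qed.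

(** As delta > 0, the condition on gamma and delta forces gamma - 1 < 3/4. *)
Let g1inv : 1 <= (gamma p - 1)^-1.
Proof.
by move: hdelta hgd hgamma => /andP[d0 d1] h g; rewrite invf_ge1; lra.
Qed.

Let nu0 : 0 < nu p.
Proof.
by move: hdelta => /andP[d0 _]; move: d0; rewrite /delta pmulr_rgt0 ?subr_gt0.
Qed.

Lemma density_sup_continuous : sup_continuous T rho.
Proof.
have [C1 C3] := rs_rho_gamma sol.
have pos t x : t \in `[0, T] -> 0 < rho t x `^ (gamma p - 1).
  by move=> tT; rewrite powR_gt0// (rs_rho_gt0 sol).
apply: sup_continuous_ext (sup_continuous_powR g1inv pos (D1star_sup_continuous C1 C3)) => t tT.
by apply/funext => x; rewrite powR_root// ltW// (rs_rho_gt0 sol).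
Qed.

Lemma velocity_sup_continuous i : sup_continuous T (fun t x => u t x 0 i).
Proof. by have [Cu _] := rs_u sol i; exact: Hn_sup_continuous. Qed.

(** Pressure and viscosity involve S only through e^(S / c_v) and its power nu, so an upper bound
    and measurability of this exponential are what the flux estimate asks for. *)
Lemma expS_bounded : exists e : R, forall t, t \in `[0, T] ->
  measurable_fun setT (fun x => expR (S t x / cv p)) /\
  {ae mu, forall x, expR (S t x / cv p) <= e}.
Proof.
have [C1 C3] := rs_expS sol; have sc := D1star_sup_continuous C1 C3.
have [B B0 hB] := sup_continuous_bounded sc; have [mS _ _] := sc.
exists (B + expR (Sbar p / cv p)) => t tT; split; last first.
  by apply: ae_imp (hB t tT) => x /ler_normlW; rewrite lerBlDr.
have -> : (fun x => expR (S t x / cv p)) =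
    (fun x => (expR (S t x / cv p) - expR (Sbar p / cv p)) + expR (Sbar p / cv p)).
  by apply/funext => x; rewrite subrK.
by apply: measurable_funD => //; exact: mS.
Qed.

Lemma initial_density_measurable : measurable_fun setT rho0.
Proof.
have [h _] := ad_rho_gamma data; have [e e0 De] := in_space_lt h (D1star_ge0 _).
have mf : measurable_fun setT (fun x => rho0 x `^ (gamma p - 1)).
  apply: (@Lp_measurable R 6%:E _ e); apply: le_trans (ltW De).
  by rewrite /D1star leeDl// Dn_ge0.
have -> : rho0 = (fun x => (rho0 x `^ (gamma p - 1)) `^ (gamma p - 1)^-1).
  by apply/funext => x; rewrite powR_root// ltW// (ad_rho_gt0 data).
exact: (measurableT_comp (measurable_powR _) mf).
Qed.

Hypothesis hmass : (mass rho0 < +oo)%E.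

Lemma initial_density_integrable : mu.-integrable setT (EFin \o rho0).
Proof.
apply/integrableP; split.
  by apply/measurable_EFinP; exact: initial_density_measurable.
apply: le_lt_trans hmass; rewrite le_eqVlt; apply/orP; left; apply/eqP.
by apply: eq_integral => x _ /=; rewrite gtr0_norm// (ad_rho_gt0 data).
Qed.

Let m0 : R := \int[mu]_x rho0 x.

Let zero_in : 0 \in `[0, T].
Proof. by rewrite in_itv/= lexx ltW. Qed.

Lemma cutoff_mass_le r t : 0 < r -> 0 < t < T -> \int[mu]_x (rho t x * cutoff r x) <= m0.
Proof.
have csol := density_sup_continuous; have [mrho _ _] := csol.
apply: (mass_le T0 (v := fun j t x => u t x 0 j) _ csol velocity_sup_continuous).
- exact: (rs_mass sol).
- by move=> s x sT; rewrite ltW// (rs_rho_gt0 sol).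
move=> {}r r0; apply: le_trans (ler_norm _) _.
apply: (@Rintegral_le_ae _ _ R mu).
- by apply: measurable_funM; [exact: mrho|exact: cutoff_measurable].
- exact: initial_density_integrable.
apply: ae_imp (rs_init sol) => x [-> _ _].
by apply: norm_mul_cutoff_le; exact: ltW (ad_rho_gt0 data x).
Qed.

(** The flux is dominated by C3 rho + C2 h, with h the sum of the squared weighted derivatives of u:
    [cutoff_mass_le] bounds the integral of the first term, the continuity in L^2 of [rs_gradu] that
    of the second, uniformly in time and radius. *)
Lemma cutoff_momentum_increment i : exists2 C : R, 0 <= C & forall r t, 0 < r -> 0 < t < T ->
  `|\int[mu]_x (rho t x * u t x 0 i * cutoff r x) -
    \int[mu]_x (rho 0 x * u 0 x 0 i * cutoff r x)| <= C / r.
Proof.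
have csol := density_sup_continuous; have [mrho _ _] := csol.
have [B B0 rhoB] := sup_continuous_bounded csol.
have mu_ k t : t \in `[0, T] -> measurable_fun setT (fun x => u t x 0 k).
  by have [mu_ _ _] := velocity_sup_continuous k; exact: mu_.
have [Umax U0 uU] : exists2 U : R, 0 <= U &
    forall k t, t \in `[0, T] -> ae_le (fun x => u t x 0 k) U.
  have /choice[b hb] : forall k, exists b : R, 0 <= b /\
      forall t, t \in `[0, T] -> ae_le (fun x => u t x 0 k) b.
    by move=> k; have [b b0 hb] := sup_continuous_bounded (velocity_sup_continuous k); exists b.
  exists (\sum_j b j); first by apply: sumr_ge0 => j _; exact: (hb j).1.
  move=> j t tT; apply: ae_le_trans ((hb j).2 t tT) _.
  by rewrite (bigD1 j)//= lerDl sumr_ge0// => k _; exact: (hb k).1.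
have [e eS] := expS_bounded.
pose w (k l : 'I_3) (t : R) (x : E) : R :=
  rho t x `^ ((delta p - 1) / 2) * wD [:: l] (fun y => u t y 0 k) x.
have /choice[W /= hW] : forall kl : 'I_3 * 'I_3, exists C : R, forall t, t \in `[0, T] ->
    [/\ measurable_fun setT (w kl.1 kl.2 t),
       mu.-integrable setT (EFin \o (fun x => w kl.1 kl.2 t x ^+ 2)) &
       \int[mu]_x (w kl.1 kl.2 t x ^+ 2) <= C].
  by move=> [k l]; exact: Ct_Lp2_sqr (rs_gradu sol k l).
have d0 : 0 < delta p by case/andP: hdelta.
have [C3 [C2 [C30 C20 hflux]]] := flux_le B Umax e hgamma d0 (ltW hA) (ltW nu0).
pose F j t x := flux p (rho t x) (S t x / cv p) (fun k => u t x 0 k)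
  (fun k l => wD [:: l] (fun y => u t y 0 k) x) i j.
pose h t x := \sum_(kl : 'I_3 * 'I_3) w kl.1 kl.2 t x ^+ 2.
pose g t x := C3 * rho t x + C2 * h t x.
have FE : (fun j t x => rho t x * u t x 0 i * u t x 0 j
        + (i == j)%:R * pressure p (rho t) (S t) x
        - cA p `^ nu p * cR p `^ (- nu p)
          * (visc p (rho t) (S t) x * Qu p (u t) x i j)) = F.
  apply/funext => j; apply/funext => t; apply/funext => x.
  by rewrite /F /flux /Qu /stress !mxE.
have bal := rs_momentum sol i; rewrite FE in bal.
have seg t : 0 < t < T -> t \in `[0, T] by rewrite in_itv/= => /andP[/ltW-> /ltW->].
have h0 t x : 0 <= h t x by apply: sumr_ge0 => kl _; exact: sqr_ge0.
have hint t : t \in `[0, T] -> mu.-integrable setT (EFin \o h t) /\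
    \int[mu]_x h t x <= \sum_kl W kl.
  move=> tT; apply: (@sum_integrable_le _ _ R mu) => kl.
  by have [_ ? ?] := hW kl t tT.
have m00 : 0 <= m0.
  by apply: Rintegral_ge0 => x _; rewrite ltW// (ad_rho_gt0 data).
have W0 : 0 <= \sum_kl W kl.
  by apply: le_trans (hint 0 zero_in).2; apply: Rintegral_ge0 => x _; exact: h0.
apply: (flux_increment (F := F) (g := g) (G := C3 * m0 + C2 * \sum_kl W kl) T0) => //.
- by rewrite addr_ge0// mulr_ge0.
- exact: sup_continuous_mul (velocity_sup_continuous i).
- move=> j t tT; have [mS _] := eS t tT; have mr := mrho t tT.
  have mpow a : measurable_fun setT (fun x => rho t x `^ a).
    exact: (measurableT_comp (measurable_powR _) mr).
  rewrite /F /flux; apply: measurable_funB.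
    apply: measurable_funD.
      by apply: measurable_funM; [apply: measurable_funM|]; rewrite //; exact: mu_.
    apply: measurable_funM => //; apply: measurable_funM; last exact: mpow.
    by apply: measurable_funM.
  apply: measurable_funM => //; apply: measurable_funM.
    apply: measurable_funM; first exact: mpow.
    under eq_fun do rewrite powR_expR.
    exact: (measurableT_comp (measurable_powR _) mS).
  rewrite /stress; apply: measurable_funD.
    apply: measurable_funM => //; apply: measurable_funD; exact: wD_measurable.
  case: (i == j) => /=; last exact: measurable_cst.
  apply: measurable_funM => //; apply: measurable_sum => k; exact: wD_measurable.
- move=> j t tT; have tI := seg t tT.
  have uall : {ae mu, forall x, forall k, `|u t x 0 k| <= Umax}.
    by apply: (ae_forall_countable (mu := mu)) => k; exact: uU k t tI.
  have [_ Se] := eS t tI.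
  have rS : {ae mu, forall x, `|rho t x| <= B /\ expR (S t x / cv p) <= e}.
    by apply: ae_imp2 (rhoB t tI) Se => x h1 h2; split.
  apply: ae_imp2 uall rS => x uk [rB Sle].
  have := hflux (rho t x) (S t x / cv p) (fun k => u t x 0 k)
    (fun k l => wD [:: l] (fun y => u t y 0 k) x) i j.
  have r0 : 0 < rho t x by exact: (rs_rho_gt0 sol).
  rewrite r0 (ler_normlW rB) => /(_ isT uk Sle).
  by rewrite /g /h -(pair_bigA _ (fun k l => w k l t x ^+ 2)).
- move=> r t r0 tT; have tI := seg t tT; have [ih hle] := hint t tI.
  have [ir _] := cutoff_integrable r0 B0 (mrho t tI) (rhoB t tI).
  have hc : forall x, `|h t x * cutoff r x| <= h t x.
    by move=> x; exact: norm_mul_cutoff_le.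
  have mh : measurable_fun setT (fun x => h t x * cutoff r x).
    apply: measurable_funM; last exact: cutoff_measurable.
    by have /integrableP[/measurable_EFinP mh _] := ih.
  have ihc : mu.-integrable setT (EFin \o (fun x => h t x * cutoff r x)).
    by apply: (@integrable_le _ _ R mu _ measurableT _ (h t)).
  have -> : (fun x => g t x * cutoff r x) =
      (fun x => C3 * (rho t x * cutoff r x) + C2 * (h t x * cutoff r x)).
    by apply/funext => x; rewrite /g; ring.
  have i3 : mu.-integrable setT (EFin \o (fun x => C3 * (rho t x * cutoff r x))).
    exact: (@integrable_scaler _ _ R mu _ measurableT _ _ ir).
  have i2 : mu.-integrable setT (EFin \o (fun x => C2 * (h t x * cutoff r x))).
    exact: (@integrable_scaler _ _ R mu _ measurableT _ _ ihc).
  split; first exact: (@integrable_addr _ _ R mu _ measurableT _ _ i3 i2).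
  rewrite [leLHS](@RintegralD _ _ R mu)//.
  rewrite [X in X + _ <= _](RintegralZl _ _ ir)// [X in _ + X <= _](RintegralZl _ _ ihc)//.
  apply: lerD; rewrite ler_wpM2l//; first exact: cutoff_mass_le.
  apply: le_trans hle; apply: le_Rintegral => // x _.
  by apply: le_trans (ler_norm _) _; exact: norm_mul_cutoff_le.
Qed.

End Solution.

(** * Decay of the velocity and the initial momentum *)

Section Decay.
Variable R : realType.
Notation mu := (@mu3 R).
Notation E := (R * R * R)%type.

Lemma enorm_ge_coord (v : 'rV[R]_3) i : `|v 0 i| <= enorm v.
Proof.
rewrite /enorm -sqrtr_sqr; apply: ler_wsqrtr.
rewrite /dot (bigD1 i)//= expr2 lerDl sumr_ge0// => j _; rewrite -expr2; exact: sqr_ge0.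
Qed.

(** The L^oo norm of the library is the essential supremum only on a space of positive measure. *)
Lemma mu3_setT_gt0 : (0 < mu setT)%E.
Proof.
have := @mu3_box R (0, 0, 0) (1, 1, 1); rewrite /= !ler01 => /(_ isT isT isT) b1.
have : (0 < ((1 - 0) * (1 - 0) * (1 - 0) : R)%:E)%E by rewrite lte_fin !subr0 !mulr1.
rewrite -b1 => b0; apply: (lt_le_trans b0).
by apply: le_measure => //; rewrite inE//; exact: measurable_box.
Qed.

Lemma sup_norm_coord (v : E -> 'rV[R]_3) (e : R) i : (sup_norm v <= e%:E)%E ->
  {ae mu, forall x, `|v x 0 i| <= e}.
Proof.
rewrite /sup_norm /Lp; case: asboolP => // _; rewrite unlock /= mu3_setT_gt0.
move=> /ess_supP; apply: ae_imp => x /=; rewrite lee_fin => h.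
by apply: le_trans (enorm_ge_coord _ i) (le_trans (ler_norm _) h).
Qed.

(** The decay enters the argument through a single positive time at which the sup norm is below
    e. *)
Lemma limf_esup_pinfty_near0 (f : R -> \bar R) (e : R) : limf_esup f +oo = 0%E -> 0 < e ->
  exists2 t, 0 < t & (f t <= e%:E)%E.
Proof.
move=> f0 e0; have : ((limf_esup f +oo)%R < e%:E)%E by rewrite f0 lte_fin.
rewrite limf_esupE => /ereal_inf_lt[_ [V [M [_ MV]] <-] /ltW le].
exists (`|M| + 1); first by rewrite ltr_pwDr.
apply: le_trans le; apply: ereal_sup_ubound; exists (`|M| + 1) => //.
by apply: MV; rewrite ltr_pwDr// ler_norm.
Qed.

Section Momentum.
Variables (p : params R) (q : R) (rho0 : E -> R) (u0 : E -> 'rV[R]_3) (S0 : E -> R).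
Variables (rho : R -> E -> R) (u : R -> E -> 'rV[R]_3) (S : R -> E -> R).
Hypotheses (hA : 0 < cA p) (hgamma : 1 < gamma p) (hdelta : 0 < delta p < 1)
  (hgd : 4 * gamma p + 3 * delta p <= 7).
Hypotheses (data : admissible_data p q rho0 u0 S0) (hmass : (mass rho0 < +oo)%E).
Hypothesis (sol : global_regular_solution p q rho0 u0 S0 rho u S).

(** At time t the cutoff momentum is at most e times the initial mass for every radius. It differs
    by C / r from the one at time 0, which converges to the initial momentum as r grows, dominated
    by U rho0. *)
Lemma momentum_le i (e : R) t : 0 <= e -> 0 < t -> (sup_norm (u t) <= e%:E)%E ->
  `|\int[mu]_x (rho0 x * u0 x 0 i)| <= e * \int[mu]_x rho0 x.
Proof.
(* T = t + 1 makes t an interior time, as the increment estimates ask. *)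
move=> e0 t0 ue; pose T := t + 1; have T0 : 0 < T by rewrite addr_gt0.
have tT : 0 < t < T by rewrite t0 ltrDl ltr01.
have tI : t \in `[0, T] by rewrite in_itv/= ltW// lerDl ler01.
have z0 : 0 \in `[0, T] by rewrite in_itv/= lexx ltW.
have [rs _] := sol T0.
have crho := density_sup_continuous hgamma hdelta hgd rs.
have cu := velocity_sup_continuous rs i.
have cm := sup_continuous_mul crho cu.
have [mrho _ _] := crho; have [mm _ _] := cm; have [mu_ _ _] := cu.
have [B B0 rhoB] := sup_continuous_bounded crho.
have [C0 C00 mB] := sup_continuous_bounded cm.
have [U U0 uU] := sup_continuous_bounded cu.
have irho := initial_density_integrable hgamma data hmass.
have [C C00' incr] := cutoff_momentum_increment hA hgamma hdelta hgd data T0 rs hmass i.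
have rpos x : 0 <= rho t x by rewrite ltW// (rs_rho_gt0 rs).
have Vt r : 0 < r -> `|\int[mu]_x (rho t x * u t x 0 i * cutoff r x)| <= e * \int[mu]_x rho0 x.
  move=> r0; have [ir _] := cutoff_integrable r0 B0 (mrho t tI) (rhoB t tI).
  apply: le_trans (_ : e * \int[mu]_x (rho t x * cutoff r x) <= _); last first.
    rewrite ler_wpM2l//.
    exact: (cutoff_mass_le hgamma hdelta hgd data T0 rs hmass r0 tT).
  rewrite -(RintegralZl _ _ ir)//.
  apply: (@Rintegral_le_ae _ _ R mu).
  - by apply: measurable_funM; [exact: mm|exact: cutoff_measurable].
  - exact: (@integrable_scaler _ _ R mu _ measurableT _ _ ir).
  apply: ae_imp (sup_norm_coord i ue) => x ux.
  move: (cutoff r x) (cutoff_ge0 r x) => c c0.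
  rewrite !normrM (ger0_norm (rpos x)) (ger0_norm c0).
  by rewrite mulrAC mulrC ler_wpM2r// mulr_ge0.
(* [harmonic n] is 1 / (n + 1), that is, 1 / r at the radius r = n + 1. *)
have V0 n : `|\int[mu]_x (rho 0 x * u 0 x 0 i * cutoff n.+1%:R x)| <=
    e * \int[mu]_x rho0 x + C * harmonic n.
  have n0 : 0 < n.+1%:R :> R by rewrite ltr0n.
  have := lerD (Vt _ n0) (incr _ _ n0 tT); apply: le_trans.
  rewrite distrC addrC; apply: le_trans (ler_normD _ _); rewrite subrK.
  exact: lexx.
have mu0 : measurable_fun setT (fun x => u0 x 0 i).
  have [e' e'0 he'] := in_space_lt (ad_u data i) (Hn_ge0 _ _).
  by have [[]] := Hn_sobolev he'.
have cut1 (x : E) : \forall n \near \oo, cutoff n.+1%:R x = 1.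
  near=> n; have h : forall y : R, `|y| <= n%:R -> `|y| <= n.+1%:R.
    by move=> y /le_trans; apply; rewrite ler_nat.
  by apply: cutoff_in => //; apply: h; near: n; exact: nbhs_infty_ger.
have lim : {ae mu, forall x, setT x ->
    rho 0 x * u 0 x 0 i * cutoff n.+1%:R x @[n --> \oo] --> rho0 x * u0 x 0 i}.
  apply: ae_imp (rs_init rs) => x [-> -> _] _; apply: cvg_near_cst.
  by near=> n; have -> : cutoff n.+1%:R x = 1; [near: n; exact: cut1|rewrite mulr1].
have dom : {ae mu, forall x, forall n : nat, setT x ->
    `|rho 0 x * u 0 x 0 i * cutoff n.+1%:R x| <= U * rho0 x}.
  apply: ae_imp2 (rs_init rs) (uU 0 z0) => x [-> _ _] ux n _.
  have r0 := ltW (ad_rho_gt0 data x).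
  rewrite mulrAC normrM mulrC; apply: ler_pM => //; exact: norm_mul_cutoff_le.
have mf n : measurable_fun setT (fun x => rho 0 x * u 0 x 0 i * cutoff n.+1%:R x).
  by apply: measurable_funM; [exact: mm|exact: cutoff_measurable].
have ml : measurable_fun setT (fun x => rho0 x * u0 x 0 i).
  by apply: measurable_funM => //; exact: (initial_density_measurable hgamma data).
have iU : mu.-integrable setT (EFin \o (fun x => U * rho0 x)).
  exact: (@integrable_scaler _ _ R mu _ measurableT _ _ irho).
have [_ cvg] := @Rdominated_cvg _ _ R mu setT _ _ _ measurableT mf ml lim iU dom.
have bound : e * \int[mu]_x rho0 x + C * harmonic n @[n --> \oo] --> e * \int[mu]_x rho0 x + C * 0.
  by apply: cvgD; [exact: cvg_cst|apply: cvgM; [exact: cvg_cst|exact: cvg_harmonic]].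
rewrite mulr0 addr0 in bound.
by apply: (ler_cvg_to (cvg_norm cvg) bound); apply: nearW => n; exact: V0.
Unshelve. all: by end_near. Qed.

End Momentum.
End Decay.

Theorem corollary1p1 (R : realType) (p : params R) (q : R)
    (rho0 : R * R * R -> R) (u0 : R * R * R -> 'rV[R]_3) (S0 : R * R * R -> R)
    (hA : 0 < cA p) (hR : 0 < cR p)
    (hgamma : 1 < gamma p) (hdelta : 0 < delta p < 1)
    (halpha : 0 < alpha p) (hbeta : 0 <= 2 * alpha p + 3 * beta p)
    (hgd : 4 * gamma p + 3 * delta p <= 7)
    (hq : 3 < q)
    (hdata : admissible_data p q rho0 u0 S0)
    (hcompat : exists g1 g2 g3 g4,
       [/\ L2_mx g1, L2_row g2, L2_mx g3, L2_mx g4 &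
           initial_compatibility p rho0 u0 S0 g1 g2 g3 g4])
    (hmass : (0 < mass rho0 < +oo)%E)
    (hmomentum : 0 < enorm (momentum rho0 u0)) :
  ~ exists rho u S,
      global_regular_solution p q rho0 u0 S0 rho u S /\
      limf_esup (fun t : R => sup_norm (u t)) +oo = 0%E.
Proof.
move=> [rho [u [S [sol decay]]]]; have /andP[_ mfin] := hmass.
have m0 : 0 <= \int[@mu3 R]_x rho0 x.
  by apply: Rintegral_ge0 => x _; rewrite ltW// (ad_rho_gt0 hdata).
(* With m the initial mass, a time where the sup norm is at most e / (m + 1) bounds the component by
   e. *)
have zero i : momentum rho0 u0 0 i = 0.
  apply/eqP; rewrite -normr_le0; apply/ler_addgt0Pr => e e0; rewrite add0r mxE.
  have e1 : 0 < e / (\int[@mu3 R]_x rho0 x + 1) by rewrite divr_gt0// ltr_pwDr.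
  have [t t0 ut] := limf_esup_pinfty_near0 decay e1.
  apply: le_trans (momentum_le hA hgamma hdelta hgd hdata mfin sol i (ltW e1) t0 ut) _.
  by rewrite mulrC ler_frac_succ.
move: hmomentum; rewrite /enorm /dot big1 ?sqrtr0 ?ltxx// => i _.
by rewrite zero mul0r.
Qed.
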